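(* Let $d\ge2$, $1\le q,\tilde q<\infty$, $2\le r,\tilde r\le\infty$ and $1\le p<\infty$. If the estimate $$\bigg\|\int_{\mathbb{R}}e^{i(t-s)\sqrt{-\Delta}}F(s,\cdot)\,\mathrm{d}s\bigg\|_{L^{q,p}_tL^r_x}\lesssim\|F\|_{L^{\tilde q'}_tL^{\tilde r'}_x}$$ holds (with implicit constant independent of $F$) for all $F$ whose spatial Fourier support is compactly supported away from zero, then $$\frac1q<(d-1)\Big(\frac12-\frac1r\Big).$$
   Context: Functions are on $\mathbb{R}\times\mathbb{R}^d$, with time variable $t\in\mathbb{R}$ and space variable $x\in\mathbb{R}^d$. $e^{it\sqrt{-\Delta}}$ is the Fourier multiplier operator in $x$ with symbol $e^{it|\xi|}$. The spatial Fourier support of $F$ refers to the support in $\xi$ of the Fourier transform of $F(t,x)$ in the $x$ variable only; the condition says it is contained in a compact subset of $\mathbb{R}^d\setminus\{0\}$. Primes denote conjugate exponents ($\frac1a+\frac1{a'}=1$). $A\lesssim B$ means $A\le CB$ for some constant $C>0$. $\|G\|_{L^{a}_tL^{b}_x}$ is the $L^{a}(\mathbb{R})$ norm of $t\mapsto\|G(t,\cdot)\|_{L^{b}(\mathbb{R}^d)}$, and $\|G\|_{L^{q,p}_tL^r_x}$ is the norm in the Lorentz space $L^{q,p}(\mathbb{R})$ of the function $g(t)=\|G(t,\cdot)\|_{L^r(\mathbb{R}^d)}$, which up to a constant factor is $\big(\int_0^\infty\lambda^{p}\,|\{t:g(t)>\lambda\}|^{p/q}\,\frac{\mathrm{d}\lambda}{\lambda}\big)^{1/p}$.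 *)

(* Defs.v *)
From HB Require Import structures.
From mathcomp Require Import all_boot all_order all_algebra complex.
From mathcomp Require Import all_classical all_reals all_analysis.

Set Implicit Arguments.
Unset Strict Implicit.
Unset Printing Implicit Defensive.
Import Order.TTheory GRing.Theory Num.Theory.
Import numFieldNormedType.Exports.

Local Open Scope classical_set_scope.
Local Open Scope ring_scope.

(* R^n is 'rV[R]_n, with the sigma-algebra generated by the coordinates
   (the Borel one) and the library's product topology.                       *)
Definition measure_rV_display : measure_display -> measure_display.
Proof. exact. Qed.

Section measurable_rV.
Context {d} {T : measurableType d} (n : nat).

Let coors : 'I_n -> 'rV[T]_n -> T := fun i v => v ord0 i.

Let rV_set0 : g_sigma_preimage coors set0.
Proof. exact: sigma_algebra0. Qed.

Let rV_setC A : g_sigma_preimage coors A -> g_sigma_preimage coors (~` A).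
Proof. exact: sigma_algebraC. Qed.

Let rV_bigcup (F : _^nat) : (forall i, g_sigma_preimage coors (F i)) ->
  g_sigma_preimage coors (\bigcup_i (F i)).
Proof. exact: sigma_algebra_bigcup. Qed.

HB.instance Definition _ := @isMeasurable.Build (measure_rV_display d)
  'rV[T]_n (g_sigma_preimage coors) rV_set0 rV_setC rV_bigcup.

Lemma measurable_coord (i : 'I_n) :
  measurable_fun [set: 'rV[T]_n] (fun v : 'rV[T]_n => v ord0 i).
Proof.
move=> _ Y mY; rewrite setTI; apply: sub_sigma_algebra => /=.
rewrite -bigcup_seq/=; exists i => /=; first by rewrite mem_index_enum.
by exists Y => //; rewrite setTI.
Qed.

Lemma measurable_fun_rVP d' (X : measurableType d') (f : X -> 'rV[T]_n) :
  (forall i, measurable_fun [set: X] (fun x => f x ord0 i)) ->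
  measurable_fun [set: X] f.
Proof.
move=> mf _ A mA; rewrite setTI; move: A mA.
suff : g_sigma_preimage coors `<=` [set A | measurable (f @^-1` A)] by [].
apply: smallest_sub.
  split => /=.
  - by rewrite preimage_set0.
  - by move=> A mA; rewrite setTD preimage_setC; exact: measurableC.
  - by move=> F mF; rewrite preimage_bigcup; exact: bigcup_measurable.
rewrite -bigcup_seq => A [i _ [B mB <-]] /=.
rewrite setTI -comp_preimage -[X in measurable X]setTI.
exact: mf.
Qed.

End measurable_rV.

Section lebesgue_rV.
Context {R : realType}.

Definition cons_rV n (z : R * 'rV[R]_n) : 'rV[R]_n.+1 :=
  row_mx (const_mx z.1 : 'rV[R]_1) z.2.

Definition uncons_rV n (v : 'rV[R]_n.+1) : R * 'rV[R]_n :=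
  (v ord0 ord0, rsubmx (v : 'rV[R]_(1 + n))).

Lemma uncons_rVK n : cancel (@uncons_rV n) (@cons_rV n).
Proof.
move=> v; rewrite /cons_rV /uncons_rV /=.
rewrite -[RHS](@hsubmxK R 1 1 n v).
rewrite (_ : const_mx _ = lsubmx (v : 'rV[R]_(1 + n)))//.
apply/rowP => i; rewrite !mxE; congr (fun_of_matrix v _ _); apply/val_inj => /=.
by rewrite ord1.
Qed.

Lemma cons_rVK n : cancel (@cons_rV n) (@uncons_rV n).
Proof.
move=> [x v]; rewrite /cons_rV /uncons_rV /= row_mxKr; congr pair.
transitivity (row_mx (const_mx x : 'rV[R]_1) v ord0 (lshift n ord0)).
  by congr (fun_of_matrix _ _ _); exact/val_inj.
by rewrite row_mxEl mxE.
Qed.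

Lemma measurable_cons_rV n : measurable_fun setT (@cons_rV n).
Proof.
apply: measurable_fun_rVP => i.
have [j ->|j ->] := split_ordP (i : 'I_(1 + n)).
  apply: (eq_measurable_fun fst) => // z _.
  exact: (esym (etrans (row_mxEl _ _ _ _) (mxE _ _ _ _))).
apply: (eq_measurable_fun (fun z : R * 'rV[R]_n => z.2 ord0 j)) => [z _|].
  exact: (esym (row_mxEr _ _ _ _)).
exact: (measurableT_comp (measurable_coord j)).
Qed.

Lemma measurable_uncons_rV n : measurable_fun setT (@uncons_rV n).
Proof.
apply: measurable_fun_pair; first exact: measurable_coord.
apply: measurable_fun_rVP => i.
apply: (eq_measurable_fun (fun v : 'rV[R]_n.+1 =>
  v ord0 (rshift 1 i : 'I_n.+1))) => [v _|]; first by rewrite mxE.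
exact: measurable_coord.
Qed.


Section cons_lebesgue.
Variables (n : nat) (m : {sigma_finite_measure set 'rV[R]_n -> \bar R}).

Definition cons_lebesgue : set 'rV[R]_n.+1 -> \bar R :=
  pushforward (@lebesgue_measure R \x m)%E (@cons_rV n).

Let cons_lebesgue0 : cons_lebesgue set0 = 0%E.
Proof. by rewrite /cons_lebesgue /pushforward preimage_set0 measure0. Qed.

Let cons_lebesgue_ge0 A : (0 <= cons_lebesgue A)%E.
Proof. by rewrite /cons_lebesgue /pushforward; exact: measure_ge0. Qed.

Let cons_lebesgue_sigma_additive : semi_sigma_additive cons_lebesgue.
Proof.
move=> F mF tF mUF; rewrite /cons_lebesgue /pushforward preimage_bigcup.
apply: measure_semi_sigma_additive.
- by move=> k; rewrite -[X in measurable X]setTI; exact: measurable_cons_rV.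
- apply/trivIsetP => /= i j _ _ ij; rewrite -preimage_setI.
  by move/trivIsetP : tF => /(_ _ _ _ _ ij) ->//; rewrite preimage_set0.
- rewrite -preimage_bigcup -[X in measurable X]setTI.
  exact: measurable_cons_rV.
Qed.

HB.instance Definition _ := isMeasure.Build _ _ _ cons_lebesgue
  cons_lebesgue0 cons_lebesgue_ge0 cons_lebesgue_sigma_additive.

Let cons_lebesgue_sigma_finite : sigma_finite setT cons_lebesgue.
Proof.
have /sigma_finiteP[F [TF ndF Foo]] := sigma_finiteT (@lebesgue_measure R).
have /sigma_finiteP[G [TG ndG Goo]] := sigma_finiteT m.
have E A : @cons_rV n @^-1` (@uncons_rV n @^-1` A) = A.
  by apply/seteqP; split => z /=; rewrite cons_rVK.
exists (fun k => @uncons_rV n @^-1` (F k `*` G k)).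
  rewrite -preimage_bigcup (_ : \bigcup_k _ = setT) ?preimage_setT//.
  rewrite -subTset => -[x v] _.
  have : setT x by []; rewrite TF => -[i _ Fix].
  have : setT v by []; rewrite TG => -[j _ Gjv].
  exists (maxn i j) => //; split => /=.
  - by move: x Fix; exact/subsetPset/ndF/leq_maxl.
  - by move: v Gjv; exact/subsetPset/ndG/leq_maxr.
move=> k; have [mF Fk] := Foo k; have [mG Gk] := Goo k; split.
  rewrite -[X in measurable X]setTI; apply: measurable_uncons_rV => //.
  exact: measurableX.
rewrite /cons_lebesgue /pushforward E product_measure1E//.
by rewrite lte_mul_pinfty// ge0_fin_numE.
Qed.

HB.instance Definition _ := Measure_isSigmaFinite.Build _ _ _ cons_lebesgue
  cons_lebesgue_sigma_finite.

End cons_lebesgue.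

Fixpoint lebesgue_rV n : {sigma_finite_measure set 'rV[R]_n -> \bar R} :=
  if n is n'.+1 then cons_lebesgue (lebesgue_rV n')
  else @dirac _ 'rV[R]_0 0 R.

End lebesgue_rV.

Section complex_integral.
Context {R : realType} {d} {T : measurableType d}.
Implicit Type f : T -> R[i].

(* R[i] carries no measurable structure; these notions are componentwise.    *)
Definition cmeasurable f :=
  measurable_fun setT (fun x => complex.Re (f x)) /\
  measurable_fun setT (fun x => complex.Im (f x)).

Variable mu : {measure set T -> \bar R}.

Definition cintegrable f :=
  mu.-integrable setT (fun x => (complex.Re (f x))%:E) /\
  mu.-integrable setT (fun x => (complex.Im (f x))%:E).

Definition cintegral f : R[i] :=
  Complex (\int[mu]_x complex.Re (f x)) (\int[mu]_x complex.Im (f x)).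

Definition cLnorm (p : \bar R) f : \bar R :=
  Lnorm mu p (fun x => (Normc.normc (f x))%:E).

End complex_integral.

Section fourier.
Context {R : realType} {n : nat}.
Implicit Types (x xi : 'rV[R]_n) (f g phi : 'rV[R]_n -> R[i]).

Definition dotv x xi : R := \sum_(i < n) x ord0 i * xi ord0 i.

(* The library norm on 'rV[R]_n is the sup norm. *)
Definition enorm xi : R := Num.sqrt (dotv xi xi).

Definition expi (a : R) : R[i] := Complex (cos a) (sin a).

Definition fourier f xi : R[i] :=
  cintegral (lebesgue_rV n) (fun x => expi (- dotv x xi) * f x).

Definition inv_fourier g x : R[i] :=
  real_complex R ((2 * pi) ^- n) *
  cintegral (lebesgue_rV n) (fun xi => expi (dotv x xi) * g xi).

(* g is the Fourier transform of f in the sense of distributions,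
   <g, phi> = <f, fourier phi>, the class of test functions (integrable with
   integrable transform) containing the Schwartz class.  When f is integrable
   this is fourier f; the duality is needed because f is only assumed to lie in
   some L^a with 1 <= a <= 2.  Requiring g to be integrable is no restriction
   for such an f with compact Fourier support, by Hausdorff-Young.           *)
Definition is_fourier f g :=
  cintegrable (lebesgue_rV n) g /\
  forall phi, cintegrable (lebesgue_rV n) phi ->
    cintegrable (lebesgue_rV n) (fourier phi) ->
    cintegral (lebesgue_rV n) (fun xi => g xi * phi xi) =
    cintegral (lebesgue_rV n) (fun x => f x * fourier phi x).

(* e^{i tau sqrt(-Delta)} f, as a function of the Fourier transform g of f.  *)
Definition half_wave (tau : R) g : 'rV[R]_n -> R[i] :=
  inv_fourier (fun xi => expi (tau * enorm xi) * g xi).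

End fourier.

Section spacetime.
Context {R : realType} {n : nat}.
Implicit Types (F Fhat : R -> 'rV[R]_n -> R[i]) (g : R -> \bar R).

Local Notation mu := (@lebesgue_measure R).

Definition mixed_norm (a b : \bar R) F : \bar R :=
  Lnorm mu a (fun t => cLnorm (lebesgue_rV n) b (F t)).

Definition lorentz_norm (q p : R) g : \bar R :=
  ((\int[mu]_(l in `]0%R, +oo[) ((l `^ p)%:E
     * mu [set t | (l%:E < g t)%E] `^ (p / q) * (l^-1)%:E)) `^ p^-1)%E.

Definition lorentz_mixed_norm (q p : R) (r : \bar R) F : \bar R :=
  lorentz_norm q p (fun t => cLnorm (lebesgue_rV n) r (F t)).

Definition is_spatial_fourier F Fhat :=
  cmeasurable (fun z => Fhat z.1 z.2) /\
  \forall t \ae mu, is_fourier (F t) (Fhat t).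

Definition spatial_support_compact_away0 Fhat :=
  exists K : set 'rV[R]_n, [/\ compact K, ~ K 0 &
    \forall t \ae mu, \forall xi \ae lebesgue_rV n,
      ~ K xi -> Fhat t xi = 0].

Definition duhamel Fhat (t : R) (x : 'rV[R]_n) : R[i] :=
  cintegral mu (fun s => half_wave (t - s) (Fhat s) x).

(* A function in L^a_t need not be integrable in t, so the convergence of the
   time integral is a requirement on F.                                      *)
Definition duhamel_converges Fhat := forall t x,
  cintegrable mu (fun s => half_wave (t - s) (Fhat s) x).

End spacetime.

(* Main.v *)
(* Suppose 1/q >= a := (d-1)(1/2 - 1/r).  Take F(s, x) = 1_[0,delta](s) f(x),
   where f is a modulated Fejer kernel, so that its Fourier transform g is
   nonnegative, explicit and supported in [2,4]^d, and write D(t) for the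
   Duhamel integral of F.  With z = 1 + i t, the function
     h(x) = int_R |y|^d exp(-(z + |x|^2/z) y^2) dy
   has Fourier transform kappa(z) exp(-z |xi|), because of the Gaussian
   transform formula and the Cauchy-Schloemilch substitution.  In the pairing of
   h with D(t) the factor exp(-i t |xi|) cancels the propagator, hence this
   pairing is (2 pi)^-d kappa(z) K with K <> 0 independent of t, and
   |kappa(z)| = c |z|^((d-1)/2).  Moreover h is bounded and, being concentrated
   near the cone |x| = t, has L^1 norm O(t^(d-1)); so by Hoelder
   ||D(t)||_r >= c t^(-a) for all t >= 1.  Then |{t : ||D(t)||_r > l}| is at least
   of the order of l^(-q) as l -> 0, and the Lorentz integral of D diverges like
   the integral of dl / l at 0, whatever p < oo, although F has finite norm. *)
From HB Require Import structures.
Require Import Defs.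
From mathcomp Require Import all_boot all_order all_algebra complex.
From mathcomp Require Import all_classical all_reals all_analysis.
From mathcomp Require Import measurable_realfun ess_sup_inf ring lra.
Set Implicit Arguments.
Unset Strict Implicit.
Unset Printing Implicit Defensive.
Import Order.TTheory GRing.Theory Num.Theory.
Import numFieldNormedType.Exports.
Local Open Scope classical_set_scope.
Local Open Scope ring_scope.

Local Notation normc := (@Normc.normc _).

(** Up to a factor depending on z alone, [h] is the Poisson kernel z / (z^2 + |x|^2)^((d+1)/2)
    continued to complex height z; this is where the transform exp(-z |xi|) comes from. At height i
    t the kernel would be singular on the light cone; the real part 1 of z makes all integrals
    absolutely convergent, at the price of a factor exp(-|xi|) in K. Writing the kernel as a
    Gaussian moment trades complex powers and their branches for integrals. The obstacle is
    uniformity in t. With w = z + |x|^2/z, absolute values inside the moment yield powers of Re w,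
    while both the size of [h] and that of kappa must be measured by |w| and |z|. For the Gaussian
    integral J this is repaired by the exact identity |J(w)|^2 |w| = pi, obtained from a double
    integral of J(w) times its conjugate, and integration by parts carries the bound to higher
    moments. The L^1 norm of [h] is then a race between two powers over dyadic shells of parameter L
    = 2^k around the cone: volume grows like L^(d/2), [h] decays like L^(-(d+1)/2), and the spare
    L^(-1/2) makes the sum converge. *)

HB.lock Definition cexp {R : realType} (z : R[i]) : R[i] :=
  (expR (complex.Re z))%:C%C * expi (complex.Im z).
Canonical cexp_unlockable := Unlockable cexp.unlock.

(** * Complex-valued integrals *)

Section complex_exponential.
Context {R : realType}.
Implicit Types (z w : R[i]) (a : R).

Lemma normc_ge0 z : 0 <= normc z.
Proof. by case: z => a b; exact: sqrtr_ge0. Qed.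

Lemma normc_sqr z : normc z ^+ 2 = complex.Re z ^+ 2 + complex.Im z ^+ 2.
Proof. by case: z => a b /=; rewrite sqr_sqrtr// addr_ge0// sqr_ge0. Qed.

Lemma normc_Re z : `|complex.Re z| <= normc z.
Proof.
rewrite -(@ler_pXn2r _ 2)// ?nnegrE ?normc_ge0// normc_sqr real_normK
  ?num_real//.
by rewrite lerDl sqr_ge0.
Qed.

Lemma normc_Im z : `|complex.Im z| <= normc z.
Proof.
rewrite -(@ler_pXn2r _ 2)// ?nnegrE ?normc_ge0// normc_sqr real_normK
  ?num_real//.
by rewrite lerDr sqr_ge0.
Qed.

Lemma normc_le_ReIm z : normc z <= `|complex.Re z| + `|complex.Im z|.
Proof.
rewrite -(@ler_pXn2r _ 2)// ?nnegrE ?normc_ge0 ?addr_ge0// normc_sqr.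
rewrite sqrrD !real_normK ?num_real// addrAC lerDl.
by rewrite mulrn_wge0// mulr_ge0.
Qed.

Lemma normc_real a : normc (a%:C)%C = `|a|.
Proof. by rewrite /= expr0n/= addr0 sqrtr_sqr. Qed.

Lemma normc_prod (I : finType) (F : I -> R[i]) :
  normc (\prod_i F i) = \prod_i normc (F i).
Proof.
by elim/big_ind2 : _ => [|x a y b <- <-|//];
  [exact: Normc.normc1|exact: Normc.normcM].
Qed.

Lemma normcX z n : normc (z ^+ n) = normc z ^+ n.
Proof.
elim: n => [|n IH]; first by rewrite !expr0 Normc.normc1.
by rewrite !exprS Normc.normcM IH.
Qed.

Lemma normc_expi a : normc (expi a) = 1.
Proof. by rewrite /= cos2Dsin2 sqrtr1. Qed.

Lemma expiD a b : expi (a + b) = expi a * expi b :> R[i].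
Proof.
by rewrite /expi cosD sinD; apply/eqP; rewrite eq_complex/= eqxx addrC eqxx.
Qed.

Lemma expi0 : expi 0 = 1 :> R[i].
Proof. by rewrite /expi cos0 sin0. Qed.

Lemma cexpE z : cexp z = (expR (complex.Re z))%:C%C * expi (complex.Im z).
Proof. by rewrite unlock. Qed.

Lemma cexpD z w : cexp (z + w) = cexp z * cexp w.
Proof.
case: z w => a b [c d]; rewrite !cexpE/= expRD expiD rmorphM/=; ring.
Qed.

Lemma cexp0 : cexp (0 : R[i]) = 1.
Proof. by rewrite cexpE/= expR0 expi0 mul1r. Qed.

Lemma normc_cexp z : normc (cexp z) = expR (complex.Re z).
Proof.
by rewrite cexpE Normc.normcM normc_expi normc_real mulr1 ger0_norm// expR_ge0.
Qed.

Lemma cexp_sum (I : finType) (F : I -> R[i]) :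
  cexp (\sum_i F i) = \prod_i cexp (F i).
Proof.
by apply: (big_morph cexp) => [x y|]; [exact: cexpD|exact: cexp0].
Qed.

Lemma cexp_expi a : cexp (Complex 0 a) = expi a.
Proof. by rewrite cexpE/= expR0 mul1r. Qed.

Lemma reD z w : complex.Re (z + w) = complex.Re z + complex.Re w.
Proof. by case: z w => a b [c d]. Qed.
Lemma imD z w : complex.Im (z + w) = complex.Im z + complex.Im w.
Proof. by case: z w => a b [c d]. Qed.
Lemma reN z : complex.Re (- z) = - complex.Re z.
Proof. by case: z. Qed.
Lemma imN z : complex.Im (- z) = - complex.Im z.
Proof. by case: z. Qed.
Lemma reM z w : complex.Re (z * w) =
  complex.Re z * complex.Re w - complex.Im z * complex.Im w.
Proof. by case: z w => a b [c d]. Qed.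
Lemma imM z w : complex.Im (z * w) =
  complex.Re z * complex.Im w + complex.Im z * complex.Re w.
Proof. by case: z w => a b [c d]. Qed.
Lemma reZ a w : complex.Re (a%:C%C * w) = a * complex.Re w.
Proof. by rewrite reM/= mul0r subr0. Qed.
Lemma imZ a w : complex.Im (a%:C%C * w) = a * complex.Im w.
Proof. by rewrite imM/= mul0r addr0. Qed.

Lemma re_sum (I : finType) (F : I -> R[i]) :
  complex.Re (\sum_i F i) = \sum_i complex.Re (F i).
Proof.
by elim/big_ind2 : _ => // z a w b <- <-; exact: reD.
Qed.

Lemma complex_eqP z w : complex.Re z = complex.Re w ->
  complex.Im z = complex.Im w -> z = w.
Proof. by case: z w => a b [c d] /= -> ->. Qed.

End complex_exponential.

Section complex_measurable.
Context {R : realType} {d} {T : measurableType d}.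
Implicit Types (f g : T -> R[i]) (r : T -> R).

Lemma cmeasurable_cst (c : R[i]) : cmeasurable (fun _ : T => c).
Proof. by split; exact: measurable_cst. Qed.

Lemma cmeasurableD f g : cmeasurable f -> cmeasurable g ->
  cmeasurable (fun x => f x + g x).
Proof.
move=> [fR fI] [gR gI]; split.
  by under eq_fun do rewrite reD; exact: measurable_funD.
by under eq_fun do rewrite imD; exact: measurable_funD.
Qed.

Lemma cmeasurableN f : cmeasurable f -> cmeasurable (fun x => - f x).
Proof.
move=> [fR fI]; split.
  by under eq_fun do rewrite reN; exact: measurableT_comp.
by under eq_fun do rewrite imN; exact: measurableT_comp.
Qed.

Lemma cmeasurableM f g : cmeasurable f -> cmeasurable g ->
  cmeasurable (fun x => f x * g x).
Proof.
move=> [fR fI] [gR gI]; split.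
  by under eq_fun do rewrite reM; apply: measurable_funB;
    exact: measurable_funM.
by under eq_fun do rewrite imM; apply: measurable_funD; exact: measurable_funM.
Qed.

Lemma cmeasurableX f n : cmeasurable f -> cmeasurable (fun x => f x ^+ n).
Proof.
move=> mf; elim: n => [|n IH].
  by under eq_fun do rewrite expr0; exact: cmeasurable_cst.
by under eq_fun do rewrite exprS; exact: cmeasurableM.
Qed.

Lemma cmeasurable_real r : measurable_fun setT r ->
  cmeasurable (fun x => (r x)%:C%C).
Proof. by move=> mr; split => //=; exact: measurable_cst. Qed.

Lemma cmeasurable_expi r : measurable_fun setT r ->
  cmeasurable (fun x => expi (r x)).
Proof.
move=> mr; split => /=.
  by apply: measurableT_comp mr; apply: continuous_measurable_fun;
    exact: continuous_cos.
by apply: measurableT_comp mr; apply: continuous_measurable_fun;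
  exact: continuous_sin.
Qed.

Lemma cmeasurable_cexp f : cmeasurable f -> cmeasurable (fun x => cexp (f x)).
Proof.
move=> [fR fI]; under eq_fun do rewrite cexpE.
apply: cmeasurableM; last exact: cmeasurable_expi.
by apply: cmeasurable_real; exact: measurableT_comp.
Qed.

Lemma cmeasurable_prod (I : finType) (F : I -> T -> R[i]) :
  (forall i, cmeasurable (F i)) -> cmeasurable (fun x => \prod_i F i x).
Proof.
move=> mF; elim: (index_enum I) => [|i s IH].
  by under eq_fun do rewrite big_nil; exact: cmeasurable_cst.
by under eq_fun do rewrite big_cons; exact: cmeasurableM.
Qed.

Lemma cmeasurable_comp d' (T' : measurableType d') (phi : T' -> T) f :
  measurable_fun setT phi -> cmeasurable f -> cmeasurable (f \o phi).
Proof. by move=> mp [fR fI]; split; [exact: (measurableT_comp fR mp)|exact: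
  (measurableT_comp fI mp)]. Qed.

Lemma measurable_normc f : cmeasurable f -> measurable_fun setT (normc \o f).
Proof.
move=> [fR fI].
rewrite (_ : _ \o _ = fun x => Num.sqrt (complex.Re (f x) ^+ 2 + complex.Im (f
  x) ^+ 2)).
  apply: (@measurableT_comp _ _ _ _ _ _ (@Num.sqrt R)).
    by apply: continuous_measurable_fun => x; exact: sqrt_continuous.
  by apply: measurable_funD; exact: measurable_funX.
by apply/funext => x /=; case: (f x).
Qed.

End complex_measurable.

Section complex_integral_theory.
Context {R : realType} {d} {T : measurableType d}.
Variable mu : {measure set T -> \bar R}.
Implicit Types (f g : T -> R[i]).

Lemma cintegrable_measurable f : cintegrable mu f -> cmeasurable f.
Proof.
by move=> [fR fI]; split; apply/measurable_EFinP;
  [exact: measurable_int fR|exact: measurable_int fI].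
Qed.

Lemma le_cintegrable f (g : T -> R) : cmeasurable f ->
  mu.-integrable setT (fun x => (g x)%:E) ->
  (forall x, normc (f x) <= g x) -> cintegrable mu f.
Proof.
move=> [fR fI] ig fg; split; apply: le_integrable ig => //.
- exact/measurable_EFinP.
- move=> x _ /=; rewrite lee_fin (le_trans (normc_Re _))// (le_trans (fg x))//.
  exact: ler_norm.
- exact/measurable_EFinP.
- move=> x _ /=; rewrite lee_fin (le_trans (normc_Im _))// (le_trans (fg x))//.
  exact: ler_norm.
Qed.

Lemma cintegrable_normc f : cintegrable mu f ->
  mu.-integrable setT (fun x => (normc (f x))%:E).
Proof.
move=> cf; have mf := cintegrable_measurable cf; move: cf => [fR fI].
have := integrableD measurableT (integrable_abse fR) (integrable_abse fI).
apply: le_integrable => //; first exact/measurable_EFinP/measurable_normc.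
move=> x _ /=; rewrite lee_fin ger0_norm ?normc_ge0// ger0_norm ?addr_ge0//.
exact: normc_le_ReIm.
Qed.

Lemma cintegrableP f : cmeasurable f ->
  (\int[mu]_x (normc (f x))%:E < +oo)%E -> cintegrable mu f.
Proof.
move=> mf foo; apply: (@le_cintegrable f (normc \o f)) => //.
apply/integrableP; split; first exact/measurable_EFinP/measurable_normc.
by under eq_integral do rewrite gee0_abs ?lee_fin ?normc_ge0//.
Qed.

Lemma cintegrable_lty f : cintegrable mu f ->
  (\int[mu]_x (normc (f x))%:E < +oo)%E.
Proof.
move=> /cintegrable_normc/integrableP[_].
by under eq_integral do rewrite gee0_abs ?lee_fin ?normc_ge0//.
Qed.

Lemma cintegrableD f g : cintegrable mu f -> cintegrable mu g ->
  cintegrable mu (fun x => f x + g x).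
Proof.
move=> [fR fI] [gR gI]; split.
  under eq_fun do rewrite reD EFinD; exact: integrableD.
under eq_fun do rewrite imD EFinD; exact: integrableD.
Qed.

Lemma cintegralD f g : cintegrable mu f -> cintegrable mu g ->
  cintegral mu (fun x => f x + g x) = cintegral mu f + cintegral mu g.
Proof.
move=> [fR fI] [gR gI]; apply: complex_eqP; rewrite ?reD ?imD /=.
  by under eq_Rintegral do rewrite reD; exact: RintegralD.
by under eq_Rintegral do rewrite imD; exact: RintegralD.
Qed.

Lemma cintegrableZl (c : R[i]) f : cintegrable mu f ->
  cintegrable mu (fun x => c * f x).
Proof.
move=> [fR fI]; split.
  under eq_fun do rewrite reM EFinB !EFinM.
  by apply: integrableB => //; exact: integrableZl.
under eq_fun do rewrite imM EFinD !EFinM.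
by apply: integrableD => //; exact: integrableZl.
Qed.

Lemma cintegralZl (c : R[i]) f : cintegrable mu f ->
  cintegral mu (fun x => c * f x) = c * cintegral mu f.
Proof.
move=> [fR fI]; apply: complex_eqP; rewrite ?reM ?imM /=.
  under eq_Rintegral do rewrite reM.
  rewrite RintegralB//= ?RintegralZl//.
    by under [X in integrable _ _ X]eq_fun do rewrite EFinM;
      exact: integrableZl.
  by under [X in integrable _ _ X]eq_fun do rewrite EFinM; exact: integrableZl.
under eq_Rintegral do rewrite imM.
rewrite RintegralD//= ?RintegralZl//.
  by under [X in integrable _ _ X]eq_fun do rewrite EFinM; exact: integrableZl.
by under [X in integrable _ _ X]eq_fun do rewrite EFinM; exact: integrableZl.
Qed.

Lemma eq_cintegral f g : f =1 g -> cintegral mu f = cintegral mu g.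
Proof. by move=> /funext->. Qed.

Lemma ae_eq_cintegral f g : cmeasurable f -> cmeasurable g ->
  (\forall x \ae mu, f x = g x) -> cintegral mu f = cintegral mu g.
Proof.
move=> [fR fI] [gR gI] fg; congr Complex; congr fine.
  apply: ae_eq_integral => //; [exact/measurable_EFinP..|].
  by apply: filterS fg => x /= ->.
apply: ae_eq_integral => //; [exact/measurable_EFinP..|].
by apply: filterS fg => x /= ->.
Qed.

(** Real and imaginary parts are bounded separately, which costs the factor 2; only the rate in t
    matters later. *)
Lemma normc_cintegral f : cintegrable mu f ->
  normc (cintegral mu f) <= 2 * \int[mu]_x normc (f x).
Proof.
move=> cf; have [fR fI] := cf; have nf := cintegrable_normc cf.
apply: le_trans (normc_le_ReIm _) _; rewrite mulr_natl mulr2n /=.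
apply: lerD; (apply: le_trans (le_normr_Rintegral _ _) _ => //);
  apply: le_Rintegral => //.
- exact: (integrable_abse fR).
- by move=> x _; exact: normc_Re.
- exact: (integrable_abse fI).
- by move=> x _; exact: normc_Im.
Qed.

Lemma cintegrable_indic (D : set T) : measurable D -> (mu D < +oo)%E ->
  cintegrable mu (fun x => (\1_D x)%:C%C).
Proof.
move=> mD Doo; apply: cintegrableP.
  by apply: cmeasurable_real; exact: measurable_indic.
under eq_integral do rewrite normc_real ger0_norm ?indicE ?ler0n// -indicE.
by rewrite integral_indic// setIT.
Qed.

End complex_integral_theory.

(** * Fubini and Tonelli for complex-valued functions *)

Section complex_fubini.
Context {R : realType} {d1 d2} {T1 : measurableType d1} {T2 : measurableType
  d2}.
Variable m1 : {sigma_finite_measure set T1 -> \bar R}.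
Variable m2 : {sigma_finite_measure set T2 -> \bar R}.
Implicit Types (f : T1 * T2 -> R[i]) (g : T1 * T2 -> R).

(** Tonelli applies to the positive and negative parts, and a difference of measurable extended-real
    functions is measurable even where both are infinite. *)
Lemma measurable_fun_integral_prod g : measurable_fun setT g ->
  measurable_fun setT (fun x => \int[m2]_y (g (x, y))%:E)%E.
Proof.
move=> mg; have mE : measurable_fun setT (EFin \o g) by exact/measurable_EFinP.
rewrite (_ : (fun _ => _) = (fun x =>
  (\int[m2]_y ((EFin \o g)^\+ (x, y)) - \int[m2]_y ((EFin \o g)^\- (x, y)))%E)).
  apply: emeasurable_funB.
  - by apply: (measurable_fun_fubini_tonelli_F (m2 := m2) ((EFin \o g)^\+)%E) =>
    //; exact: measurable_funepos.
  - by apply: (measurable_fun_fubini_tonelli_F (m2 := m2) ((EFin \o g)^\-)%E) =>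
    //; exact: measurable_funeneg.
apply/funext => x.
rewrite (_ : (fun y => (g (x, y))%:E) = (EFin \o g) \o pair x)//.
by rewrite integralE funepos_comp funeneg_comp.
Qed.

Lemma cmeasurable_cintegral f : cmeasurable f ->
  cmeasurable (fun x => cintegral m2 (fun y => f (x, y))).
Proof.
move=> [fR fI]; split => /=.
  by apply: measurableT_comp => //; exact: (measurable_fun_integral_prod fR).
by apply: measurableT_comp => //; exact: (measurable_fun_integral_prod fI).
Qed.

Lemma Rintegral12_prod g : (m1 \x m2)%E.-integrable setT (fun z => (g z)%:E) ->
  \int[m1]_x (\int[m2]_y g (x, y)) = \int[(m1 \x m2)%E]_z g z.
Proof.
move=> ig; rewrite /Rintegral -(integral12_prod_meas1 ig); congr fine.
have mg : measurable_fun setT g by apply/measurable_EFinP;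
  exact: measurable_int ig.
apply: ae_eq_integral => //.
- apply/measurable_EFinP; apply: measurableT_comp => //.
  exact: measurable_fun_integral_prod.
- exact: measurable_fun_integral_prod.
(* [fine] recovers the inner integral only where that is finite, which by Fubini is almost
   everywhere. *)
- have := integrable_ae measurableT (integrable_fubini_F ig).
  by apply: filterS => x /(_ I) xfin _; rewrite fineK.
Qed.

Lemma Rintegral21_prod g : (m1 \x m2)%E.-integrable setT (fun z => (g z)%:E) ->
  \int[m2]_y (\int[m1]_x g (x, y)) = \int[(m1 \x m2)%E]_z g z.
Proof.
move=> ig; rewrite /Rintegral -(integral21_prod_meas1 ig); congr fine.
have mG := measurable_fubini_G ig.
apply: ae_eq_integral => //.
- by apply/measurable_EFinP; apply: measurableT_comp.
- have := ae_integrable2 ig.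
  by apply: filterS => x ix _; rewrite fineK//; exact: integrable_fin_num ix.
Qed.

Lemma cintegral12_prod f : cintegrable (m1 \x m2)%E f ->
  cintegral m1 (fun x => cintegral m2 (fun y => f (x, y))) =
  cintegral (m1 \x m2)%E f.
Proof. by move=> [fR fI]; apply: complex_eqP; exact: Rintegral12_prod. Qed.

Lemma cintegral21_prod f : cintegrable (m1 \x m2)%E f ->
  cintegral m2 (fun y => cintegral m1 (fun x => f (x, y))) =
  cintegral (m1 \x m2)%E f.
Proof. by move=> [fR fI]; apply: complex_eqP; exact: Rintegral21_prod. Qed.

Lemma cintegral_exchange f : cintegrable (m1 \x m2)%E f ->
  cintegral m1 (fun x => cintegral m2 (fun y => f (x, y))) =
  cintegral m2 (fun y => cintegral m1 (fun x => f (x, y))).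
Proof. by move=> cf; rewrite cintegral12_prod// cintegral21_prod. Qed.

Lemma cintegrable12P f : cmeasurable f ->
  (\int[m1]_x \int[m2]_y (normc (f (x, y)))%:E < +oo)%E ->
  cintegrable (m1 \x m2)%E f.
Proof.
move=> mf foo; apply: cintegrableP => //; rewrite fubini_tonelli1//.
  exact/measurable_EFinP/measurable_normc.
by move=> x; rewrite lee_fin normc_ge0.
Qed.

Lemma cintegrable21P f : cmeasurable f ->
  (\int[m2]_y \int[m1]_x (normc (f (x, y)))%:E < +oo)%E ->
  cintegrable (m1 \x m2)%E f.
Proof.
move=> mf foo; apply: cintegrableP => //; rewrite fubini_tonelli2//.
  exact/measurable_EFinP/measurable_normc.
by move=> x; rewrite lee_fin normc_ge0.
Qed.

Lemma cintegrable_cintegral12 f : cintegrable (m1 \x m2)%E f ->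
  cintegrable m1 (fun x => cintegral m2 (fun y => f (x, y))).
Proof.
move=> cf; have mf := cintegrable_measurable cf.
have [mR mI] := cmeasurable_cintegral mf.
have [fR fI] := cf.
have aux g : (m1 \x m2)%E.-integrable setT (fun z => (g z)%:E) ->
    measurable_fun setT (fun x => \int[m2]_y g (x, y)) ->
    m1.-integrable setT (fun x => (\int[m2]_y g (x, y))%:E).
  move=> ig mg; have := integrable_fubini_F ig; apply: le_integrable => //.
    exact/measurable_EFinP.
  (* [fine] sends both infinities to 0, so passing to it never increases the absolute value. *)
  by move=> x _; rewrite /Rintegral /fubini_F; case: (integral _ _ _) =>
    [r||]//=; rewrite ?normr0 ?leey.
by split; [exact: (aux _ fR mR)|exact: (aux _ fI mI)].
Qed.

Lemma cintegrable_prod (f : T1 -> R[i]) (g : T2 -> R[i]) :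
  cintegrable m1 f -> cintegrable m2 g ->
  cintegrable (m1 \x m2)%E (fun z => f z.1 * g z.2).
Proof.
move=> cf cg; apply: cintegrable12P.
  apply: cmeasurableM.
    exact: (cmeasurable_comp measurable_fst (cintegrable_measurable cf)).
  exact: (cmeasurable_comp measurable_snd (cintegrable_measurable cg)).
under eq_integral => x _.
  under eq_integral do rewrite /= Normc.normcM EFinM.
  rewrite ge0_integralZl_EFin//; last 3 first.
  - by move=> y _; rewrite lee_fin normc_ge0.
  - exact/measurable_EFinP/measurable_normc/(cintegrable_measurable cg).
  - exact: normc_ge0.
  over.
rewrite ge0_integralZr//; last 3 first.
- exact/measurable_EFinP/measurable_normc/(cintegrable_measurable cf).
- by move=> x _; rewrite lee_fin normc_ge0.
- by apply: integral_ge0 => y _; rewrite lee_fin normc_ge0.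
apply: lte_mul_pinfty; last exact: (cintegrable_lty cg).
- by apply: integral_ge0 => y _; rewrite lee_fin normc_ge0.
- rewrite ge0_fin_numE; first exact: (cintegrable_lty cf).
  by apply: integral_ge0 => y _; rewrite lee_fin normc_ge0.
Qed.

Lemma cintegral_prod (f : T1 -> R[i]) (g : T2 -> R[i]) :
  cintegrable m1 f -> cintegrable m2 g ->
  cintegral (m1 \x m2)%E (fun z => f z.1 * g z.2) =
  cintegral m1 f * cintegral m2 g.
Proof.
move=> cf cg; rewrite -cintegral12_prod; last exact: cintegrable_prod.
under eq_cintegral => x do rewrite /= cintegralZl// mulrC.
by rewrite cintegralZl// mulrC.
Qed.

End complex_fubini.

(** * Integration along a map that scales a measure by a constant *)

Section transport.
Context {R : realType} {d1 d2} {T1 : measurableType d1} {T2 : measurableType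
  d2}.
Variables (m1 : {measure set T1 -> \bar R}) (m2 : {measure set T2 -> \bar R}).
Variables (phi : T1 -> T2) (c : R).
Hypotheses (mphi : measurable_fun setT phi) (c0 : 0 <= c).
Hypothesis phiE : forall A, measurable A -> m1 (phi @^-1` A) = (c%:E * m2 A)%E.

Lemma ge0_integral_transport (f : T2 -> \bar R) : measurable_fun setT f ->
  (forall x, 0 <= f x)%E ->
  (\int[m1]_x f (phi x) = c%:E * \int[m2]_x f x)%E.
Proof.
move=> mf f0.
pose m := [the measure _ _ of mscale (NngNum c0) m2].
transitivity (\int[pushforward m1 phi]_y f y)%E.
  by rewrite ge0_integral_pushforward// => x _.
rewrite -(ge0_integral_mscale m2 measurableT (NngNum c0))//.
apply: eq_measure_integral => A mA _ /=.
by rewrite /pushforward phiE.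
Qed.

Lemma integral_transport (f : T2 -> R) :
  m2.-integrable setT (fun x => (f x)%:E) ->
  m1.-integrable setT (fun x => (f (phi x))%:E) /\
  \int[m1]_x f (phi x) = c * \int[m2]_x f x.
Proof.
move=> fi; have mf := measurable_int _ fi.
have mf' : measurable_fun setT f by exact/measurable_EFinP.
have fp : measurable_fun setT (fun x => (f (phi x))%:E).
  by apply/measurable_EFinP; exact: (measurableT_comp mf').
split.
  apply/integrableP; split => //.
  rewrite (ge0_integral_transport (f := fun x => `|(f x)%:E|%E))//.
  - apply: lte_mul_pinfty => //; rewrite ?lee_fin//.
    by move/integrableP : fi => [].
  - exact: measurableT_comp.
rewrite /Rintegral integralE.
rewrite (_ : (fun x => (f (phi x))%:E)^\+%E = (fun x =>
  ((EFin \o f)^\+ (phi x))%E)); last exact: (funepos_comp (EFin \o f)).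
rewrite (_ : (fun x => (f (phi x))%:E)^\-%E = (fun x =>
  ((EFin \o f)^\- (phi x))%E)); last exact: (funeneg_comp (EFin \o f)).
rewrite ge0_integral_transport//; last exact: measurable_funepos.
rewrite ge0_integral_transport//; last exact: measurable_funeneg.
rewrite -muleBr//; last first.
  by rewrite fin_num_adde_defl// fin_numN integrable_neg_fin_num.
by rewrite -integralE fineM// integrable_fin_num.
Qed.

Lemma cintegrable_transport (f : T2 -> R[i]) : cintegrable m2 f ->
  cintegrable m1 (fun x => f (phi x)).
Proof.
move=> [fR fI]; split.
  by have [] := integral_transport fR.
by have [] := integral_transport fI.
Qed.

Lemma cintegral_transport (f : T2 -> R[i]) : cintegrable m2 f ->
  cintegral m1 (fun x => f (phi x)) = (c%:C)%C * cintegral m2 f.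
Proof.
move=> [fR fI]; apply: complex_eqP; rewrite ?reZ ?imZ/=.
  by have [_ ->] := integral_transport fR.
by have [_ ->] := integral_transport fI.
Qed.

End transport.

(** * Changes of variables *)

Section lebesgue_maps.
Context {R : realType}.
Local Notation mu := (@lebesgue_measure R).

Lemma measurable_inv : measurable_fun setT (@GRing.inv R).
Proof.
(* Real powers and absolute value are known to be measurable; the formula also holds at 0, whose
   inverse is 0 by convention. *)
rewrite (_ : @GRing.inv R = fun x => x * (`|x| `^ (-1)) ^+ 2).
  apply: measurable_funM => //; apply: measurable_funX.
  by apply: (measurableT_comp (measurable_powR _)).
apply/funext => x; have [->|x0] := eqVneq x 0; first by rewrite invr0 mul0r.
rewrite powR_inv1// exprVn real_normK ?num_real// expr2 invfM mulrA divff//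
  mul1r.
by [].
Qed.

(** The pushforward divided by c gives every interval ]a, b] its length, and this characterizes
    Lebesgue measure. *)
Lemma lebesgue_mapE (phi : R -> R) (c : R) : measurable_fun setT phi -> 0 < c ->
  (forall a b, a < b -> mu (phi @^-1` `]a, b]) = (c * (b - a))%:E) ->
  forall A, measurable A -> mu (phi @^-1` A) = (c%:E * mu A)%E.
Proof.
move=> mphi c0 phiE A mA.
have ci0 : 0 <= c^-1 by rewrite invr_ge0 ltW.
pose pm : {measure set (measurableTypeR R) -> \bar R} :=
  pushforward mu (phi : measurableTypeR R -> measurableTypeR R).
pose m : {measure set (measurableTypeR R) -> \bar R} :=
  mscale (NngNum ci0) (pm mphi).
have -> : mu A = m A.
  apply: lebesgue_measure_unique => //= X [[a b] _ <-] /=.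
  rewrite /mscale/= /pushforward lebesgue_measure_itv/= lte_fin.
  case: ltP => [ab|ba]; first by rewrite phiE// -EFinM mulrA mulVf ?gt_eqF//
    mul1r.
  by rewrite set_itv_ge ?bnd_simp -?leNgt// preimage_set0 measure0 mule0.
by rewrite /m/= /mscale/= muleA -EFinM divff ?gt_eqF// mul1e.
Qed.

Lemma lebesgue_scale (l : R) : l != 0 -> forall A, measurable A ->
  mu ((fun x => l * x) @^-1` A) = ((`|l|^-1)%:E * mu A)%E.
Proof.
move=> l0; apply: lebesgue_mapE.
- by apply: measurable_funM.
- by rewrite invr_gt0 normr_gt0.
move=> a b ab; have [lp|ln] : 0 < l \/ l < 0.
  by case: (ltgtP l 0) l0 => //; [right|left].
- rewrite (_ : _ @^-1` _ = `](a / l), (b / l)]%classic).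
    rewrite lebesgue_measure_itv/= lte_fin ltr_pM2r ?invr_gt0// ab.
    by rewrite gtr0_norm// -EFinB -mulrBl mulrC.
  apply/seteqP; split => x /=; rewrite !in_itv/=;
    by rewrite ltr_pdivrMr// ler_pdivlMr// mulrC.
- rewrite (_ : _ @^-1` _ = `[(b / l), (a / l)[%classic).
    rewrite lebesgue_measure_itv/= lte_fin ltr_nM2r ?invr_lt0// ab.
    by rewrite ltr0_norm// -EFinB; congr EFin; field.
  apply/seteqP; split => x /=; rewrite !in_itv/=;
    by rewrite ltr_ndivlMr// ler_ndivrMr// andbC mulrC.
Qed.

Lemma ge0_integral_scale (l : R) (f : R -> \bar R) : l != 0 ->
  measurable_fun setT f -> (forall x, 0 <= f x)%E ->
  (\int[mu]_x f (l * x)%R = (`|l|^-1)%:E * \int[mu]_x f x)%E.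
Proof.
move=> l0 mf f0; have l10 : 0 <= `|l|^-1 by rewrite invr_ge0.
have ml : measurable_fun setT (fun x : R => l * x) by apply: measurable_funM.
exact: (ge0_integral_transport (m1 := mu) (m2 :=
  mu) ml l10 (lebesgue_scale l0) mf f0).
Qed.

Lemma integral_scale (l : R) (f : R -> R) : l != 0 ->
  mu.-integrable setT (fun x => (f x)%:E) ->
  mu.-integrable setT (fun x => (f (l * x))%:E) /\
  \int[mu]_x f (l * x) = `|l|^-1 * \int[mu]_x f x.
Proof.
move=> l0 fi; have l10 : 0 <= `|l|^-1 by rewrite invr_ge0.
have ml : measurable_fun setT (fun x : R => l * x) by apply: measurable_funM.
exact: (integral_transport (m1 := mu) (m2 := mu) ml l10 (lebesgue_scale l0) fi).
Qed.

Lemma cintegral_scale (l : R) (f : R -> R[i]) : l != 0 -> cintegrable mu f ->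
  cintegrable mu (fun x => f (l * x)) /\
  cintegral mu (fun x => f (l * x)) = ((`|l|^-1)%:C)%C * cintegral mu f.
Proof.
move=> l0 fi; have l10 : 0 <= `|l|^-1 by rewrite invr_ge0.
have ml : measurable_fun setT (fun x : R => l * x) by apply: measurable_funM.
split.
  exact: (cintegrable_transport (m1 := mu) (m2 :=
    mu) ml l10 (lebesgue_scale l0) fi).
exact: (cintegral_transport (m1 := mu) (m2 := mu) ml l10 (lebesgue_scale l0)
  fi).
Qed.

Lemma lebesgue_shift (s : R) : forall A, measurable A ->
  mu ((fun x => x + s) @^-1` A) = (1%:E * mu A)%E.
Proof.
apply: lebesgue_mapE => //; first exact: measurable_funD.
move=> a b ab; rewrite (_ : _ @^-1` _ = `](a - s), (b - s)]%classic).
  rewrite lebesgue_measure_itv/= lte_fin ltrD2r ab mul1r.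
  by rewrite -EFinB; congr EFin; ring.
by apply/seteqP; split => x /=; rewrite !in_itv/= ltrBlDr lerBrDr.
Qed.

(* The two branches x_- < 0 < x_+ of the inverse of x - b / x have constant
   sum x_- + x_+ = c, so the two intervals in the preimage of ]c1, c2] have
   total length c2 - c1. *)
Lemma lebesgue_boole (b : R) : 0 < b -> forall A, measurable A ->
  mu ((fun x => x - b / x) @^-1` A) = (1%:E * mu A)%E.
Proof.
move=> b0.
have mphi : measurable_fun setT (fun x : R => x - b / x).
  apply: measurable_funB => //; apply: measurable_funM => //.
  exact: measurable_inv.
apply: lebesgue_mapE => // c1 c2 c12; rewrite mul1r.
(* The equation x - b / x = c amounts to x^2 - c x - b = 0, whose discriminant is under this root;
   [xp c] and [xm c] are its positive and negative solutions. *)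
pose s c := Num.sqrt (c ^+ 2 + 4 * b).
have s2 c : s c ^+ 2 = c ^+ 2 + 4 * b by rewrite sqr_sqrtr// addr_ge0 ?sqr_ge0//
  mulr_ge0// ltW.
have sp c : 0 < s c by rewrite sqrtr_gt0 ltr_wpDl ?sqr_ge0// mulr_gt0.
have sc c : c < s c.
  by have := s2 c; have := sp c; nra.
have sNc c : - c < s c.
  by have := s2 c; have := sp c; nra.
pose xp c := (c + s c) / 2; pose xm c := (c - s c) / 2.
have xp0 c : 0 < xp c by rewrite /xp; have := sNc c; lra.
have xm0 c : xm c < 0 by rewrite /xm; have := sc c; lra.
have fac c x : x ^+ 2 - c * x - b = (x - xp c) * (x - xm c).
  by rewrite /xp /xm; have := s2 c; nra.
have leP c x : 0 < x -> (x - b / x <= c) = (x <= xp c).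
  move=> x0; rewrite -subr_le0 -[RHS]subr_le0.
  rewrite (_ : x - b / x - c = (x - xp c) * ((x - xm c) / x)); last first.
    by rewrite mulrA -fac; field; rewrite gt_eqF.
  by rewrite pmulr_lle0// divr_gt0// subr_gt0 (lt_trans (xm0 c)).
have leN c x : x < 0 -> (x - b / x <= c) = (x <= xm c).
  move=> x0; rewrite -subr_le0 -[RHS]subr_le0.
  rewrite (_ : x - b / x - c = (x - xm c) * ((x - xp c) / x)); last first.
    by rewrite mulrA [_ * (x - xp c)]mulrC -fac; field; rewrite lt_eqF.
  rewrite pmulr_lle0// -mulrNN -invrN divr_gt0 ?oppr_gt0//.
  by rewrite subr_lt0 (lt_trans x0).
set P := _ @^-1` _.
have mP : measurable P by rewrite -[P]setTI; exact: mphi.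
pose U := `](xm c1), (xm c2)]%classic `|` `](xp c1), (xp c2)]%classic.
have mU : measurable U by exact: measurableU.
have lePx x : x != 0 -> P x <-> U x.
  case: ltgtP => // x0 _; rewrite /P /U/= !in_itv/=.
    rewrite !ltNge !leN//; split => [->|[//|]]; first by left.
    by move=> /andP[]; rewrite -ltNge (ltNge _ x) (ltW (lt_trans x0 (xp0 _))).
  rewrite !ltNge !leP//; split => [->|[|//]]; first by right.
  by move=> /andP[_]; rewrite leNgt (lt_trans (xm0 _) x0).
have mxm : xm c1 < xm c2.
  rewrite /xm; have := s2 c1; have := s2 c2; have := sp c1; have := sp c2.
  by have := sc c1; have := sc c2; nra.
have mxp : xp c1 < xp c2.
  rewrite /xp; have := s2 c1; have := s2 c2; have := sp c1; have := sp c2.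
  by have := sNc c1; have := sNc c2; nra.
have muU : mu U = (c2 - c1)%:E.
  have -> : mu U = (mu `](xm c1), (xm c2)]%classic + mu `](xp c1),
    (xp c2)]%classic)%E.
    apply: measureU => //.
    rewrite -subset0 => x /=; rewrite !in_itv/= => -[/andP[_ h1] /andP[h2 _]].
    by have := lt_le_trans h2 h1; rewrite ltNge (ltW (lt_trans (xm0 _) (xp0
      _))).
  rewrite !lebesgue_measure_itv/= !lte_fin mxm mxp -!EFinB -EFinD.
  by congr EFin; rewrite /xp /xm; field.
(* [P] and [U] agree off 0, so each is contained in the other enlarged by a null set. *)
rewrite -muU; apply/eqP; rewrite eq_le; apply/andP; split.
  rewrite -[leRHS]adde0 -(lebesgue_measure_set1 (0:R)).
  apply: le_trans (measureU2 _ _ _) => //.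
  apply: le_measure; rewrite ?inE//; first exact: measurableU.
  by move=> x Px; have [->|/lePx] := eqVneq x 0; [right|move=> [/(_ Px)]; left].
rewrite -[leRHS]adde0 -(lebesgue_measure_set1 (0:R)).
apply: le_trans (measureU2 _ _ _) => //.
apply: le_measure; rewrite ?inE//; first exact: measurableU.
by move=> x Px; have [->|/lePx] := eqVneq x 0; [right|move=> [_ /(_ Px)]; left].
Qed.

Lemma cintegral_shift (s : R) (f : R -> R[i]) : cintegrable mu f ->
  cintegrable mu (fun x => f (x + s)) /\
  cintegral mu (fun x => f (x + s)) = cintegral mu f.
Proof.
move=> fi.
have ml : measurable_fun setT (fun x : R => x + s) by apply: measurable_funD.
split.
  exact: (cintegrable_transport (m1 := mu) (m2 :=
    mu) ml ler01 (@lebesgue_shift s) fi).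
rewrite (cintegral_transport (m1 := mu) (m2 :=
  mu) ml ler01 (@lebesgue_shift s) fi).
by rewrite mul1r.
Qed.

Lemma measurable_boole (b : R) : measurable_fun setT (fun x : R => x - b / x).
Proof.
apply: measurable_funB => //; apply: measurable_funM => //.
exact: measurable_inv.
Qed.

Lemma cintegral_boole (b : R) (f : R -> R[i]) : 0 < b -> cintegrable mu f ->
  cintegrable mu (fun x => f (x - b / x)) /\
  cintegral mu (fun x => f (x - b / x)) = cintegral mu f.
Proof.
move=> b0 fi; have ml := measurable_boole b.
split.
  exact: (cintegrable_transport (m1 := mu) (m2 :=
    mu) ml ler01 (lebesgue_boole b0) fi).
rewrite (cintegral_transport (m1 := mu) (m2 :=
  mu) ml ler01 (lebesgue_boole b0) fi).
by rewrite mul1r.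
Qed.

End lebesgue_maps.

(** * Integration on R^n one coordinate at a time *)

Section lebesgue_rV_integral.
Context {R : realType}.
Local Notation mu := (@lebesgue_measure R).
Local Notation leb n := (@lebesgue_rV R n).

Lemma lebesgue_rV_uncons n A : measurable A ->
  leb n.+1 (@uncons_rV R n @^-1` A) = (1%:E * (mu \x leb n) A)%E.
Proof.
move=> mA; rewrite mul1e /= /cons_lebesgue /pushforward; congr (_ _).
by apply/seteqP; split => z /=; rewrite cons_rVK.
Qed.

Lemma ge0_integral_rVS n (f : 'rV[R]_n.+1 -> \bar R) : measurable_fun setT f ->
  (forall x, 0 <= f x)%E ->
  (\int[leb n.+1]_v f v = \int[mu]_x \int[leb n]_v f (cons_rV (x, v)))%E.
Proof.
move=> mf f0.
transitivity (\int[leb n.+1]_v (f \o @cons_rV R n) (uncons_rV v))%E.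
  by apply: eq_integral => v _ /=; rewrite uncons_rVK.
rewrite (ge0_integral_transport (m2 := (mu \x leb n)%E) (@measurable_uncons_rV R
  n) ler01 (@lebesgue_rV_uncons n)).
- rewrite mul1e fubini_tonelli1//.
    by apply: measurableT_comp mf _; exact: measurable_cons_rV.
  by move=> z /=.
- by apply: measurableT_comp mf _; exact: measurable_cons_rV.
- by move=> x /=.
Qed.

Lemma cintegral_rV_prod n (phi : 'I_n -> R -> R[i]) :
  (forall i, cintegrable mu (phi i)) ->
  cintegrable (leb n) (fun v => \prod_i phi i (v ord0 i)) /\
  cintegral (leb n) (fun v => \prod_i phi i (v ord0 i)) =
  \prod_i cintegral mu (phi i).
Proof.
elim: n phi => [|n IH] phi iphi.
  (* In dimension 0 the measure is a unit mass on a one-point space, in accordance with the empty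
     product 1. *)
  under eq_fun do rewrite big_ord0.
  rewrite big_ord0; split.
    split => /=.
      apply/integrableP; split; first exact: measurable_cst.
      by rewrite integral_dirac//= diracT mul1e normr1 ltry.
    apply/integrableP; split; first exact: measurable_cst.
    by rewrite integral_dirac//= diracT mul1e normr0 ltry.
  apply: complex_eqP.
    by rewrite /= /Rintegral integral_dirac// diracT mul1e.
  by rewrite /= /Rintegral integral_dirac// diracT mul1e.
have [IH1 IH2] := IH (fun i => phi (lift ord0 i)) (fun i => iphi _).
pose G z := phi ord0 z.1 * \prod_i phi (lift ord0 i) ((z.2 : 'rV[R]_n) ord0 i).
have iG : cintegrable (mu \x leb n)%E G by exact: (cintegrable_prod (m2 :=
  leb n) (iphi ord0) IH1).
have FE : (fun v : 'rV[R]_n.+1 => \prod_i phi i (v ord0 i)) =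
    (fun v => G (uncons_rV v)).
  apply/funext => v; rewrite big_ord_recl /G/=; congr (_ * _).
  apply: eq_bigr => i _; rewrite mxE; congr (phi _ (v _ _)); exact: val_inj.
rewrite FE; split.
  exact: (cintegrable_transport (m2 := (mu \x leb n)%E) (@measurable_uncons_rV R
    n) ler01 (@lebesgue_rV_uncons n)).
rewrite (cintegral_transport (m2 := (mu \x leb n)%E) (@measurable_uncons_rV R n)
  ler01 (@lebesgue_rV_uncons n))//.
by rewrite mul1r (cintegral_prod (m2 := leb n) (iphi ord0) IH1) IH2
  big_ord_recl.
Qed.

Lemma measurable_scale_rV n (l : R) : measurable_fun setT (fun v : 'rV[R]_n =>
  l *: v).
Proof.
apply: measurable_fun_rVP => i; under eq_fun do rewrite mxE.
by apply: measurable_funM => //; exact: measurable_coord.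
Qed.

Lemma ge0_integral_rV_scale n (l : R) (f : 'rV[R]_n -> \bar R) : 0 < l ->
  measurable_fun setT f -> (forall x, 0 <= f x)%E ->
  (\int[leb n]_v f (l *: v) = (l^-1 ^+ n)%:E * \int[leb n]_v f v)%E.
Proof.
move=> l0; elim: n f => [|n IH] f mf f0.
  rewrite expr0 mul1e; apply: eq_integral => v _; congr f.
  by apply/rowP => -[].
have mfc x : measurable_fun setT (fun v : 'rV[R]_n => f (cons_rV (x, v))).
  by apply: measurableT_comp mf _; apply: measurableT_comp (@measurable_cons_rV
    R n) _; exact: measurable_pair1.
rewrite !ge0_integral_rVS//; last first.
  by apply: measurableT_comp mf _; exact: measurable_scale_rV.
have mI : measurable_fun setT (fun x => \int[leb n]_v f (cons_rV (x, v)))%E.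
  apply: (measurable_fun_fubini_tonelli_F (m2 := leb n) (f \o @cons_rV R n)) =>
    //.
    by apply: measurableT_comp mf _; exact: measurable_cons_rV.
  by move=> z /=.
pose I x := (\int[leb n]_v f (cons_rV (x, v)))%E.
have I0 x : (0 <= I x)%E by apply: integral_ge0.
transitivity (\int[mu]_x ((l^-1 ^+ n)%:E * I (l * x)%R))%E.
  apply: eq_integral => x _; rewrite -IH//.
  apply: eq_integral => v _; congr f.
  apply/rowP => i; rewrite !mxE; case: splitP => j _; rewrite !mxE//.
have mlx : measurable_fun setT (fun x : R => l * x) by apply: measurable_funM.
have ln0 : 0 <= l^-1 ^+ n by rewrite exprn_ge0// invr_ge0 ltW.
rewrite (@ge0_integralZl_EFin _ _ _ mu setT measurableT (fun x =>
  I (l * x)%R) (fun x _ => I0 _) (measurableT_comp mI mlx) _ ln0).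
rewrite (ge0_integral_scale (lt0r_neq0 l0) mI I0).
by rewrite muleA -EFinM gtr0_norm// -exprSr.
Qed.

End lebesgue_rV_integral.

(** * Gaussian integrals with complex parameters *)

Section complex_derivative.
Context {R : realType}.
Implicit Types (f g : R -> R[i]) (x : R).

Definition is_cderive f x (l : R[i]) :=
  is_derive x 1 (fun y => complex.Re (f y)) (complex.Re l) /\
  is_derive x 1 (fun y => complex.Im (f y)) (complex.Im l).

Lemma cderive_cst (c : R[i]) x : is_cderive (fun _ => c) x 0.
Proof. by split => /=; exact: is_derive_cst. Qed.

Lemma cderive_real x : is_cderive (fun y => (y%:C)%C) x 1.
Proof. by split => /=; [exact: is_derive_id|exact: is_derive_cst]. Qed.

Lemma cderiveD f g x l m : is_cderive f x l -> is_cderive g x m ->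
  is_cderive (fun y => f y + g y) x (l + m).
Proof.
move=> [fR fI] [gR gI]; split.
  by under eq_fun do rewrite reD; rewrite reD; exact: is_deriveD.
by under eq_fun do rewrite imD; rewrite imD; exact: is_deriveD.
Qed.

Lemma cderiveM f g x l m : is_cderive f x l -> is_cderive g x m ->
  is_cderive (fun y => f y * g y) x (l * g x + f x * m).
Proof.
move=> [fR fI] [gR gI]; split.
  under eq_fun do rewrite reM.
  apply: is_derive_eq.
  by rewrite !reD !reM; rewrite /GRing.scale/=; ring.
under eq_fun do rewrite imM.
apply: is_derive_eq.
by rewrite !imD !imM; rewrite /GRing.scale/=; ring.
Qed.

Lemma cderiveZ (c : R[i]) f x l : is_cderive f x l ->
  is_cderive (fun y => c * f y) x (c * l).
Proof.
move=> fl; have := cderiveM (cderive_cst c x) fl; rewrite mul0r add0r.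
exact.
Qed.

Lemma cderiveX f x l n : is_cderive f x l ->
  is_cderive (fun y => f y ^+ n) x (n%:R * f x ^+ n.-1 * l).
Proof.
move=> fl; elim: n => [|n IH].
  by under eq_fun do rewrite expr0; rewrite mul0r mul0r; exact: cderive_cst.
under eq_fun do rewrite exprS.
have := cderiveM fl IH; congr is_cderive.
case: n {IH} => [|n]; rewrite ?expr0/=; first by ring.
by rewrite -[in RHS]natr1 exprS; ring.
Qed.

Lemma cderive_cexp f x l : is_cderive f x l ->
  is_cderive (fun y => cexp (f y)) x (l * cexp (f x)).
Proof.
move=> [fR fI]; under eq_fun do rewrite cexpE; split.
  under eq_fun do rewrite reM/= mul0r subr0.
  apply: is_derive_eq.
  by rewrite reM cexpE reM imM/= /GRing.scale/=; ring.
under eq_fun do rewrite imM/= mul0r addr0.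
apply: is_derive_eq.
by rewrite imM cexpE reM imM/= /GRing.scale/=; ring.
Qed.

Lemma eq_cderive f x l m : is_cderive f x l -> l = m -> is_cderive f x m.
Proof. by move=> fl <-. Qed.

Lemma is_derive_continuous (h : R -> R) (x l : R) : is_derive x 1 h l ->
  {for x, continuous h}.
Proof.
move=> hl; apply/differentiable_continuous/derivable1_diffP.
exact: ex_derive.
Qed.

End complex_derivative.

Section exhaustion.
Context {R : realType}.
Local Notation mu := (@lebesgue_measure R).

(** The fundamental theorem on the segments [a n, b n] passes to the limit by dominated convergence
    with |f| as the bound. One statement serves the line, the half-line and, with constant
    sequences, a segment. *)
Lemma FTC_exhaust (f F : R -> R) (D : set R) (a b : nat -> R) (l : R) :
  measurable D -> (forall n, a n < b n) ->
  (forall n, `[a n, b n] `<=` D) ->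
  (forall x, D x -> \forall n \near \oo, a n <= x <= b n) ->
  continuous f -> (forall x : R, is_derive x 1 F (f x)) ->
  mu.-integrable D (EFin \o f) ->
  (fun n => F (b n) - F (a n)) @ \oo --> l ->
  \int[mu]_(x in D) f x = l.
Proof.
move=> mD ab abD Dab cf dF fi Fl.
have mf : measurable_fun setT f by exact: continuous_measurable_fun.
have FTC n : (\int[mu]_(x in `[a n, b n]) (f x)%:E = (F (b n) - F (a n))%:E)%E.
  rewrite (@continuous_FTC2 _ _ F)//.
  - by apply: continuous_subspaceT.
  - split => //.
    + by apply: cvg_at_right_filter; exact: is_derive_continuous (dF _).
    + by apply: cvg_at_left_filter; exact: is_derive_continuous (dF _).
  - by move=> x _; rewrite derive1E derive_val.
pose f_ n := ((EFin \o f) \_ `[a n, b n])%E.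
have mf_ n : measurable_fun D (f_ n).
  apply: measurable_funTS; apply/(measurable_restrictT _ _).1 => //.
  by apply/measurable_EFinP; exact: measurable_funTS.
have cvf : (\int[mu]_(x in D) f_ n x)%E @[n --> \oo] -->
  (\int[mu]_(x in D) (EFin \o f) x)%E.
  apply: (@dominated_cvg _ _ _ mu D mD f_ (EFin \o f) (abse \o (EFin \o f))%E)
    => //.
  - move=> x Dx; apply: (@cvg_near_cst _ _ _ _ _).
    have := Dab x Dx; apply: filterS => n /andP[h1 h2].
    by rewrite /f_ patchE mem_set//= in_itv/= h1.
  - exact: integrable_abse.
  - move=> n x Dx; rewrite /f_ patchE; case: ifPn => // _.
    by rewrite abse0 abse_ge0.
have fnE n : (\int[mu]_(x in D) f_ n x)%E = (F (b n) - F (a n))%:E.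
  rewrite -FTC [LHS]integral_mkcond [RHS]integral_mkcond; apply: eq_integral =>
    x _.
  rewrite /f_ !patchE; case: ifPn => // xD; case: ifPn => // /set_mem xab.
  by move: xD; rewrite mem_set//; exact: abD xab.
have : (F (b n) - F (a n))%:E @[n --> \oo] --> l%:E.
  by apply: cvg_EFin => //; exact: nearW.
under eq_fun do rewrite -fnE.
move=> cvl; rewrite /Rintegral.
by have /= -> := cvg_unique _ cvf cvl.
Qed.

End exhaustion.

Section gaussian_integrability.
Context {R : realType}.
Local Notation mu := (@lebesgue_measure R).

Lemma expr_le_expR n (v : R) : 0 <= v -> v ^+ n <= n`!%:R * expR v.
Proof.
move=> v0; case: n => [|n]; first by rewrite expr0 fact0 mul1r -expR0 ler_expR.
have := expR_ge1Dxn n v0 => h.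
rewrite -ler_pdivrMl ?ltr0n ?fact_gt0// mulrC.
by apply: le_trans h; rewrite lerDr.
Qed.

(** Half of the Gaussian exponent is spent: one quarter absorbs the power of |y|, through v^k <= k!
    exp(v), and another quarter absorbs the linear term by completing a square. *)
Lemma gauss_domination (u : R) (k : nat) (be : R) : 0 < u -> 0 <= be ->
  exists2 C : R, 0 <= C & forall y : R,
    `|y| ^+ k * expR (- (u * y ^+ 2) + be * `|y|) <= C * expR (- (u / 2 * y ^+
      2)).
Proof.
move=> u0 be0; pose C1 := 1 + k`!%:R * (4 / u) ^+ k.
have C10 : 0 <= C1.
  by rewrite addr_ge0// mulr_ge0// exprn_ge0// divr_ge0// ltW.
exists (C1 * expR (be ^+ 2 / u)) => [|y]; first by rewrite mulr_ge0// expR_ge0.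
set s := `|y|; have s0 : 0 <= s by exact: normr_ge0.
have -> : y ^+ 2 = s ^+ 2 by rewrite /s real_normK ?num_real.
have h1 : s ^+ k <= C1 * expR (u / 4 * s ^+ 2).
  have e1 : 1 <= expR (u / 4 * s ^+ 2).
    by rewrite -[leLHS]expR0 ler_expR mulr_ge0 ?sqr_ge0// divr_ge0// ltW.
  have s2k : s ^+ k <= 1 + (s ^+ 2) ^+ k.
    rewrite -exprM mulnC exprM; set t := s ^+ k.
    have : 0 <= (t - 1) ^+ 2 by exact: sqr_ge0.
    have : 0 <= t by exact: exprn_ge0.
    by nra.
  have v0 : 0 <= u / 4 * s ^+ 2 by rewrite mulr_ge0 ?sqr_ge0// divr_ge0// ltW.
  have := expr_le_expR k v0; rewrite exprMn => h.
  apply: (le_trans s2k); rewrite /C1 mulrDl mul1r lerD//.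
  have u4 : 0 < (4 / u) ^+ k by rewrite exprn_gt0// divr_gt0.
  have := ler_wpM2l (ltW u4) h; rewrite mulrA -exprMn.
  have -> : 4 / u * (u / 4) = 1 by field; rewrite gt_eqF.
  by rewrite expr1n mul1r mulrA [_ * k`!%:R]mulrC.
apply: (le_trans (ler_wpM2r (expR_ge0 _) h1)).
rewrite -!mulrA ler_wpM2l// -!expRD ler_expR.
have h2 : be * s <= be ^+ 2 / u + u / 4 * s ^+ 2.
  rewrite -subr_ge0 (_ : _ - _ = (be - u / 2 * s) ^+ 2 / u).
    by rewrite divr_ge0 ?sqr_ge0// ltW.
  by field; rewrite gt_eqF.
by lra.
Qed.

Lemma integrable_gauss_scale (u : R) : 0 < u ->
  mu.-integrable setT (fun y => (expR (- (u * y ^+ 2)))%:E).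
Proof.
move=> u0; have su : 0 < Num.sqrt u by rewrite sqrtr_gt0.
have [] := integral_scale (lt0r_neq0 su) (@integrableT_gauss R).
by rewrite /gauss_fun; under eq_fun do rewrite exprMn sqr_sqrtr ?(ltW u0)//.
Qed.

Lemma le_gauss_cintegrable (f : R -> R[i]) (u be C : R) (k : nat) :
  0 < u -> 0 <= be -> 0 <= C -> cmeasurable f ->
  (forall y, normc (f y) <= C * (`|y| ^+ k * expR (- (u * y ^+ 2) + be * `|y|)))
    ->
  cintegrable mu f.
Proof.
move=> u0 be0 C0 mf fle; have [C1 C10 C1le] := gauss_domination k u0 be0.
apply: (@le_cintegrable _ _ _ mu f (fun y => C * C1 * expR (- (u / 2 * y ^+
  2)))) => //.
  under eq_fun do rewrite EFinM.
  by apply: integrableZl => //; apply: integrable_gauss_scale; rewrite divr_gt0.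
move=> y; apply: le_trans (fle y) _; rewrite -mulrA ler_wpM2l//.
Qed.

Lemma normc_gauss (a b c : R[i]) (y : R) :
  normc (cexp (- a * (y%:C)%C ^+ 2 + b * (y%:C)%C + c)) <=
  expR (complex.Re c) * expR (- (complex.Re a * y ^+ 2) + `|complex.Re b| *
    `|y|).
Proof.
rewrite normc_cexp -expRD ler_expR !reD.
have -> : complex.Re (- a * (y%:C)%C ^+ 2) = - (complex.Re a * y ^+ 2).
  by rewrite -rmorphXn reM reN/= mulr0 subr0 mulNr.
rewrite [leLHS]addrC lerD2l lerD2l reM/= mulr0 subr0 -normrM.
exact: ler_norm.
Qed.

Lemma cmeasurable_gauss (a b c : R[i]) :
  cmeasurable (fun y : R => cexp (- a * (y%:C)%C ^+ 2 + b * (y%:C)%C + c)).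
Proof.
apply: cmeasurable_cexp; apply: cmeasurableD; last exact: cmeasurable_cst.
have mid : cmeasurable (fun y : R => (y%:C)%C) by exact: cmeasurable_real.
by apply: cmeasurableD; apply: cmeasurableM;
  [exact: cmeasurable_cst|exact: cmeasurableX|exact: cmeasurable_cst|].
Qed.

Lemma cintegrable_gauss (a b c : R[i]) (p : R -> R) (k : nat) :
  0 < complex.Re a -> measurable_fun setT p -> (forall y,
    `|p y| <= `|y| ^+ k) ->
  cintegrable mu
    (fun y => (p y)%:C%C * cexp (- a * (y%:C)%C ^+ 2 + b * (y%:C)%C + c)).
Proof.
move=> a0 mp pk.
apply: (le_gauss_cintegrable (k := k) a0 (normr_ge0 (complex.Re b)) (expR_ge0
  (complex.Re c))).
  by apply: cmeasurableM; [exact: cmeasurable_real|exact: cmeasurable_gauss].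
move=> y; rewrite Normc.normcM normc_real.
apply: le_trans (ler_wpM2l (normr_ge0 _) (normc_gauss _ _ _ _)) _.
by rewrite mulrCA ler_wpM2l ?expR_ge0// ler_wpM2r ?expR_ge0.
Qed.

Lemma cintegrable_gauss0 (a b c : R[i]) : 0 < complex.Re a ->
  cintegrable mu (fun y => cexp (- a * (y%:C)%C ^+ 2 + b * (y%:C)%C + c)).
Proof.
move=> a0.
have h y : `|1 : R| <= `|y : R| ^+ 0 by rewrite expr0 normr1.
have := cintegrable_gauss b c a0 (measurable_cst _) h.
by congr cintegrable; apply/funext => y; rewrite mul1r.
Qed.

Lemma gauss_cvg0 (f : R -> R[i]) (u be C : R) (k : nat) (x : nat -> R) :
  0 < u -> 0 <= be -> 0 <= C -> (forall n, n.+1%:R <= `|x n|) ->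
  (forall y, normc (f y) <= C * (`|y| ^+ k * expR (- (u * y ^+ 2) + be * `|y|)))
    ->
  (fun n => normc (f (x n))) @ \oo --> (0 : R).
Proof.
move=> u0 be0 C0 xn fle; have [C1 C10 C1le] := gauss_domination k u0 be0.
(* The crude exp(-v) <= 1/v with v at least u (n + 1) / 2 reduces the decay to that of the harmonic
   sequence. *)
have bd n : normc (f (x n)) <= C * C1 * (2 / u) * n.+1%:R^-1.
  apply: le_trans (fle _) _; rewrite -!mulrA ler_wpM2l//.
  apply: le_trans (C1le _) _; rewrite ler_wpM2l//.
  have n1 : 1 <= n.+1%:R :> R by rewrite ler1n.
  have v0 : u / 2 * n.+1%:R <= expR (u / 2 * x n ^+ 2).
    apply: le_trans (expR_ge1Dx _); apply: ler_wpDl => //.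
    rewrite ler_wpM2l ?divr_ge0 ?(ltW u0)//.
    by rewrite -(real_normK (num_real (x n))); have := xn n; nra.
  rewrite expRN (_ : 2 * _ = (u / 2 * n.+1%:R)^-1); last first.
    by rewrite invfM invf_div mulrA.
  by rewrite lef_pV2 ?posrE ?expR_gt0// !mulr_gt0.
apply: (@squeeze_cvgr _ _ _ _ (cst 0) (fun n => C * C1 * (2 / u) * n.+1%:R^-1)).
- by apply: nearW => n; rewrite normc_ge0 bd.
- exact: cvg_cst.
- rewrite -[X in _ --> X](mulr0 (C * C1 * (2 / u))).
  apply: cvgM; first exact: cvg_cst.
  exact: cvg_harmonic.
Qed.

End gaussian_integrability.

Section gaussian_formula.
Context {R : realType}.
Local Notation mu := (@lebesgue_measure R).

Definition gauss_int (a : R[i]) : R[i] :=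
  cintegral mu (fun y => cexp (- a * (y%:C)%C ^+ 2)).

Lemma cderive_continuous (f f' : R -> R[i]) :
  (forall x, is_cderive f x (f' x)) ->
  continuous (fun x => complex.Re (f x)) /\ continuous (fun x =>
    complex.Im (f x)).
Proof.
by move=> df; split => x; [have [h _] := df x|have [_ h] := df x];
  exact: is_derive_continuous h.
Qed.

(** [F''] is there to make [F'] continuous, as the fundamental theorem requires. *)
Lemma cintegral_derive0 (F F' F'' : R -> R[i]) :
  (forall x, is_cderive F x (F' x)) -> (forall x, is_cderive F' x (F'' x)) ->
  cintegrable mu F' ->
  (fun n : nat => normc (F n.+1%:R)) @ \oo --> (0 : R) ->
  (fun n : nat => normc (F (- n.+1%:R))) @ \oo --> (0 : R) ->
  cintegral mu F' = 0.
Proof.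
move=> dF dF' [iR iI] cy cNy; have [cR cI] := cderive_continuous dF'.
have ab (n : nat) : - n.+1%:R < n.+1%:R :> R by rewrite gtrN// ltr0n.
have ex (x : R) : [set: R] x -> \forall n \near \oo, - n.+1%:R <= x <= n.+1%:R.
  move=> _; near=> n; rewrite -ler_norml.
  apply: (@le_trans _ _ n%:R); last by rewrite ler_nat.
  by near: n; exact: nbhs_infty_ger.
have part (p : R[i] -> R) : (forall z, `|p z| <= normc z) -> (forall x y,
  p (x - y) = p x - p y) ->
    (fun n : nat => p (F n.+1%:R) - p (F (- n.+1%:R))) @ \oo --> (0 : R).
  move=> pn pB; apply: norm_cvg0.
  apply: (@squeeze_cvgr _ _ _ _ (cst 0) (fun n : nat =>
    normc (F n.+1%:R) + normc (F (- n.+1%:R)))).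
  - apply: nearW => n; rewrite normr_ge0/=.
    by apply: le_trans (ler_normB _ _) _; apply: lerD.
  - exact: cvg_cst.
  - by rewrite -[X in _ --> X](addr0 (0:R)); apply: cvgD.
apply: complex_eqP => /=.
  apply: (FTC_exhaust (F := fun x => complex.Re (F x)) (a := fun n =>
    - n.+1%:R) (b := fun n => n.+1%:R)) => //.
  - by move=> x; have [] := dF x.
  - by apply: part => [z|x y]; [exact: normc_Re|rewrite reD reN].
apply: (FTC_exhaust (F := fun x => complex.Im (F x)) (a := fun n =>
  - n.+1%:R) (b := fun n => n.+1%:R)) => //.
- by move=> x; have [] := dF x.
- by apply: part => [z|x y]; [exact: normc_Im|rewrite imD imN].
Unshelve. all: end_near. Qed.

Lemma cintegral_derive_ray (F F' F'' : R -> R[i]) :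
  (forall x, is_cderive F x (F' x)) -> (forall x, is_cderive F' x (F'' x)) ->
  cintegrable mu F' ->
  (fun n : nat => normc (F n.+1%:R)) @ \oo --> (0 : R) ->
  cintegral mu (fun x => (\1_(`[0, +oo[%classic : set R) x)%:C%C * F' x) = - F
    0.
Proof.
move=> dF dF' [iR iI] cy; have [cR cI] := cderive_continuous dF'.
pose D := `[0, +oo[%classic : set R.
have mD : measurable D by exact: measurable_itv.
have ab (n : nat) : 0 < n.+1%:R :> R by rewrite ltr0n.
have abD (n : nat) : `[0, n.+1%:R] `<=` D.
  by move=> x; rewrite /D/= !in_itv/= => /andP[->].
have ex (x : R) : D x -> \forall n \near \oo, 0 <= x <= n.+1%:R.
  rewrite /D/= in_itv/= andbT => x0; near=> n; rewrite x0/=.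
  apply: (@le_trans _ _ n%:R); last by rewrite ler_nat.
  by near: n; exact: nbhs_infty_ger.
have part (p : R[i] -> R) : (forall z, `|p z| <= normc z) ->
    (fun n : nat => p (F n.+1%:R) - p (F 0)) @ \oo --> - p (F 0).
  move=> pn; rewrite -[X in _ --> X]add0r.
  apply: cvgB; last exact: cvg_cst.
  apply: norm_cvg0.
  apply: (@squeeze_cvgr _ _ _ _ (cst 0) (fun n : nat => normc (F n.+1%:R))) =>
    //.
  - by apply: nearW => n; rewrite normr_ge0/= pn.
  - exact: cvg_cst.
apply: complex_eqP; rewrite ?reN ?imN /=.
  transitivity (\int[mu]_(x in D) complex.Re (F' x)).
    rewrite Rintegral_mkcond; apply: eq_Rintegral => x _.
    by rewrite reZ patchE indicE; case: (x \in D); rewrite ?mul1r ?mul0r.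
  apply: (FTC_exhaust (F := fun x => complex.Re (F x)) (a := fun n => 0) (b :=
    fun n => n.+1%:R)) => //.
  - by move=> x; have [] := dF x.
  - exact: integrableS iR.
  - by apply: part => z; exact: normc_Re.
transitivity (\int[mu]_(x in D) complex.Im (F' x)).
  rewrite Rintegral_mkcond; apply: eq_Rintegral => x _.
  by rewrite imZ patchE indicE; case: (x \in D); rewrite ?mul1r ?mul0r.
apply: (FTC_exhaust (F := fun x => complex.Im (F x)) (a := fun n => 0) (b :=
  fun n => n.+1%:R)) => //.
- by move=> x; have [] := dF x.
- exact: integrableS iI.
- by apply: part => z; exact: normc_Im.
Unshelve. all: end_near. Qed.

Lemma cderive_quadratic (a b c : R[i]) (x : R) :
  is_cderive (fun y : R => - a * (y%:C)%C ^+ 2 + b * (y%:C)%C + c) x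
    (- a * (2 * (x%:C)%C) + b).
Proof.
have h2 := cderiveZ (- a) (cderiveX 2 (cderive_real x)).
have h1 := cderiveZ b (cderive_real x).
apply: eq_cderive (cderiveD (cderiveD h2 h1) (cderive_cst c x)) _.
by rewrite /= expr1 !mulr1 addr0.
Qed.

Lemma cderive_gauss (a b c : R[i]) (x : R) :
  is_cderive (fun y : R => cexp (- a * (y%:C)%C ^+ 2 + b * (y%:C)%C + c)) x
    ((- a * (2 * (x%:C)%C) + b) * cexp (- a * (x%:C)%C ^+ 2 + b * (x%:C)%C +
      c)).
Proof. exact: cderive_cexp (cderive_quadratic _ _ _ _). Qed.

End gaussian_formula.

Section gaussian_transform.
Context {R : realType}.
Local Notation mu := (@lebesgue_measure R).
Local Notation toC x := ((x : R)%:C%C).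

Lemma Re_gt0_neq0 (a : R[i]) : 0 < complex.Re a -> a != 0.
Proof. by move=> a0; apply/eqP => az; move: a0; rewrite az ltxx. Qed.

Lemma normc_affine (a b : R[i]) (y : R) :
  normc (a * toC y + b) <= (normc a + normc b) * expR `|y|.
Proof.
apply: le_trans (le_normcD _ _) _; rewrite Normc.normcM normc_real.
have e1 : 1 + `|y| <= expR `|y| by exact: expR_ge1Dx.
have := normc_ge0 a; have := normc_ge0 b; have := normr_ge0 y; nra.
Qed.

(** The affine factor is bounded by a multiple of exp(|y|), which joins the linear exponent; hence
    the 1 added to [|Re b|]. *)
Lemma gauss_derive_bound (a b c p q : R[i]) (y : R) :
  normc ((p * toC y + q) * cexp (- a * toC y ^+ 2 + b * toC y + c)) <=
  (normc p + normc q) * expR (complex.Re c) *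
    (`|y| ^+ 0 * expR (- (complex.Re a * y ^+ 2) + (1 + `|complex.Re b|) *
      `|y|)).
Proof.
rewrite Normc.normcM expr0 mul1r (mulrDl 1) mul1r addrCA expRD.
apply: le_trans (ler_pM (normc_ge0 _) (normc_ge0 _) (normc_affine _ _ _)
  (normc_gauss _ _ _ _)) _.
by rewrite le_eqVlt; apply/orP; left; apply/eqP; ring.
Qed.

Lemma cintegrable_gauss_derive (a b c p q : R[i]) : 0 < complex.Re a ->
  cintegrable mu (fun y => (p * toC y + q) * cexp (- a * toC y ^+ 2 + b * toC y
    + c)).
Proof.
move=> a0; apply: (le_gauss_cintegrable a0 _ _ _ (gauss_derive_bound a b c p
  q)).
- by rewrite addr_ge0.
- by rewrite mulr_ge0 ?expR_ge0// addr_ge0 ?normc_ge0.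
- apply: cmeasurableM; last exact: cmeasurable_gauss.
  apply: cmeasurableD; last exact: cmeasurable_cst.
  by apply: cmeasurableM; [exact: cmeasurable_cst|exact: cmeasurable_real].
Qed.

Lemma gauss_cvg0_gen (a b c : R[i]) (x : nat -> R) : 0 < complex.Re a ->
  (forall n, n.+1%:R <= `|x n|) ->
  (fun n => normc (cexp (- a * toC (x n) ^+ 2 + b * toC (x n) + c))) @ \oo -->
    (0 : R).
Proof.
move=> a0 xn.
apply: (@gauss_cvg0 _ (fun y => cexp (- a * toC y ^+ 2 + b * toC y + c)) _
  `|complex.Re b| (expR (complex.Re c)) 0 x a0) => //.
by move=> y; rewrite expr0 mul1r; exact: normc_gauss.
Qed.

Lemma cintegral_derive_gauss (a b c : R[i]) : 0 < complex.Re a ->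
  cintegral mu (fun y => (- a * (2 * toC y) + b) * cexp (- a * toC y ^+ 2 + b *
    toC y + c)) = 0.
Proof.
move=> a0; apply: (cintegral_derive0 (F := fun y =>
  cexp (- a * toC y ^+ 2 + b * toC y + c))
  (F'' := fun y => - a * (2 * 1) * cexp (- a * toC y ^+ 2 + b * toC y + c) +
    (- a * (2 * toC y) + b) * ((- a * (2 * toC y) + b) * cexp (- a * toC y ^+ 2
      + b * toC y + c)))).
- by move=> x; exact: cderive_gauss.
- move=> x; apply: cderiveM; last exact: cderive_gauss.
  have h := cderiveD (cderiveZ (- a) (cderiveZ 2 (cderive_real x))) (cderive_cst
    b x).
  by apply: eq_cderive h _; rewrite addr0.
- have := cintegrable_gauss_derive b c (- a * 2) b a0.
  by under eq_fun do rewrite -mulrA.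
- by apply: gauss_cvg0_gen => // n; rewrite ger0_norm.
- by apply: gauss_cvg0_gen => // n; rewrite normrN ger0_norm.
Qed.

Lemma cintegral_derive01 (F F' F'' : R -> R[i]) :
  (forall x, is_cderive F x (F' x)) -> (forall x, is_cderive F' x (F'' x)) ->
  cintegral mu (fun x => toC (\1_(`[0, 1]%classic : set R) x) * F' x) = F 1 - F
    0.
Proof.
move=> dF dF'; have [cR cI] := cderive_continuous dF'.
pose D := `[0, 1]%classic : set R.
have mD : measurable D by exact: measurable_itv.
have part (f F0 : R -> R) : continuous f -> (forall x : R,
  is_derive x 1 F0 (f x)) ->
    \int[mu]_(x in D) f x = F0 1 - F0 0.
  move=> cf df; apply: (FTC_exhaust (F := F0) (a := fun=> 0) (b := fun=> 1)) =>
    //.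
  - by move=> _.
  - by move=> x Dx; apply: nearW => n; move: Dx; rewrite /D/= in_itv.
  - apply: continuous_compact_integrable; first exact: segment_compact.
    exact: continuous_subspaceT.
  - exact: cvg_cst.
apply: complex_eqP; rewrite ?reD ?imD ?reN ?imN /=.
  rewrite -[RHS](part (fun x => complex.Re (F' x)) (fun x =>
    complex.Re (F x)))//; last by move=> x; have [] := dF x.
  rewrite Rintegral_mkcond; apply: eq_Rintegral => x _.
  by rewrite reZ patchE indicE; case: (x \in D); rewrite ?mul1r ?mul0r.
rewrite -[RHS](part (fun x => complex.Im (F' x)) (fun x => complex.Im (F x)))//;
  last by move=> x; have [] := dF x.
rewrite Rintegral_mkcond; apply: eq_Rintegral => x _.
by rewrite imZ patchE indicE; case: (x \in D); rewrite ?mul1r ?mul0r.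
Qed.

(* Moving the contour from x to x - eta b / (2 a), eta in [0, 1]: the
   derivative in eta of the integrand is a multiple of its derivative in x. *)
Lemma cintegral_gauss (a b : R[i]) : 0 < complex.Re a ->
  cintegral mu (fun y => cexp (- a * toC y ^+ 2 + b * toC y)) =
  gauss_int a * cexp (b ^+ 2 / (4 * a)).
Proof.
move=> a0; have an0 := Re_gt0_neq0 a0.
have a4 : 4 * a != 0 by rewrite mulf_neq0// pnatr_eq0.
pose s := - (b ^+ 2 / (4 * a)).
(* This is exp(-a (x - e b / (2 a))^2) expanded: the shift by a complex amount becomes a polynomial
   in two real variables. *)
pose Phi (x e : R) := cexp (s * toC e ^+ 2 + (b * toC x) * toC e + - a * toC x
  ^+ 2).
pose dPhi (x e : R) := (s * (2 * toC e) + b * toC x) * Phi x e.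
pose D := `[0, 1]%classic : set R.
have mD : measurable D by exact: measurable_itv.
have dP x e : is_cderive (Phi x) e (dPhi x e).
  by have := cderive_gauss (- s) (b * toC x) (- a * toC x ^+ 2) e;
    rewrite opprK.
have dP' x e : is_cderive (dPhi x) e ((s * (2 * 1)) * Phi x e + (s * (2 * toC e)
  + b * toC x) * dPhi x e).
  apply: cderiveM; last exact: dP.
  have h := cderiveD (cderiveZ s (cderiveZ 2 (cderive_real e))) (cderive_cst (b
    * toC x) e).
  by apply: eq_cderive h _; rewrite addr0.
have FTC x : cintegral mu (fun e => toC (\1_D e) * dPhi x e) = Phi x 1 - Phi x
  0.
  exact: cintegral_derive01 (dP x) (dP' x).
have PhiE x e : Phi x e = cexp (- a * toC x ^+ 2 + (toC e * b) * toC x + s * toC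
  e ^+ 2).
  by rewrite /Phi; congr cexp; ring.
have dPhiE x e : toC (\1_D e) * dPhi x e = toC (\1_D e) * - (b / (2 * a)) *
    ((- a * (2 * toC x) + toC e * b) * cexp (- a * toC x ^+ 2 + (toC e * b) *
      toC x + s * toC e ^+ 2)).
  rewrite /dPhi PhiE !mulrA; congr (_ * _); rewrite -!mulrA; congr (_ * _).
  by rewrite /s; field; rewrite an0.
pose K z := toC (\1_D z.2) * dPhi z.1 z.2.
have mK : cmeasurable K.
  have m1 : cmeasurable (fun z : R * R => toC z.1) by exact: cmeasurable_real.
  have m2 : cmeasurable (fun z : R * R => toC z.2) by exact: cmeasurable_real.
  have mc c : cmeasurable (fun _ : R * R => c : R[i]) by exact: cmeasurable_cst.
  apply: cmeasurableM.
    apply: cmeasurable_real; exact: (measurableT_comp (measurable_indic mD)).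
  apply: cmeasurableM.
    by apply: cmeasurableD; apply: cmeasurableM => //; exact: cmeasurableM.
  apply: cmeasurable_cexp; apply: cmeasurableD; [apply: cmeasurableD|].
  - by apply: cmeasurableM => //; exact: cmeasurableX.
  - by apply: cmeasurableM => //; exact: cmeasurableM.
  - by apply: cmeasurableM => //; exact: cmeasurableX.
have iK : cintegrable (mu \x mu)%E K.
  (* For e in [0, 1] one has |e b| <= |b| and Re (s e^2) <= |s|, so a single Gaussian in x dominates
     uniformly in e. *)
  pose be := 1 + normc b.
  pose C := normc (b / (2 * a)) * ((normc (- a * 2) + normc b) * expR (normc
    s)).
  pose f1 (x : R) := toC (C * (`|x| ^+ 0 * expR (- (complex.Re a * x ^+ 2) + be
    * `|x|))).
  pose f2 (e : R) := toC (\1_D e).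
  have C0 : 0 <= C by rewrite !mulr_ge0 ?normc_ge0 ?expR_ge0// addr_ge0
    ?normc_ge0.
  have be0 : 0 <= be by rewrite addr_ge0 ?normc_ge0.
  have if1 : cintegrable mu f1.
    apply: (le_gauss_cintegrable (k := 0) a0 be0 C0).
      apply: cmeasurable_real; apply: measurable_funM => //.
      under eq_fun do rewrite expr0 mul1r.
      apply: measurableT_comp => //; apply: measurable_funD.
        by apply: measurableT_comp => //; apply: measurable_funM => //;
          exact: measurable_funX.
      by apply: measurable_funM => //; exact: measurableT_comp.
    by move=> y; rewrite normc_real ger0_norm// mulr_ge0// mulr_ge0 ?expR_ge0//
      exprn_ge0.
  have if2 : cintegrable mu f2.
    have muD : (mu D < +oo)%E.
      by rewrite /D lebesgue_measure_itv/= lte_fin ltr01 -EFinB ltry.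
    exact: (cintegrable_indic (mu := mu) mD muD).
  have := cintegrable_normc (cintegrable_prod (m1 := mu) (m2 := mu) if1 if2).
  move=> /(@le_cintegrable _ _ _ (mu \x mu)%E K); apply => // -[x e].
  rewrite /K [z in z.1]/= [z in z.2]/= [leRHS]/=.
  rewrite dPhiE -[X in _ <= X]/(normc (f1 x * f2 e)).
  set G := (_ + toC e * b) * cexp _.
  rewrite -mulrA Normc.normcM [normc (_ * G)]Normc.normcM.
  rewrite [normc (f1 x * _)]Normc.normcM /f1 /f2 !normc_real normcN.
  have [eD|] := boolP (e \in D); last first.
    by rewrite !indicE => /negbTE ->; rewrite normr0 !(mul0r, mulr0).
  move: (eD); rewrite inE /D/= in_itv/= => /andP[e0 e1].
  rewrite !indicE eD normr1 mulr1 mul1r [leRHS]ger0_norm; last first.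
    by rewrite mulr_ge0// mulr_ge0 ?expR_ge0// exprn_ge0.
  rewrite /C -[leRHS]mulrA ler_wpM2l ?normc_ge0//.
  rewrite /G [- a * (2 * _)]mulrA.
  apply: le_trans (gauss_derive_bound _ _ _ _ _ _) _.
  have eb : normc (toC e * b) <= normc b.
    by rewrite Normc.normcM normc_real ger0_norm// ler_piMl ?normc_ge0.
  apply: ler_pM.
  - by rewrite mulr_ge0 ?expR_ge0// addr_ge0 ?normc_ge0.
  - by rewrite mulr_ge0 ?expR_ge0// exprn_ge0.
  - apply: ler_pM; rewrite ?expR_ge0 ?addr_ge0 ?normc_ge0//; first exact: lerD.
    rewrite ler_expR (le_trans (ler_norm _))// (le_trans (normc_Re _))//.
    rewrite Normc.normcM -rmorphXn normc_real ger0_norm ?sqr_ge0//.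
    by rewrite ler_piMr ?normc_ge0// expr_le1.
  - rewrite ler_wpM2l ?exprn_ge0// ler_expR lerD2l ler_wpM2r// lerD2l.
    exact: le_trans (normc_Re _) eb.
have exch := cintegral_exchange iK.
have Phi1 x : Phi x 1 = cexp (- (b ^+ 2 / (4 * a))) * cexp (- a * toC x ^+ 2 + b
  * toC x).
  by rewrite /Phi -cexpD; congr cexp; rewrite /s/=; ring.
have Phi0 x : Phi x 0 = cexp (- a * toC x ^+ 2).
  by rewrite /Phi; congr cexp; rewrite /=; ring.
have i1 : cintegrable mu (fun x => cexp (- a * toC x ^+ 2 + b * toC x)).
  by have := cintegrable_gauss0 b 0 a0; under eq_fun do rewrite addr0.
have i0 : cintegrable mu (fun x => cexp (- a * toC x ^+ 2)).
  by have := cintegrable_gauss0 0 0 a0; under eq_fun do rewrite mul0r !addr0.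
have L : cintegral mu (fun x => cintegral mu (fun e => K (x, e))) =
    cexp (- (b ^+ 2 / (4 * a))) * cintegral mu (fun y =>
      cexp (- a * toC y ^+ 2 + b * toC y))
    - gauss_int a.
  under eq_cintegral => x do
    rewrite (FTC x : cintegral mu (fun e => K (x,
      e)) = _) Phi1 Phi0 -[X in _ + X]mulN1r.
  rewrite (cintegralD (cintegrableZl _ i1) (cintegrableZl _ i0)).
  by rewrite (cintegralZl _ i1) (cintegralZl _ i0) mulN1r.
(* In this order the inner integral is, for each e, a constant times the integral over the line of
   an x-derivative. *)
have Z : cintegral mu (fun e => cintegral mu (fun x => K (x, e))) = 0.
  rewrite (_ : (fun _ => _) = (fun _ => 0)); last first.
    apply/funext => e; under eq_cintegral do rewrite /K/= dPhiE.
    have := cintegrable_gauss_derive (toC e * b) (s * toC e ^+ 2) (- a * 2) (toC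
      e * b) a0.
    under eq_fun do rewrite -[- a * 2 * _]mulrA.
    by move=> ie; rewrite (cintegralZl _ ie) (cintegral_derive_gauss _ _ a0)
      mulr0.
  by rewrite /cintegral /Rintegral !integral0.
move: exch; rewrite L Z => /eqP; rewrite subr_eq0 => /eqP <-.
by rewrite mulrAC -cexpD addNr cexp0 mul1r.
Qed.

End gaussian_transform.

Section gaussian_integral.
Context {R : realType}.
Local Notation mu := (@lebesgue_measure R).
Local Notation toC x := ((x : R)%:C%C).
Local Notation conj z := (z^*)%C.

Lemma cexp_conj (z : R[i]) : cexp (conj z) = conj (cexp z).
Proof.
by case: z => a b; rewrite !cexpE/= /expi cosN sinN; apply: complex_eqP => /=;
  ring.
Qed.

Lemma cintegral_conj (f : R -> R[i]) : cintegrable mu f ->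
  cintegral mu (fun x => conj (f x)) = conj (cintegral mu f).
Proof.
move=> [fR fI]; apply: complex_eqP => /=.
  by apply: eq_Rintegral => x _; case: (f x).
rewrite -mulN1r -RintegralZl//; apply: eq_Rintegral => x _.
by case: (f x) => a b /=; rewrite mulN1r.
Qed.

Lemma re_gauss (a : R[i]) (x : R) :
  complex.Re (- a * toC x ^+ 2) = - (complex.Re a * x ^+ 2).
Proof. by rewrite mulNr reN -rmorphXn mulrC reZ mulrC. Qed.

Lemma gauss_int_integrable (a : R[i]) : 0 < complex.Re a ->
  cintegrable mu (fun x => cexp (- a * toC x ^+ 2)).
Proof.
by move=> a0; have := cintegrable_gauss0 0 0 a0;
  under eq_fun do rewrite mul0r !addr0.
Qed.

Lemma gauss_int_conj (a : R[i]) : 0 < complex.Re a ->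
  gauss_int (conj a) = conj (gauss_int a).
Proof.
move=> a0; rewrite /gauss_int -cintegral_conj; last exact: gauss_int_integrable.
apply: eq_cintegral => x; rewrite -cexp_conj; congr cexp.
by rewrite rmorphM rmorphN rmorphXn/= oppr0.
Qed.

Lemma gauss_int_scale (a : R[i]) (l : R) : 0 < complex.Re a -> l != 0 ->
  gauss_int (toC l ^+ 2 * a) = toC `|l|^-1 * gauss_int a.
Proof.
move=> a0 l0; have [_ <-] := cintegral_scale l0 (gauss_int_integrable a0).
by apply: eq_cintegral => x; congr cexp; rewrite rmorphM/=; ring.
Qed.

Lemma cexp_gauss_fun (x : R) : cexp (- 1 * toC x ^+ 2) = toC (gauss_fun x).
Proof.
rewrite (_ : - 1 * toC x ^+ 2 = toC (- x ^+ 2));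
  last by rewrite rmorphN rmorphXn mulN1r.
by rewrite cexpE/= expi0 mulr1.
Qed.

Lemma gauss_int1 : gauss_int (1 : R[i]) = toC (Num.sqrt pi).
Proof.
rewrite /gauss_int; under eq_cintegral do rewrite cexp_gauss_fun.
apply: complex_eqP.
  by rewrite -[LHS]/(fine (\int[mu]_x (gauss_fun x)%:E)) integralT_gauss.
by rewrite -[LHS]/(\int[mu]_x 0) /Rintegral integral0.
Qed.

Lemma gauss_int1_gt0 : 0 < normc (gauss_int (1 : R[i])).
Proof. by rewrite gauss_int1 normc_real normr_gt0 gt_eqF// sqrtr_gt0 pi_gt0.
  Qed.

Lemma gauss_int_real (s : R) : 0 < s ->
  gauss_int (toC s) = toC (Num.sqrt s)^-1 * gauss_int 1.
Proof.
move=> s0; have l0 : Num.sqrt s != 0 by rewrite gt_eqF// sqrtr_gt0.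
have -> : toC s = toC (Num.sqrt s) ^+ 2 * 1.
  by rewrite mulr1 -rmorphXn sqr_sqrtr// ltW.
by rewrite gauss_int_scale//= ?ger0_norm ?sqrtr_ge0.
Qed.

Lemma mulcJ_normc (z : R[i]) : z * conj z = toC (normc z ^+ 2).
Proof.
case: z => a b; rewrite normc_sqr; apply: complex_eqP => /=; ring.
Qed.

(* With y = x + p in J w * conj (J w), the integral in x is Gaussian with real
   coefficient 2 Re w, and leaves exp (- |w|^2 p^2 / (2 Re w)). *)
Lemma normc_gauss_int (w : R[i]) : 0 < complex.Re w ->
  normc (gauss_int w) ^+ 2 * normc w = normc (gauss_int 1) ^+ 2.
Proof.
move=> w0; set u := complex.Re w; have cw0 : 0 < complex.Re (conj w) by case:
  (w) w0.
have wn0 := Re_gt0_neq0 w0; have nw0 : 0 < normc w.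
  by rewrite lt_neqAle normc_ge0 andbT eq_sym; apply: contra wn0 =>
    /eqP/Normc.eq0_normc ->.
have iw := gauss_int_integrable w0; have icw := gauss_int_integrable cw0.
pose K (z : R * R) := cexp (- w * toC z.1 ^+ 2) * cexp (- conj w * toC (z.2 +
  z.1) ^+ 2).
have twou : w + conj w = toC (2 * u) by rewrite /u; case: (w) => a b;
  apply: complex_eqP => /=; ring.
have KE x p : K (x, p) = cexp (- conj w * toC p ^+ 2) *
    cexp (- toC (2 * u) * toC x ^+ 2 + (- 2 * conj w * toC p) * toC x).
  rewrite /K/= -!cexpD; congr cexp; rewrite -twou rmorphD/=; ring.
have u2 : 0 < complex.Re (toC (2 * u)) by rewrite /= mulr_gt0.
have mK : cmeasurable K.
  have m1 : cmeasurable (fun z : R * R => toC z.1) by exact: cmeasurable_real.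
  have m2 : cmeasurable (fun z : R * R => toC (z.2 + z.1)).
    by apply: cmeasurable_real; exact: measurable_funD.
  by apply: cmeasurableM; apply: cmeasurable_cexp; apply: cmeasurableM;
    [exact: cmeasurable_cst|exact: cmeasurableX|exact: cmeasurable_cst|exact:
      cmeasurableX].
have iK : cintegrable (mu \x mu)%E K.
  (* The modulus of [K] is exp(-u x^2 - u (x + p)^2), and the quadratic form x^2 + (x + p)^2
     dominates x^2/2 + p^2/4; this separates the variables. *)
  have u20 : 0 < complex.Re (toC (u / 2)) by rewrite /= divr_gt0.
  have u40 : 0 < complex.Re (toC (u / 4)) by rewrite /= divr_gt0.
  have := cintegrable_normc (cintegrable_prod (m1 := mu) (m2 := mu)
    (gauss_int_integrable u20) (gauss_int_integrable u40)).
  move=> /(@le_cintegrable _ _ _ (mu \x mu)%E K); apply => // -[x p].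
  rewrite /K ![(_, _).1]/= ![(_, _).2]/= Normc.normcM [leRHS]Normc.normcM.
  rewrite !normc_cexp -!expRD ler_expR.
  rewrite !re_gauss.
  have -> : complex.Re (conj w) = u by rewrite /u; case: (w).
  rewrite -[complex.Re w]/u /=.
  have : 0 <= u * (x + p / 2 ) ^+ 2 by rewrite mulr_ge0 ?sqr_ge0// ltW.
  have : 0 <= u * (x + p) ^+ 2 by rewrite mulr_ge0 ?sqr_ge0// ltW.
  have : 0 <= u * p ^+ 2 by rewrite mulr_ge0 ?sqr_ge0// ltW.
  have : 0 <= u * x ^+ 2 by rewrite mulr_ge0 ?sqr_ge0// ltW.
  by rewrite !sqrrD !mulrDr; lra.
have L : cintegral mu (fun x => cintegral mu (fun p => K (x, p))) =
    gauss_int w * gauss_int (conj w).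
  have inner x : cintegral mu (fun p => K (x, p)) =
      gauss_int (conj w) * cexp (- w * toC x ^+ 2).
    have [ish shE] := cintegral_shift x icw.
    rewrite mulrC; transitivity (cexp (- w * toC x ^+ 2) *
        cintegral mu (fun p => cexp (- conj w * toC (p + x) ^+ 2))).
      exact: (cintegralZl (cexp (- w * toC x ^+ 2)) ish).
    by congr (_ * _).
  transitivity (cintegral mu (fun x => gauss_int (conj w) * cexp (- w * toC x ^+
    2))).
    by apply: eq_cintegral => x; exact: inner.
  by rewrite mulrC; exact: (cintegralZl _ iw).
have v0 : 0 < normc w ^+ 2 / (2 * u) by rewrite divr_gt0 ?exprn_gt0// mulr_gt0.
have Rr : cintegral mu (fun p => cintegral mu (fun x => K (x, p))) =
    gauss_int (toC (2 * u)) * gauss_int (toC (normc w ^+ 2 / (2 * u))).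
  have inner p : cintegral mu (fun x => K (x, p)) =
      gauss_int (toC (2 * u)) * cexp (- toC (normc w ^+ 2 / (2 * u)) * toC p ^+
        2).
    have ig : cintegrable mu (fun x => cexp (- toC (2 * u) * toC x ^+ 2 +
        (- 2 * conj w * toC p) * toC x)).
      by have := cintegrable_gauss0 (- 2 * conj w * toC p) 0 u2;
        under eq_fun do rewrite addr0.
    transitivity (cexp (- conj w * toC p ^+ 2) * cintegral mu (fun x =>
        cexp (- toC (2 * u) * toC x ^+ 2 + (- 2 * conj w * toC p) * toC x))).
      by rewrite -(cintegralZl _ ig); apply: eq_cintegral => x; exact: KE.
    rewrite (cintegral_gauss _ u2) mulrCA -cexpD; congr (_ * cexp _).
    have cwE : conj w = toC (2 * u) - w by rewrite -twou addrAC subrr add0r.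
    have -> : toC (normc w ^+ 2 / (2 * u)) = w * conj w / toC (2 * u).
      by rewrite mulcJ_normc; exact: fmorph_div.
    by rewrite cwE; field; exact: Re_gt0_neq0.
  have iv := gauss_int_integrable (a := toC (normc w ^+ 2 / (2 * u))) v0.
  rewrite -(cintegralZl _ iv); apply: eq_cintegral => p; exact: inner.
have := cintegral_exchange iK; rewrite L Rr gauss_int_conj// mulcJ_normc.
rewrite (gauss_int_real (mulr_gt0 _ w0))// (gauss_int_real v0).
rewrite gauss_int1 normc_real ger0_norm ?sqrtr_ge0// -!rmorphM => /complexI ->.
(* The two real parameters 2 u and |w|^2 / (2 u) have product |w|^2, so Re w drops out and only |w|
   is left. *)
rewrite mulrACA -invfM -sqrtrM ?mulr_ge0 ?(ltW w0)//.
rewrite (_ : 2 * complex.Re w * _ = normc w ^+ 2); last first.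
  by rewrite -/u; field; rewrite gt_eqF.
rewrite (sqrtr_sqr (normc w)) (ger0_norm (normc_ge0 w)).
by rewrite mulrAC mulVf ?gt_eqF// mul1r expr2.
Qed.

End gaussian_integral.

(** * Absolute moments of complex Gaussians *)

Section gaussian_moments.
Context {R : realType}.
Local Notation mu := (@lebesgue_measure R).
Local Notation toC x := ((x : R)%:C%C).
Local Notation rayp := (`[0%R, +oo[%classic : set R).
Implicit Types (w : R[i]) (k : nat).

Definition gauss_moment k w : R[i] :=
  cintegral mu (fun y => toC (`|y| ^+ k) * cexp (- w * toC y ^+ 2)).

Definition gauss_mono k w (y : R) : R[i] := toC (y ^+ k) * cexp (- w * toC y ^+
  2).

(** On the half-line |y|^k is a monomial, so that integration by parts is available for odd k as
    well. *)
Definition half_moment k w : R[i] :=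
  cintegral mu (fun y => toC (\1_rayp y) * gauss_mono k w y).

Lemma cderive_gauss_mono k w x :
  is_cderive (gauss_mono k w) x
    (k%:R * gauss_mono k.-1 w x + - (2 * w) * gauss_mono k.+1 w x).
Proof.
rewrite /gauss_mono; under eq_fun do rewrite rmorphXn.
have hG : is_cderive (fun y : R => cexp (- w * toC y ^+ 2)) x
    (- w * (2 * toC x) * cexp (- w * toC x ^+ 2)).
  have := cderive_gauss w 0 0 x; rewrite mul0r !addr0.
  by under eq_fun do rewrite mul0r !addr0.
apply: eq_cderive (cderiveM (cderiveX k (cderive_real x)) hG) _.
by rewrite !rmorphXn mulr1 /= (exprS _ k); ring.
Qed.

Lemma cmeasurable_gauss_mono k w : cmeasurable (gauss_mono k w).
Proof.
apply: cmeasurableM; first by apply: cmeasurable_real; exact: measurable_funX.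
apply: cmeasurable_cexp; apply: cmeasurableM; first exact: cmeasurable_cst.
by apply: cmeasurableX; exact: cmeasurable_real.
Qed.

Lemma normc_gauss_mono k w y :
  normc (gauss_mono k w y) = `|y| ^+ k * expR (- (complex.Re w * y ^+ 2)).
Proof.
by rewrite /gauss_mono Normc.normcM normc_cexp normc_real normrX re_gauss.
Qed.

Lemma cintegrable_gauss_mono k w : 0 < complex.Re w ->
  cintegrable mu (gauss_mono k w).
Proof.
move=> w0; apply: (le_gauss_cintegrable (k := k) w0 (lexx 0) ler01).
  exact: cmeasurable_gauss_mono.
by move=> y; rewrite normc_gauss_mono mul0r addr0 mul1r.
Qed.

Lemma cintegrable_half k w : 0 < complex.Re w ->
  cintegrable mu (fun y => toC (\1_rayp y) * gauss_mono k w y).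
Proof.
move=> w0; have := cintegrable_normc (cintegrable_gauss_mono k w0).
move=> /(@le_cintegrable _ _ _ mu); apply.
  apply: cmeasurableM; last exact: cmeasurable_gauss_mono.
  by apply: cmeasurable_real; exact: measurable_indic.
move=> y; rewrite Normc.normcM normc_real ler_piMl ?normc_ge0//.
by rewrite indicE; case: (_ \in _); rewrite ?normr1 ?normr0.
Qed.

(** Integrating the derivative of y^k exp(-w y^2) over the half-line leaves a boundary term at 0,
    equal to 1 for k = 0 and to 0 otherwise. For k = 0 the truncated [k.-1] is harmless, since its
    coefficient is 0. *)
Lemma half_moment_rec k w : 0 < complex.Re w ->
  2 * w * half_moment k.+1 w = k%:R * half_moment k.-1 w + (k == 0%N)%:R.
Proof.
move=> w0.
have h : cintegral mu (fun y => toC (\1_rayp y) *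
    (k%:R * gauss_mono k.-1 w y + - (2 * w) * gauss_mono k.+1 w y)) =
    - gauss_mono k w 0.
  apply: (cintegral_derive_ray (F'' := fun x =>
    k%:R * (k.-1%:R * gauss_mono k.-1.-1 w x + - (2 * w) * gauss_mono k.-1.+1 w
      x) +
    - (2 * w) * (k.+1%:R * gauss_mono k w x + - (2 * w) * gauss_mono k.+2 w
      x))).
  - by move=> x; exact: cderive_gauss_mono.
  - by move=> x; apply: cderiveD; apply: cderiveZ; exact: cderive_gauss_mono.
  - by apply: cintegrableD; apply: cintegrableZl; exact: cintegrable_gauss_mono.
  - apply: (@gauss_cvg0 _ (gauss_mono k w) _ 0 1 k (fun n => n.+1%:R) w0) => //.
      by move=> n; rewrite ger0_norm.
    by move=> y; rewrite normc_gauss_mono mul0r addr0 mul1r.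
have i1 := cintegrable_half k.-1 w0; have i2 := cintegrable_half k.+1 w0.
have E : (fun y => toC (\1_rayp y) *
    (k%:R * gauss_mono k.-1 w y + - (2 * w) * gauss_mono k.+1 w y)) =
    (fun y => k%:R * (toC (\1_rayp y) * gauss_mono k.-1 w y) +
      - (2 * w) * (toC (\1_rayp y) * gauss_mono k.+1 w y)).
  by apply/funext => y; rewrite mulrDr (mulrCA (toC _) k%:R) (mulrCA (toC _) (-
    (2 * w))).
move: h; rewrite E.
rewrite (cintegralD (cintegrableZl _ i1) (cintegrableZl _ i2)).
rewrite (cintegralZl _ i1) (cintegralZl _ i2) -/(half_moment _ _) -/(half_moment
  _ _).
have -> : gauss_mono k w 0 = (k == 0%N)%:R.
  rewrite /gauss_mono expr0n [toC 0]rmorph0 expr0n mulr0 cexp0 mulr1.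
  by case: (k == 0%N); rewrite ?rmorph1 ?rmorph0.
by move=> /eqP; rewrite eq_sym -subr_eq0 => /eqP h; apply/eqP;
  rewrite -subr_eq0 -h; apply/eqP; ring.
Qed.

Lemma ae_neq0 (P : R -> Prop) : (forall y, y != 0 -> P y) ->
  \forall y \ae mu, P y.
Proof.
move=> h; exists [set 0].
split; [exact: measurable_set1|exact: lebesgue_measure_set1|].
move=> y /= nP; apply/eqP; apply: contra_notT nP; exact: h.
Qed.

Lemma gauss_momentE k w : 0 < complex.Re w ->
  gauss_moment k w = 2 * half_moment k w.
Proof.
move=> w0; have ih := cintegrable_half k w0.
have n1 : -1 != 0 :> R by rewrite oppr_eq0 oner_eq0.
have [ir rE] := cintegral_scale n1 ih.
rewrite normrN1 invr1 mul1r in rE.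
rewrite mulr_natl mulr2n.
transitivity (half_moment k w + cintegral mu (fun x =>
  toC (\1_rayp (-1 * x)) * gauss_mono k w (-1 * x))); last first.
  by congr (_ + _).
rewrite -(cintegralD ih ir).
apply: ae_eq_cintegral.
- apply: cmeasurableM.
    by apply: cmeasurable_real; apply: measurable_funX; exact: normr_measurable.
  by have := cmeasurable_gauss_mono 0 w; rewrite /gauss_mono;
    under eq_fun do rewrite expr0 mul1r.
- by apply: cmeasurableD; exact: (cintegrable_measurable (mu := mu)).
(* The point 0 lies in both half-lines, so for k = 0 the two sides differ there. *)
- apply: ae_neq0 => y y0; rewrite !indicE !mem_setE !in_itv/= !andbT.
  rewrite /gauss_mono mulN1r oppr_ge0 (_ : toC (- y) = - toC y) ?rmorphN//
    sqrrN.
  have t1 : toC true%:R = 1 by [].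
  have t0 : toC false%:R = 0 by [].
  have [y_gt0|y_le0] := ltP 0 y.
    rewrite (ltW y_gt0).
    by rewrite t1 t0 mul0r addr0 mul1r gtr0_norm.
  rewrite (_ : 0 <= y = false) ?y_le0; last by apply/negbTE;
    rewrite -ltNge lt_neqAle y0.
  by rewrite t1 t0 mul0r add0r mul1r ler0_norm.
Qed.

(** The constant must not depend on the argument of w, so the triangle inequality, which gives
    powers of Re w, cannot be used. The recursion raises the order by two and costs exactly one
    factor |w|; it starts from [normc_gauss_int] at k = 0 and from the explicit value 1 / w at k =
    1. *)
Lemma normc_gauss_moment k : exists2 C : R, 0 <= C &
  forall w, 0 < complex.Re w ->
    normc (gauss_moment k w) * Num.sqrt (normc w) ^+ k.+1 <= C.
Proof.
have nw w : 0 < complex.Re w -> 0 < normc w.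
  move=> /Re_gt0_neq0 wn0; rewrite lt_neqAle normc_ge0 andbT eq_sym.
  by apply: contra wn0 => /eqP/Normc.eq0_normc ->.
have base0 : exists2 C : R, 0 <= C & forall w, 0 < complex.Re w ->
    normc (gauss_moment 0 w) * Num.sqrt (normc w) ^+ 1 <= C.
  exists (normc (gauss_int (1 : R[i]))) => [|w w0]; first exact: normc_ge0.
  rewrite expr1 -(@ler_pXn2r _ 2)// ?nnegrE ?mulr_ge0 ?normc_ge0 ?sqrtr_ge0//.
  have -> : gauss_moment 0 w = gauss_int w.
    by apply: eq_cintegral => y; rewrite expr0 mul1r.
  rewrite exprMn (sqr_sqrtr (normc_ge0 w)) le_eqVlt; apply/orP; left; apply/eqP.
  exact: normc_gauss_int.
have step j : (exists2 C : R, 0 <= C & forall w, 0 < complex.Re w ->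
    normc (gauss_moment j w) * Num.sqrt (normc w) ^+ j.+1 <= C) ->
    exists2 C : R, 0 <= C & forall w, 0 < complex.Re w ->
    normc (gauss_moment j.+2 w) * Num.sqrt (normc w) ^+ j.+3 <= C.
  move=> [C C0 HC]; exists (j.+1%:R / 2 * C) => [|w w0];
    first by rewrite mulr_ge0// divr_ge0.
  have wn0 := Re_gt0_neq0 w0.
  have E : gauss_moment j.+2 w * w = toC (j.+1%:R / 2) * gauss_moment j w.
    rewrite !gauss_momentE//; have := half_moment_rec j.+1 w0.
    rewrite addr0/= => h; rewrite mulrAC h.
    rewrite (_ : toC (_ / 2) = j.+1%:R / 2); last by rewrite rmorphM fmorphV
      !rmorph_nat.
    by field.
  rewrite (_ : j.+3 = j.+1 + 2)%N; last by rewrite addn2.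
  rewrite exprD (sqr_sqrtr (normc_ge0 w)).
  rewrite mulrA mulrAC -Normc.normcM E Normc.normcM normc_real ger0_norm;
    last first.
    by rewrite divr_ge0.
  have c0 : 0 <= j.+1%:R / 2 :> R by rewrite divr_ge0.
  by apply: le_trans (ler_wpM2l c0 (HC w w0)); rewrite mulrA.
have base1 : exists2 C : R, 0 <= C & forall w, 0 < complex.Re w ->
    normc (gauss_moment 1 w) * Num.sqrt (normc w) ^+ 2 <= C.
  exists 1 => // w w0; rewrite (sqr_sqrtr (normc_ge0 w)) -Normc.normcM.
  rewrite gauss_momentE// mulrAC (half_moment_rec 0 w0) mul0r add0r.
  by rewrite Normc.normc1.
by elim/ltn_ind: k => -[|[|k]] IH //; apply: step; apply: IH; rewrite ltnS.
Qed.

End gaussian_moments.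

(** * The test function and its Fourier transform *)

Section conical_wave.
Context {R : realType}.
Local Notation mu := (@lebesgue_measure R).
Local Notation leb n := (@lebesgue_rV R n).
Local Notation toC x := ((x : R)%:C%C).

Lemma toCX (x : R) k : toC (x ^+ k) = toC x ^+ k.
Proof. exact: rmorphXn. Qed.

Lemma dotv_ge0 n (x : 'rV[R]_n) : 0 <= dotv x x.
Proof. by apply: sumr_ge0 => i _; rewrite -expr2 sqr_ge0. Qed.

Lemma enorm_ge0 n (x : 'rV[R]_n) : 0 <= enorm x.
Proof. exact: sqrtr_ge0. Qed.

Lemma enorm_sqr n (x : 'rV[R]_n) : enorm x ^+ 2 = dotv x x.
Proof. by rewrite sqr_sqrtr// dotv_ge0. Qed.

Lemma normc_gt0 (z : R[i]) : z != 0 -> 0 < normc z.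
Proof.
move=> z0; rewrite lt_neqAle normc_ge0 andbT eq_sym.
by apply: contra z0 => /eqP/Normc.eq0_normc ->.
Qed.

Lemma re_inv (z : R[i]) : complex.Re z^-1 = complex.Re z / normc z ^+ 2.
Proof. by rewrite normc_sqr; case: z. Qed.

Lemma re_inv_gt0 (z : R[i]) : 0 < complex.Re z -> 0 < complex.Re z^-1.
Proof. by move=> z0; rewrite re_inv divr_gt0// exprn_gt0// normc_gt0//
  Re_gt0_neq0. Qed.

(** Multiplied by z this is z^2 + |x|^2, whose real part for z = 1 + i t nearly cancels on the cone
    |x| = t. There the weight stays bounded, and it grows away from the cone. *)
Definition cone_weight n (z : R[i]) (x : 'rV[R]_n) : R[i] :=
  z + toC (dotv x x) * z^-1.

Lemma re_cone_weight n z (x : 'rV[R]_n) :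
  complex.Re (cone_weight z x) = complex.Re z + dotv x x * complex.Re z^-1.
Proof. by rewrite reD reZ. Qed.

Lemma re_cone_weight_gt0 n z (x : 'rV[R]_n) : 0 < complex.Re z ->
  0 < complex.Re (cone_weight z x).
Proof.
move=> z0; rewrite re_cone_weight ltr_wpDr// mulr_ge0 ?dotv_ge0//.
by rewrite ltW// re_inv_gt0.
Qed.

(** The order of the moment is the dimension: n Gaussian integrations in x will produce |y|^(-n),
    which the weight |y|^n cancels. *)
Definition conical n (z : R[i]) (x : 'rV[R]_n) : R[i] :=
  gauss_moment n (cone_weight z x).

Lemma expi_dotv n (x xi : 'rV[R]_n) :
  expi (dotv x xi) = \prod_i cexp (Complex 0 (xi ord0 i) * toC (x ord0 i)).
Proof.
rewrite -cexp_sum -cexp_expi; congr cexp; rewrite /dotv.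
transitivity (\sum_i (Complex 0 (x ord0 i * xi ord0 i))).
  elim/big_rec2 : _ => // i y1 y2 _ <-.
  by apply: complex_eqP => /=; rewrite ?addr0.
by apply: eq_bigr => i _; apply: complex_eqP => /=; ring.
Qed.

Lemma toC_dotv n (x : 'rV[R]_n) : toC (dotv x x) = \sum_i toC (x ord0 i) ^+ 2.
Proof.
rewrite /dotv rmorph_sum; apply: eq_bigr => i _.
by rewrite -rmorphXn expr2.
Qed.

Section kernel.
Variables (n : nat) (z : R[i]) (xi : 'rV[R]_n).
Hypotheses (n0 : (0 < n)%N) (z0 : 0 < complex.Re z).

(** The Gaussian in x and the character are split into coordinates, so that the integral over R^n
    becomes a product of one-dimensional ones. *)
Definition cone_kernel (p : 'rV[R]_n * R) : R[i] :=
  toC (`|p.2| ^+ n) * cexp (- z * toC p.2 ^+ 2) *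
  \prod_i cexp (- (toC p.2 ^+ 2 * z^-1) * toC (p.1 ord0 i) ^+ 2 +
                Complex 0 (xi ord0 i) * toC (p.1 ord0 i)).

Lemma cmeasurable_cone_kernel : cmeasurable cone_kernel.
Proof.
have m2 : cmeasurable (fun p : 'rV[R]_n * R =>
  toC p.2) by exact: cmeasurable_real.
have m1 i : cmeasurable (fun p : 'rV[R]_n * R => toC (p.1 ord0 i)).
  by apply: cmeasurable_real; exact: (measurableT_comp (measurable_coord i)
    measurable_fst).
have mc c : cmeasurable (fun _ : 'rV[R]_n * R =>
  c : R[i]) by exact: cmeasurable_cst.
apply: cmeasurableM; first apply: cmeasurableM.
- apply: cmeasurable_real; apply: measurable_funX.
  by apply: measurableT_comp => //; exact: measurable_snd.
- by apply: cmeasurable_cexp; apply: cmeasurableM => //; exact: cmeasurableX.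
- apply: cmeasurable_prod => i; apply: cmeasurable_cexp.
  apply: cmeasurableD; last exact: cmeasurableM.
  apply: cmeasurableM; last exact: cmeasurableX.
  by apply: cmeasurableN; apply: cmeasurableM => //; exact: cmeasurableX.
Qed.

Lemma cone_kernel_conical x :
  cintegral mu (fun y => cone_kernel (x, y)) = expi (dotv x xi) * conical z x.
Proof.
have w0 := re_cone_weight_gt0 x z0.
have ig : cintegrable mu (fun y => toC (`|y| ^+ n) * cexp (- cone_weight z x *
  toC y ^+ 2)).
  have mp : measurable_fun setT (fun y : R => `|y| ^+ n).
    by apply: measurable_funX; exact: normr_measurable.
  have pk (y : R) : `| `|y| ^+ n| <= `|y| ^+ n by rewrite normrX normr_id.
  have := cintegrable_gauss 0 0 w0 mp pk.
  by under eq_fun do rewrite mul0r !addr0.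
rewrite /conical /gauss_moment -(cintegralZl _ ig); apply: eq_cintegral => y.
rewrite /cone_kernel [(x, y).1]/= [(x, y).2]/= -mulrA [RHS]mulrCA;
  congr (_ * _).
rewrite (eq_bigr _ (fun i _ => cexpD _ _)) big_split/= -expi_dotv -cexp_sum.
rewrite mulrA -cexpD mulrC; congr (_ * cexp _).
by rewrite -mulr_sumr -toC_dotv /cone_weight; ring.
Qed.

(** Each coordinate is a Gaussian of parameter y^2 / z: rescaling gives [gauss_int z^-1] with a
    factor 1 / |y|, and the linear term contributes exp(-z xi_i^2 / (4 y^2)). The n factors 1 / |y|
    cancel the weight. *)
Lemma cone_kernel_fubini y : y != 0 ->
  cintegrable (leb n) (fun x => cone_kernel (x, y)) /\
  cintegral (leb n) (fun x => cone_kernel (x, y)) =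
  gauss_int z^-1 ^+ n * cexp (- z * toC (y ^+ 2 + (enorm xi / 2) ^+ 2 / y ^+
    2)).
Proof.
move=> y0; have zi0 := re_inv_gt0 z0.
set a := toC y ^+ 2 * z^-1.
have a0 : 0 < complex.Re a by rewrite /a -rmorphXn reZ mulr_gt0//
  exprn_even_gt0.
have ia i : cintegrable mu (fun s : R => cexp (- a * toC s ^+ 2 + Complex 0 (xi
  ord0 i) * toC s)).
  by have := cintegrable_gauss0 (Complex 0 (xi ord0 i)) 0 a0;
    under eq_fun do rewrite addr0.
have [iP PE] := cintegral_rV_prod ia.
pose c0 := toC (`|y| ^+ n) * cexp (- z * toC y ^+ 2).
split; first exact: (cintegrableZl c0 iP).
transitivity (c0 * cintegral (leb n) (fun v =>
    \prod_i cexp (- a * toC (v ord0 i) ^+ 2 + Complex 0 (xi ord0 i) * toC (v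
      ord0 i)))).
  exact: (cintegralZl c0 iP).
rewrite PE /c0.
under eq_bigr do rewrite (cintegral_gauss _ a0).
rewrite big_split/= prodr_const card_ord -cexp_sum.
rewrite (gauss_int_scale zi0 y0) exprMn.
have TS : toC (`|y| ^+ n) * toC (`|y|^-1) ^+ n = 1.
  by rewrite rmorphXn -exprMn -rmorphM divff ?normr_eq0// rmorph1 expr1n.
set J := gauss_int z^-1; set E := cexp (- z * _); set X := cexp _.
transitivity ((toC (`|y| ^+ n) * toC (`|y|^-1) ^+ n) * (J ^+ n * (E * X)));
  first by ring.
rewrite TS mul1r /E /X -cexpD; congr (_ * cexp _).
have zn0 := Re_gt0_neq0 z0.
have yn0 : toC y != 0 by rewrite fmorph_eq0.
rewrite -mulr_suml.
have -> : \sum_i Complex 0 (xi ord0 i) ^+ 2 = - toC (enorm xi) ^+ 2.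
  rewrite -toCX enorm_sqr toC_dotv -sumrN; apply: eq_bigr => i _.
  by apply: complex_eqP => /=; ring.
have -> : toC (y ^+ 2 + (enorm xi / 2) ^+ 2 / y ^+ 2) =
    toC y ^+ 2 + toC (enorm xi) ^+ 2 / (4 * toC y ^+ 2).
  rewrite (_ : _ + _ = y ^+ 2 + enorm xi ^+ 2 / (4 * y ^+ 2)); last by field;
    exact: y0.
  have t4 : toC 4 = 4 by exact: rmorph_nat.
  by rewrite -t4 -!toCX -rmorphM -fmorph_div -rmorphD.
by rewrite /a; field; rewrite zn0 yn0.
Qed.

(** The modulus is a real Gaussian in x of parameter y^2 Re (1/z). Integrating it first in x gives
    [C ^+ n], the weight cancelling again, times the integrable exp(-Re z y^2). At y = 0 the
    Gaussian degenerates, but the weight vanishes because n > 0. *)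
Lemma cintegrable_cone_kernel : cintegrable (leb n \x mu)%E cone_kernel.
Proof.
have mK := cmeasurable_cone_kernel.
have rho0 := re_inv_gt0 z0.
pose C := (Num.sqrt (complex.Re z^-1))^-1 * Num.sqrt pi.
have bound y : (\int[leb n]_x (normc (cone_kernel (x, y)))%:E <=
    ((C ^+ n) * expR (- (complex.Re z * y ^+ 2)))%:E)%E.
  have C0 : 0 <= C by rewrite mulr_ge0 ?invr_ge0 ?sqrtr_ge0.
  have [->|y0] := eqVneq y 0.
    under eq_integral => x _.
      rewrite /cone_kernel [(x, 0).2]/= normr0 expr0n (gtn_eqF n0) [toC
        _]rmorph0 !mul0r Normc.normc0.
      over.
    by rewrite integral0 lee_fin mulr_ge0 ?exprn_ge0// expR_ge0.
  pose r := y ^+ 2 * complex.Re z^-1.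
  have r0 : 0 < complex.Re (toC r) by rewrite /= mulr_gt0// exprn_even_gt0.
  have [iP PE] := cintegral_rV_prod (fun _ : 'I_n => gauss_int_integrable r0).
  have nP (x : 'rV[R]_n) : normc (\prod_i cexp (- toC r * toC (x ord0 i) ^+ 2))
    =
      complex.Re (\prod_i cexp (- toC r * toC (x ord0 i) ^+ 2)).
    rewrite -cexp_sum -mulr_sumr -toC_dotv mulNr -rmorphM -rmorphN.
    by rewrite normc_cexp cexpE expi0 mulr1.
  have E x : normc (cone_kernel (x, y)) = (`|y| ^+ n * expR (- (complex.Re z * y
    ^+ 2))) *
      complex.Re (\prod_i cexp (- toC r * toC (x ord0 i) ^+ 2)).
    rewrite -nP /cone_kernel [(x, y).1]/= [(x, y).2]/=.
    rewrite Normc.normcM [normc (toC _ * _)]Normc.normcM normc_real normc_cexp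
      re_gauss.
    rewrite normrX normr_id; congr (_ * _).
    rewrite -!cexp_sum !normc_cexp !re_sum; congr expR; apply: eq_bigr => i _.
    rewrite reD !re_gauss -rmorphXn reZ /r/=; ring.
  under eq_integral => x _ do rewrite E EFinM.
  rewrite ge0_integralZl_EFin//; last 2 first.
  - by move=> x _; rewrite lee_fin -nP normc_ge0.
  - by apply: measurable_int; exact: iP.1.
  rewrite -(fineK (integrable_fin_num measurableT iP.1)) -EFinM lee_fin.
  rewrite -[fine _]/(complex.Re (cintegral (leb n) (fun x =>
    \prod_i cexp (- toC r * toC (x ord0 i) ^+ 2)))).
  rewrite PE prodr_const card_ord -/(gauss_int (toC r)) (gauss_int_real r0)
    gauss_int1.
  rewrite -rmorphM -rmorphXn /=.
  have E1 : `|y| * ((Num.sqrt r)^-1 * Num.sqrt pi) = C.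
    rewrite /r sqrtrM ?sqr_ge0// sqrtr_sqr /C; field.
    by rewrite normr_eq0 y0 andbT gt_eqF// sqrtr_gt0.
  by rewrite mulrAC -exprMn E1.
apply: cintegrable21P => //.
apply: (@le_lt_trans _ _ (\int[mu]_y ((C ^+ n) * expR (- (complex.Re z * y ^+
  2)))%:E)%E).
  apply: ge0_le_integral => //.
  - by move=> y _; apply: integral_ge0 => x _; rewrite lee_fin normc_ge0.
  - apply: (measurable_fun_fubini_tonelli_G (m1 :=
    leb n) (EFin \o (normc \o cone_kernel))).
      exact/measurable_EFinP/measurable_normc.
    by move=> p; rewrite lee_fin normc_ge0.
  - apply/measurable_EFinP; apply: measurable_funM => //;
    apply: measurableT_comp => //.
    by apply: measurableT_comp => //; apply: measurable_funM => //;
      exact: measurable_funX.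
have := integrableZl measurableT (C ^+ n) (integrable_gauss_scale z0).
under eq_fun do rewrite -EFinM.
move=> ig; rewrite -(fineK (integrable_fin_num measurableT ig)).
exact: ltry.
Qed.

End kernel.

Lemma cintegrable_conical_expi n z (xi : 'rV[R]_n) : (0 < n)%N ->
  0 < complex.Re z ->
  cintegrable (leb n) (fun x => expi (dotv x xi) * conical z x).
Proof.
move=> n0 z0; have := cintegrable_cintegral12 (cintegrable_cone_kernel xi n0
  z0).
by under eq_fun do rewrite (cone_kernel_conical _ z0).
Qed.

Lemma cintegrable_conical n z : (0 < n)%N -> 0 < complex.Re z ->
  cintegrable (leb n) (conical z).
Proof.
move=> n0 z0; have := cintegrable_conical_expi 0 n0 z0.
under eq_fun => x.
  rewrite (_ : dotv x 0 = 0) ?expi0 ?mul1r; last first.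
    by rewrite /dotv big1// => i _; rewrite mxE mulr0.
  over.
by [].
Qed.

(* [Cauchy-Schloemilch] y^2 + b^2 / y^2 = (y - b / y)^2 + 2 b, and y - b / y
   preserves Lebesgue measure. *)
Lemma fourier_conical n z (xi : 'rV[R]_n) : (0 < n)%N -> 0 < complex.Re z ->
  0 < enorm xi ->
  cintegral (leb n) (fun x => expi (dotv x xi) * conical z x) =
  gauss_int z^-1 ^+ n * gauss_int z * cexp (- z * toC (enorm xi)).
Proof.
move=> n0 z0 xi0; set b := enorm xi / 2; have b0 : 0 < b by rewrite divr_gt0.
have exch := cintegral_exchange (cintegrable_cone_kernel xi n0 z0).
transitivity (cintegral (leb n) (fun x => cintegral mu (fun y =>
  cone_kernel z xi (x, y)))).
  by apply: eq_cintegral => x; rewrite (cone_kernel_conical _ z0).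
rewrite exch.
have [ib bE] := cintegral_boole b0 (gauss_int_integrable z0).
pose c := gauss_int z^-1 ^+ n * cexp (- z * toC (enorm xi)).
transitivity (cintegral mu (fun y => c * cexp (- z * toC (y - b / y) ^+ 2))).
  apply: ae_eq_cintegral.
  - pose K' (p : R * 'rV[R]_n) := cone_kernel z xi (p.2, p.1).
    have mK' : cmeasurable K'.
      apply: (cmeasurable_comp (phi := fun p : R * 'rV[R]_n => (p.2,
        p.1)) _ (cmeasurable_cone_kernel z xi)).
      exact: measurable_swap.
    exact: (cmeasurable_cintegral (leb n) mK').
  - exact: (cintegrable_measurable (cintegrableZl c ib)).
  - apply: ae_neq0 => y y0; have [_ ->] := cone_kernel_fubini xi z0 y0.
    rewrite /c -mulrA; congr (_ * _); rewrite -cexpD; congr cexp.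
    rewrite -/b -mulrDr -rmorphXn -rmorphD; congr (_ * toC _).
    rewrite /b; field; exact: y0.
rewrite (cintegralZl _ ib) bE /c -/(gauss_int z).
by rewrite mulrAC.
Qed.

End conical_wave.

(** * Concentration of the test function near the light cone *)

Section ball_volume.
Context {R : realType}.
Local Notation mu := (@lebesgue_measure R).
Local Notation leb n := (@lebesgue_rV R n).
Local Notation toC x := ((x : R)%:C%C).

Lemma measurable_dotv n (xi : 'rV[R]_n) : measurable_fun setT (fun x : 'rV[R]_n
  => dotv x xi).
Proof.
by apply: measurable_sum => i; apply: measurable_funM => //;
  exact: measurable_coord.
Qed.

Lemma measurable_dotv2 n : measurable_fun setT (fun x : 'rV[R]_n => dotv x x).
Proof.
by apply: measurable_sum => i; apply: measurable_funM; exact: measurable_coord.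
Qed.

Definition rball n (rho : R) : set 'rV[R]_n := [set x | dotv x x <= rho ^+ 2].

Arguments rball : clear implicits.

Lemma measurable_rball n rho : measurable (rball n rho).
Proof.
rewrite (_ : rball n rho = [set: 'rV[R]_n] `&` (fun x => dotv x x) @^-1` `]-oo,
  (rho ^+ 2)]).
  by apply: measurable_dotv2 => //; exact: measurable_itv.
by rewrite setTI; apply/seteqP; split => x /=; rewrite /rball/= in_itv.
Qed.

Lemma rball1_lty n : (leb n (rball n 1) < +oo)%E.
Proof.
have mD : measurable (`[-1, 1]%classic : set R) by exact: measurable_itv.
set D := `[-1, 1]%classic in mD *; have Doo : (mu D < +oo)%E.
  by rewrite /D lebesgue_measure_itv/=; case: ifPn => _;
    rewrite ?ltry// -EFinB ltry.
have [iP _] := cintegral_rV_prod (fun _ : 'I_n => cintegrable_indic (mu :=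
  mu) mD Doo).
have := cintegrable_lty iP; apply: le_lt_trans.
rewrite -(setIT (rball n 1)) -(integral_indic _ measurableT);
  last exact: measurable_rball.
apply: ge0_le_integral => //.
- by apply/measurable_EFinP; apply: measurable_indic; exact: measurable_rball.
- apply/measurable_EFinP/measurable_normc/(cintegrable_measurable iP).
move=> x _; rewrite lee_fin indicE; case: (boolP (x \in _));
  last by rewrite normc_ge0.
rewrite inE /rball/= expr1n => x1.
rewrite big1 ?Normc.normc1// => i _; rewrite indicE mem_set// /D/= in_itv/=.
rewrite -ler_norml -(ler_pXn2r (n := 2)) ?nnegrE// expr1n real_normK
  ?num_real//; apply: le_trans x1.
rewrite /dotv (bigD1 i)//= -expr2 lerDl; apply: sumr_ge0 => j _.
by rewrite -expr2 sqr_ge0.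
Qed.

Lemma lebesgue_rball n (rho : R) : 0 < rho ->
  leb n (rball n rho) = (rho ^+ n * fine (leb n (rball n 1)))%:E.
Proof.
move=> r0; rewrite EFinM fineK ?ge0_fin_numE ?rball1_lty ?measure_ge0//.
have ri0 : 0 < rho^-1 by rewrite invr_gt0.
have m1 : measurable_fun setT (EFin \o \1_(rball n 1) : 'rV[R]_n -> \bar R).
  by apply/measurable_EFinP; apply: measurable_indic; exact: measurable_rball.
have p1 (x : 'rV[R]_n) : (0%:E <= (EFin \o \1_(rball n 1)) x :> \bar R)%E by
  rewrite lee_fin indicE.
have := ge0_integral_rV_scale ri0 m1 p1.
rewrite invrK [X in (_ * X)%E]integral_indic ?setIT//;
  last exact: measurable_rball.
move=> <-; rewrite -[in LHS](setIT (rball n rho)) -(integral_indic _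
  measurableT); last exact: measurable_rball.
apply: eq_integral => x _; rewrite /= !indicE; congr (_%:R)%:E;
  congr nat_of_bool.
have E : dotv (rho^-1 *: x) (rho^-1 *: x) = dotv x x / rho ^+ 2.
  rewrite /dotv mulr_suml; apply: eq_bigr => i _; rewrite !mxE; field.
  by rewrite gt_eqF.
by apply/idP/idP; rewrite !inE /rball/= E ler_pdivrMr ?exprn_gt0// expr1n mul1r.
Qed.

(** Measured in |x|^2 to avoid roots: since ||x|^2 - t^2| >= t ||x| - t| for t > 0, its points
    satisfy ||x| - t| < L. *)
Definition annulus n (t L : R) : set 'rV[R]_n :=
  [set x | `|dotv x x - t ^+ 2| < L * t].
Arguments annulus : clear implicits.

Lemma measurable_annulus n t L : measurable (annulus n t L).
Proof.
rewrite (_ : annulus n t L = [set: 'rV[R]_n] `&` (fun x =>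
  dotv x x) @^-1` `](t ^+ 2 - L * t), (t ^+ 2 + L * t)[).
  by apply: measurable_dotv2 => //; exact: measurable_itv.
by rewrite setTI; apply/seteqP; split => x /=;
  rewrite /annulus/= in_itv/= ltr_distl.
Qed.

(** For radii a <= b, b^n - a^n is at most n (b^2 - a^2) b^(n-2), where b^2 - a^2 <= 2 L t and b <=
    sqrt(2 L) t. The bound covers all L >= 1, even beyond t, and its growth L^(n/2) is just slow
    enough for the dyadic sum. *)
Lemma lebesgue_annulus n (t L : R) : (2 <= n)%N -> 1 <= t -> 1 <= L ->
  (leb n (annulus n t L) <=
   (fine (leb n (rball n 1)) * n%:R * Num.sqrt (2 * L) ^+ n * t ^+ n.-1)%:E)%E.
Proof.
move=> n2 t1 L1; have t0 : 0 < t := lt_le_trans ltr01 t1.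
have L0 : 0 < L := lt_le_trans ltr01 L1.
have mA := @measurable_annulus n t L; set A := annulus n t L in mA *; set V :=
  fine _; have V0 : 0 <= V by rewrite fine_ge0// measure_ge0.
pose b := Num.sqrt (t ^+ 2 + L * t).
have b0 : 0 < b by rewrite sqrtr_gt0 addr_gt0// ?exprn_gt0// mulr_gt0.
have bE : b ^+ 2 = t ^+ 2 + L * t by rewrite sqr_sqrtr// ltW// -sqrtr_gt0.
have Ab x : A x -> rball n b x.
  by rewrite /A /annulus /rball/= bE ltr_distl => /andP[_ /ltW].
have bt : b <= Num.sqrt (2 * L) * t.
  rewrite -[X in _ * X](ger0_norm (ltW t0)) -sqrtr_sqr -sqrtrM ?mulr_ge0 ?(ltW
    L0)//.
  apply: ler_wsqrtr; have tt : t <= t ^+ 2 by rewrite expr2 ler_peMl// ltW.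
  have h1 : t ^+ 2 <= L * t ^+ 2 by rewrite ler_peMl// exprn_ge0// ltW.
  have h2 : L * t <= L * t ^+ 2 by rewrite ler_wpM2l// ltW.
  by lra.
have key a : 0 <= a -> b ^+ 2 - a ^+ 2 <= 2 * L * t ->
    (b ^+ n - a ^+ n) * V <= V * n%:R * Num.sqrt (2 * L) ^+ n * t ^+ n.-1.
  move=> a0 ab; rewrite mulrC -!mulrA ler_wpM2l//.
  have s0 := sqrtr_ge0 (2 * L); set s := Num.sqrt _ in bt s0 *.
  have sE : 2 * L = s ^+ 2 by rewrite sqr_sqrtr// mulr_ge0// ltW.
  have [ba|ab'] := ltP b a.
    apply: (@le_trans _ _ 0); first by rewrite subr_le0 lerXn2r ?nnegrE ?(ltW
      b0) ?(ltW ba).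
    by rewrite !mulr_ge0// exprn_ge0// ltW.
  case: n n2 => [//|[//|m]] _ in A mA Ab V V0 *.
  have bn : b ^+ m.+2 - a ^+ m.+2 <= m.+2%:R * ((b - a) * b ^+ m.+1).
    rewrite subrXX mulrCA; apply: ler_wpM2l; first by rewrite subr_ge0.
    rewrite mulr_natl -[X in _ *+ X]card_ord -sumr_const; apply: ler_sum =>
      i _ /=.
    have im : (i <= m.+1)%N by rewrite -ltnS.
    rewrite -[X in _ <= _ ^+ X](subnK im) exprD ler_wpM2l ?exprn_ge0// ?(ltW
      b0)//.
    by rewrite lerXn2r// nnegrE ltW.
  apply: (le_trans bn); rewrite ler_wpM2l//.
  apply: (@le_trans _ _ ((b ^+ 2 - a ^+ 2) * b ^+ m)).
    rewrite subr_sqr exprS mulrA ler_wpM2r ?exprn_ge0 ?(ltW b0)// ler_wpM2l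
      ?subr_ge0//.
    by rewrite lerDl.
  apply: (@le_trans _ _ ((2 * L * t) * (s * t) ^+ m)).
    apply: ler_pM => //.
    - by rewrite subr_ge0 lerXn2r ?nnegrE ?(ltW b0).
    - by rewrite exprn_ge0// ltW.
    - by rewrite lerXn2r ?nnegrE ?(ltW b0) ?mulr_ge0 ?(ltW t0).
  by rewrite sE exprMn le_eqVlt; apply/orP; left; apply/eqP; rewrite !exprS/=;
    ring.
(* When L >= t there is no inner ball to remove, and [key] is used with inner radius 0. *)
have [c0|c0] := leP (t ^+ 2 - L * t) 0.
  apply: (@le_trans _ _ (leb n (rball n b))).
    by apply: le_measure => //; rewrite inE//; exact: measurable_rball.
  rewrite lebesgue_rball// lee_fin -/V.
  have := key 0 (lexx _); rewrite !expr0n (gtn_eqF (ltnW n2)) !subr0; apply.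
  by rewrite bE; lra.
pose a := Num.sqrt (t ^+ 2 - L * t); have a0 : 0 < a by rewrite sqrtr_gt0.
have aE : a ^+ 2 = t ^+ 2 - L * t by rewrite sqr_sqrtr// ltW.
apply: (@le_trans _ _ (leb n (rball n b `\` rball n a))).
  apply: le_measure; rewrite ?inE//; first by apply: measurableD;
    exact: measurable_rball.
  move=> x Ax; split; first exact: Ab.
  by move: Ax; rewrite /A /annulus /rball/= aE ltr_distl => /andP[h _];
    apply/negP; rewrite -ltNge.
have boo : (leb n (rball n b) < +oo)%E by rewrite lebesgue_rball// ltry.
rewrite measureD; first last.
  - exact: boo.
  - exact: measurable_rball.
  - exact: measurable_rball.
have ab : a <= b.
  by rewrite /a /b ler_wsqrtr// lerD2l (le_trans (y :=
    0))// ?oppr_le0 ?mulr_ge0 ?ltW.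
rewrite (_ : _ `&` _ = rball n a); last first.
  apply/setIidr => x; rewrite /rball/= => /le_trans; apply.
  by rewrite ler_pXn2r ?nnegrE// ltW.
rewrite -[leLHS]/(leb n (rball n b) - leb n (rball n a))%E.
rewrite (lebesgue_rball n b0) (lebesgue_rball n a0) -EFinB lee_fin -/V -mulrBl;
  apply: key; first exact: ltW.
by rewrite aE bE; lra.
Qed.

(* [|z w| = |z ^ 2 + |x| ^ 2|] has real part [1 - t ^ 2 + |x| ^ 2], so off the
   annulus of relative width [L] around the cone the weight is at least [L / 4]. *)
Lemma le_normc_cone_weight n (t : R) (x : 'rV[R]_n) (L : R) : 1 <= t ->
  ~ annulus n t L x -> L <= 4 * normc (cone_weight (Complex 1 t) x).
Proof.
move=> t1; rewrite /annulus/= => /negP; rewrite -leNgt => h.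
have t0 : 0 < t := lt_le_trans ltr01 t1.
set z := Complex 1 t; set w := cone_weight z x.
have z1 : 0 < complex.Re z by exact: ltr01.
have w1 : 1 <= normc w.
  apply: le_trans (normc_Re w); apply: le_trans (ler_norm _).
  by rewrite re_cone_weight lerDl mulr_ge0 ?dotv_ge0// ltW// re_inv_gt0.
have zw : z * w = z ^+ 2 + toC (dotv x x).
  rewrite /w /cone_weight mulrDr -expr2; congr (_ + _).
  by rewrite mulrCA divff ?mulr1// Re_gt0_neq0.
have nz : normc z <= 2 * t.
  apply: le_trans (normc_le_ReIm z) _; rewrite /= ger0_norm// ger0_norm ?(ltW
    t0)//.
  by lra.
have := normc_Re (z * w); rewrite {1}zw Normc.normcM.
rewrite (_ : complex.Re _ = dotv x x - t ^+ 2 + 1); last by rewrite /z expr2/=;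
  ring.
move=> h1.
have h2 : `|dotv x x - t ^+ 2| <= `|dotv x x - t ^+ 2 + 1| + 1.
  have := ler_normB (dotv x x - t ^+ 2 + 1) 1.
  by rewrite normr1 -addrA subrr addr0.
have h3 : normc z * normc w <= 2 * t * normc w by rewrite ler_wpM2r ?normc_ge0.
have h4 : 1 <= t * normc w by rewrite -[X in X <= _](mulr1 1) ler_pM.
have h5 : L * t <= 4 * normc w * t by lra.
by rewrite -(ler_pM2r t0).
Qed.

(** This is |w|^(-(n+1)/2) for the weight w, the profile that [normc_gauss_moment] gives to
    [conical]. *)
Definition cone_decay n (t : R) (x : 'rV[R]_n) : R :=
  (Num.sqrt (normc (cone_weight (Complex 1 t) x)))^-1 ^+ n.+1.

Lemma normc_cone_weight_ge1 n (t : R) (x : 'rV[R]_n) :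
  1 <= normc (cone_weight (Complex 1 t) x).
Proof.
apply: le_trans (normc_Re _); apply: le_trans (ler_norm _).
by rewrite re_cone_weight lerDl mulr_ge0 ?dotv_ge0// ltW// re_inv_gt0//= ltr01.
Qed.

Lemma cone_decay_ge0 n t (x : 'rV[R]_n) : 0 <= cone_decay t x.
Proof. by rewrite exprn_ge0// invr_ge0 sqrtr_ge0. Qed.

Lemma cone_decay_le1 n t (x : 'rV[R]_n) : cone_decay t x <= 1.
Proof.
have s1 : 1 <= Num.sqrt (normc (cone_weight (Complex 1 t) x)).
  by rewrite -[X in X <= _]sqrtr1; apply: ler_wsqrtr;
    exact: normc_cone_weight_ge1.
by rewrite exprn_ile1// ?invr_ge0 ?sqrtr_ge0// invf_le1// (lt_le_trans ltr01).
Qed.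

Lemma measurable_cone_decay n t :
  measurable_fun setT (cone_decay t : 'rV[R]_n -> R).
Proof.
apply: measurable_funX.
apply: measurableT_comp; first exact: measurable_inv.
apply: measurableT_comp.
  by apply: continuous_measurable_fun; exact: sqrt_continuous.
apply: measurable_normc.
apply: cmeasurableD; first exact: cmeasurable_cst.
apply: cmeasurableM; last exact: cmeasurable_cst.
by apply: cmeasurable_real; exact: measurable_dotv2.
Qed.

(** Take the least k whose annulus contains x. If k > 0, x lies outside the annulus of parameter
    2^(k-1), so the weight is at least 2^k / 8, and 3 bounds sqrt 8. If k = 0 the profile is at most
    1. *)
Lemma cone_decay_annuli n t (x : 'rV[R]_n) : 1 <= t ->
  exists k : nat, annulus n t (2 ^+ k) x /\
    cone_decay t x <= 3 ^+ n.+1 * ((Num.sqrt 2)^-1 ^+ n.+1) ^+ k.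
Proof.
move=> t1; have t0 : 0 < t := lt_le_trans ltr01 t1.
have ex : exists k, `[< annulus n t (2 ^+ k) x >].
  have [k hk] : exists k : nat, `|dotv x x - t ^+ 2| < 2 ^+ k.
    have h := archi_boundP (normr_ge0 (dotv x x - t ^+ 2)).
    exists (Num.bound `|dotv x x - t ^+ 2|); apply: lt_trans h _.
    by rewrite -natrX ltr_nat ltn_expl.
  exists k; apply/asboolP; rewrite /annulus/=; apply: lt_le_trans hk _.
  by rewrite ler_peMr ?exprn_ge0.
have s0 : 0 < Num.sqrt 2 :> R by rewrite sqrtr_gt0.
case: (ex_minnP ex) => -[|k] /asboolP Ak kmin; [exists 0%N|exists k.+1];
  split => //.
  rewrite expr0 mulr1; apply: le_trans (cone_decay_le1 _ _) _.
  by rewrite exprn_ege1// ler1n.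
have nA : ~ annulus n t (2 ^+ k) x.
  by move=> /asboolP/kmin; rewrite ltnn.
have := le_normc_cone_weight t1 nA => h.
rewrite exprAC -exprMn /cone_decay lerXn2r ?nnegrE ?invr_ge0 ?sqrtr_ge0//.
set w := normc _ in h *.
have w0 : 0 < w by exact: lt_le_trans ltr01 (normc_cone_weight_ge1 _ _).
rewrite -ler_pdivrMl// exprVn -lef_pV2 ?posrE; last 2 first.
- by rewrite invr_gt0 exprn_gt0.
- by rewrite divr_gt0// sqrtr_gt0.
rewrite invfM !invrK -(ler_pXn2r (n := 2)) ?nnegrE ?mulr_ge0 ?exprn_ge0
  ?sqrtr_ge0//.
rewrite exprAC [(3 * _) ^+ 2]exprMn !sqr_sqrtr ?(ltW w0)// exprS.
by apply: (@le_trans _ _ (2 * (4 * w))); [rewrite ler_wpM2l | lra].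
Qed.

(** Up to constants, layer k contributes 2^(-k(n+1)/2) 2^(kn/2) t^(n-1): a geometric series of ratio
    1 / sqrt 2. *)
Lemma integral_cone_decay n : (2 <= n)%N -> exists2 C : R, 0 <= C &
  forall t, 1 <= t ->
  (\int[leb n]_x (cone_decay t x)%:E <= (C * t ^+ n.-1)%:E)%E.
Proof.
move=> n2; set V := fine (leb n (rball n 1)).
have V0 : 0 <= V by rewrite fine_ge0// measure_ge0.
set s : R := Num.sqrt 2; have s0 : 0 < s by rewrite sqrtr_gt0.
have s1 : s^-1 < 1.
  by rewrite invf_lt1// -[X in X < _]sqrtr1 ltr_sqrt// ltr1n.
have si0 : 0 <= s^-1 by rewrite invr_ge0 ltW.
pose K := 3 ^+ n.+1 * (V * n%:R * s ^+ n).
have K0 : 0 <= K by rewrite !mulr_ge0// exprn_ge0// ltW.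
exists (K * (1 - s^-1)^-1); first by rewrite mulr_ge0// invr_ge0 subr_ge0 ltW.
move=> t t1; have t0 : 0 < t := lt_le_trans ltr01 t1.
pose c k : R := 3 ^+ n.+1 * (s^-1 ^+ n.+1) ^+ k.
have c0 k : 0 <= c k by rewrite mulr_ge0// !exprn_ge0.
pose F k (x : 'rV[R]_n) : \bar R := (c k * \1_(annulus n t (2 ^+ k)) x)%:E.
have F0 k x : (0 <= F k x)%E by rewrite lee_fin mulr_ge0// indicE.
have mI k : measurable_fun setT (\1_(annulus n t (2 ^+ k)) : 'rV[R]_n -> R).
  by apply: measurable_indic; exact: measurable_annulus.
have mF k : measurable_fun setT (F k).
  by apply/measurable_EFinP; apply: measurable_funM.
apply: (@le_trans _ _ (\int[leb n]_x \sum_(0 <= k <oo) F k x)%E).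
  apply: ge0_le_integral => //.
  - by move=> x _; rewrite lee_fin cone_decay_ge0.
  - by apply/measurable_EFinP; exact: measurable_cone_decay.
  - by apply: ge0_emeasurable_sum.
  move=> x _; have [k [Ak hk]] := cone_decay_annuli x t1.
  apply: (@le_trans _ _ (F k x)).
    by rewrite /F indicE mem_set// mulr1 lee_fin.
  apply: (@le_trans _ _ (\sum_(0 <= i < k.+1) F i x)%E).
    by rewrite big_nat_recr//= leeDr// sume_ge0.
  by apply: nneseries_lim_ge.
rewrite integral_nneseries//.
apply: (lime_le (is_cvg_nneseries _)) => [k _ _|].
  by apply: integral_ge0 => x _; exact: F0.
apply: nearW => N.
apply: (@le_trans _ _ (\sum_(0 <= k < N) (K * t ^+ n.-1 * s^-1 ^+ k)%:E)%E).
  apply: lee_sum => k _.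
  under eq_integral do rewrite /F EFinM.
  rewrite ge0_integralZl_EFin//; last by exact/measurable_EFinP.
  rewrite integral_indic//; last exact: measurable_annulus.
  rewrite setIT.
  have L1 : 1 <= 2 ^+ k :> R by rewrite exprn_ege1// ler1n.
  apply: le_trans (lee_wpmul2l _ (lebesgue_annulus n2 t1 L1)) _;
    first by rewrite lee_fin.
  rewrite -EFinM lee_fin le_eqVlt; apply/orP; left; apply/eqP.
  rewrite /c -/V sqrtrM// -/s.
  have -> : Num.sqrt (2 ^+ k) = s ^+ k :> R.
    rewrite -[RHS]ger0_norm ?exprn_ge0 ?(ltW s0)// -sqrtr_sqr exprAC.
    by rewrite /s sqr_sqrtr.
  rewrite exprMn /K.
  have -> : (s^-1 ^+ n.+1) ^+ k = s^-1 ^+ k * ((s ^+ k) ^+ n)^-1.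
    rewrite exprAC exprS; congr (_ * _); rewrite -[X in _ = X^-1]exprAC.
    by rewrite -!exprVn [RHS]exprAC.
  by field; rewrite expf_neq0// expf_neq0// gt_eqF.
rewrite sumEFin lee_fin -mulr_sumr [leRHS]mulrAC ler_wpM2l ?mulr_ge0 ?exprn_ge0
  ?(ltW t0) ?(ltW s0)//.
have s11 : 1 - s^-1 > 0 by rewrite subr_gt0.
have -> : \sum_(0 <= k < N) s^-1 ^+ k = (1 - s^-1 ^+ N) * (1 - s^-1)^-1.
  apply: (mulIf (lt0r_neq0 s11)); rewrite mulfVK ?lt0r_neq0// mulrC.
  by rewrite big_mkord -[RHS]opprB subrX1 -mulNr opprB.
rewrite ler_piMl ?invr_ge0 ?(ltW s11)// lerBlDr lerDl exprn_ge0//.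
Qed.

End ball_volume.

(** * Fejer data *)

Section fejer.
Context {R : realType}.
Local Notation mu := (@lebesgue_measure R).
Local Notation leb n := (@lebesgue_rV R n).
Local Notation toC x := ((x : R)%:C%C).

Lemma cos_ge (x : R) : 1 - x ^+ 2 / 2 <= cos x.
Proof.
have sinle (y : R) : 0 <= y -> sin y ^+ 2 <= y ^+ 2.
  move=> y0; have [c _] := @MVT_segment R sin cos 0 y y0 (fun x _ =>
    is_derive_sin x)
    (continuous_subspaceT (@continuous_sin R)).
  rewrite sin0 !subr0 => ->; rewrite exprMn ler_piMl ?sqr_ge0//.
have sinsq (y : R) : sin y ^+ 2 <= y ^+ 2.
  have [y0|y0] := leP 0 y; first exact: sinle.
  by rewrite -sqrrN -sinN -[leRHS]sqrrN; apply: sinle; rewrite oppr_ge0 ltW.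
have -> : cos x = 1 - 2 * sin (x / 2) ^+ 2.
  by rewrite [in LHS](splitr x) cosD -!expr2 cos2sin2; ring.
have := sinsq (x / 2); rewrite expr_div_n => h.
by rewrite lerD2l lerN2; lra.
Qed.

(** Division by 0 gives the value 0 at the origin instead of the limit 1/2, which respects the
    bounds and concerns a null set. *)
Definition fejer (x : R) : R := (1 - cos x) / x ^+ 2.

Lemma fejer_ge0 x : 0 <= fejer x.
Proof. by rewrite divr_ge0 ?sqr_ge0// subr_ge0 cos_le1. Qed.

Lemma fejer_le x : fejer x <= 2^-1.
Proof.
have [->|x0] := eqVneq x 0; first by rewrite /fejer cos0 subrr mul0r invr_ge0.
rewrite ler_pdivrMr ?exprn_even_gt0// lerBlDr -lerBlDl mulrC.
exact: cos_ge.
Qed.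

Lemma fejer_le_oneDsqr x : fejer x <= 4 * (oneDsqr x)^-1.
Proof.
rewrite ler_pdivlMr ?oneDsqr_gt0// /oneDsqr mulrDr mulr1.
have h1 := fejer_le x.
have h2 : fejer x * x ^+ 2 <= 2.
  have [->|x0] := eqVneq x 0; first by rewrite expr0n mulr0.
  by rewrite mulfVK ?expf_eq0// lerBlDr -lerBlDl; have := cos_geN1 x; lra.
lra.
Qed.

Lemma measurable_fejer : measurable_fun setT fejer.
Proof.
apply: measurable_funM; first by apply: measurable_funB => //;
  apply: continuous_measurable_fun; exact: continuous_cos.
by apply: measurableT_comp; [exact: measurable_inv|exact: measurable_funX].
Qed.

Lemma integrable_fejer : mu.-integrable setT (fun x => (fejer x)%:E).
Proof.
have i1 : mu.-integrable setT (fun x => ((oneDsqr x)^-1)%:E).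
  apply/integrableP; split.
    by apply/measurable_EFinP; apply: continuous_measurable_fun;
      exact: continuous_oneDsqrV.
  under eq_integral do rewrite gee0_abs ?lee_fin ?oneDsqrV_ge0//.
  rewrite ge0_symfun_integralT; last 3 first.
  - by move=> x; rewrite invr_ge0 (le_trans ler01 (oneDsqr_ge1 _)).
  - exact: continuous_oneDsqrV.
  - by move=> x /=; rewrite /oneDsqr sqrrN.
  rewrite (_ : [set x | _] = `[0, +oo[%classic).
    by rewrite integral0y_oneDsqr -EFinM ltry.
  by apply/seteqP; split => x /=; rewrite in_itv/= andbT.
have i4 := integrableZl measurableT 4 i1.
apply: (le_integrable measurableT _ _ i4).
  by apply/measurable_EFinP; exact: measurable_fejer.
move=> x _; rewrite -EFinM lee_fin ger0_norm ?fejer_ge0// ger0_norm.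
  exact: fejer_le_oneDsqr.
by rewrite mulr_ge0// invr_ge0 (le_trans ler01 (oneDsqr_ge1 _)).
Qed.

Definition fejer_mass : R := \int[mu]_x fejer x.

(** The mass is pi, but it may remain a symbol: dilation alone produces the absolute values |a| of
    which the transform is made. *)
Lemma fejer_scale (a : R) : mu.-integrable setT (fun x =>
  ((1 - cos (a * x)) / x ^+ 2)%:E) /\
  \int[mu]_x ((1 - cos (a * x)) / x ^+ 2) = `|a| * fejer_mass.
Proof.
have [->|a0] := eqVneq a 0.
  rewrite normr0 mul0r.
  have E x : (1 - cos (0 * x)) / x ^+ 2 = 0 :> R by rewrite mul0r cos0 subrr
    mul0r.
  under eq_fun do rewrite E.
  split; first exact: integrable0.
  by under eq_Rintegral do rewrite E; rewrite Rintegral_cst// mul0r.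
have [i E] := integral_scale a0 integrable_fejer.
have EF x : (1 - cos (a * x)) / x ^+ 2 = a ^+ 2 * fejer (a * x).
  have [->|x0] := eqVneq x 0; first by rewrite /fejer !mulr0 expr0n invr0
    !mulr0.
  by rewrite /fejer exprMn invfM; field; rewrite x0 a0.
split.
  by under eq_fun do rewrite EF EFinM; apply: integrableZl.
under eq_Rintegral do rewrite EF.
rewrite RintegralZl// E mulrA -/fejer_mass; congr (_ * _).
rewrite -[a ^+ 2](real_normK (num_real a)) expr2 mulfK ?normr_eq0//.
Qed.

(** This is max (0, 1 - |s|), in the form in which the dilated Fejer integrals deliver it. *)
Definition tent (s : R) : R := (`|s + 1| + `|s - 1| - 2 * `|s|) / 2.

(** By product-to-sum, cos (s x) (1 - cos x) is a combination of 1 - cos (a x) for a = s + 1, s - 1,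
    s, so dilation evaluates the real part. The imaginary part is the integral of an odd
    function. *)
Lemma fourier_fejer s :
  cintegrable mu (fun x => expi (s * x) * toC (fejer x)) /\
  cintegral mu (fun x => expi (s * x) * toC (fejer x)) =
  toC (fejer_mass * tent s).
Proof.
have ci : cintegrable mu (fun x => expi (s * x) * toC (fejer x)).
  apply: (le_cintegrable _ integrable_fejer).
    apply: cmeasurableM; first by apply: cmeasurable_expi;
      exact: measurable_funM.
    by apply: cmeasurable_real; exact: measurable_fejer.
  by move=> x; rewrite Normc.normcM normc_expi mul1r normc_real ger0_norm//
    fejer_ge0.
split => //; apply: complex_eqP => /=.
- have [i1 E1] := fejer_scale (s + 1).
  have [i2 E2] := fejer_scale (s - 1).
  have [i3 E3] := fejer_scale s.
  pose A a x : R := (1 - cos (a * x)) / x ^+ 2.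
  transitivity (\int[mu]_x (2^-1 * ((A (s + 1) x + A (s - 1) x) + (- 2) * A s
    x))).
    apply: eq_Rintegral => x _; rewrite mulr0 subr0 /fejer /A.
    have -> : (s + 1) * x = s * x + x by ring.
    have -> : (s - 1) * x = s * x - x by ring.
    rewrite cosD cosB.
    have aux (a b c e u : R) : a * ((1 - b) * e) = 2^-1 *
        (((1 - (a * b - c * u)) * e + (1 - (a * b + c * u)) * e) + (- 2) * ((1 -
          a) * e)).
      by field.
    exact: aux.
  have i12 : mu.-integrable setT (EFin \o (fun x => A (s + 1) x + A (s - 1) x)).
    apply: eq_integrable (integrableD measurableT i1 i2) => // x _.
  have i3' : mu.-integrable setT (EFin \o (fun x => (- 2) * A s x)).
    apply: eq_integrable (integrableZl measurableT (- 2) i3) => // x _.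
  have i123 : mu.-integrable setT (EFin \o (fun x =>
    (A (s + 1) x + A (s - 1) x) + (- 2) * A s x)).
    apply: eq_integrable (integrableD measurableT i12 i3') => // x _.
  rewrite RintegralZl// RintegralD// RintegralD// RintegralZl// E1 E2 E3 /tent;
    ring.
- have [_ iI] := ci.
  have N1 : (-1 : R) != 0 by rewrite oppr_eq0 oner_eq0.
  have [_] := integral_scale (l := -1) N1 iI.
  rewrite normrN1 invr1 mul1r.
  set I := \int[mu]_x complex.Im (expi (s * x) * toC (fejer x)).
  rewrite -[X in _ -> X = 0]/I.
  have -> : \int[mu]_x complex.Im (expi (s * (-1 * x)) * toC (fejer (-1 * x))) =
    - I.
    transitivity (\int[mu]_x (-1 * complex.Im (expi (s * x) * toC (fejer x)))).
      apply: eq_Rintegral => x _; rewrite /= !mulr0 !add0r.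
      by rewrite mulN1r mulrN sinN /fejer cosN sqrrN mulN1r mulNr.
    by rewrite RintegralZl// mulN1r.
  lra.
Qed.

Lemma Rintegral_gt0 d (T : measurableType d) (m : {measure set T -> \bar R})
    (f : T -> R) (D : set T) (c : R) :
  m.-integrable setT (fun x => (f x)%:E) -> (forall x, 0 <= f x) ->
  measurable D -> 0 < c -> (0 < m D)%E -> (forall x, D x -> c <= f x) ->
  0 < \int[m]_x f x.
Proof.
move=> fi f0 mD c0 D0 Df; rewrite -lte_fin fineK;
  last exact: integrable_fin_num.
apply: (@lt_le_trans _ _ (c%:E * m D)%E); first by rewrite mule_gt0.
rewrite -(setIT D) -(integral_indic _ measurableT)// -ge0_integralZl_EFin//;
  last 2 first.
- by apply/measurable_EFinP; exact: measurable_indic.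
- exact: ltW.
apply: ge0_le_integral => //.
- by move=> x _; rewrite -EFinM lee_fin mulr_ge0// ltW.
- apply/measurable_EFinP; apply: measurable_funM => //; exact: measurable_indic.
- exact: measurable_int fi.
move=> x _; rewrite -EFinM lee_fin indicE; case: (boolP (x \in D)) => [|_];
  last by rewrite mulr0.
by rewrite inE mulr1 => /Df.
Qed.

Lemma fejer_mass_gt0 : 0 < fejer_mass.
Proof.
have p0 : 0 < pi :> R by exact: pi_gt0.
have c0 : 0 < (pi ^+ 2)^-1 :> R by rewrite invr_gt0 exprn_gt0.
(* On this interval cos x <= 0 and x <= pi, so the kernel is at least pi^(-2). *)
have mD : measurable (`[pi / 2, pi]%classic : set R) by exact: measurable_itv.
have muD : (0 < mu (`[(pi / 2)%R, pi]%classic : set R))%E.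
  rewrite lebesgue_measure_itv/= lte_fin ltr_pdivrMr// ltr_pMr// ltr1n -EFinB
    lte_fin subr_gt0.
  by rewrite ltr_pdivrMr// ltr_pMr// ltr1n.
apply: (Rintegral_gt0 integrable_fejer fejer_ge0 mD c0 muD) => x /=.
rewrite in_itv/= => /andP[x1 x2].
have x0 : 0 < x by apply: lt_le_trans x1; rewrite divr_gt0.
rewrite /fejer -[X in X <= _]mul1r ler_pM// ?invr_ge0 ?sqr_ge0//.
  rewrite lerDl oppr_ge0 -(subrK (pi / 2) x) cosDpihalf oppr_le0 sin_ge0_pi//.
  by rewrite subr_ge0 x1/= lerBlDr (le_trans x2)// lerDl divr_ge0// ltW.
by rewrite lef_pV2 ?posrE ?exprn_gt0// lerXn2r// nnegrE ltW.
Qed.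

Lemma tent_ge0 s : 0 <= tent s.
Proof.
rewrite /tent divr_ge0// subr_ge0.
have := ler_normD (s + 1) (s - 1).
by rewrite (_ : s + 1 + (s - 1) = 2 * s); [rewrite normrM ger0_norm|ring].
Qed.

Lemma tent_out s : 1 <= `|s| -> tent s = 0.
Proof.
rewrite /tent => h; have [s0|s0] := leP 0 s.
  rewrite ger0_norm// in h; rewrite !ger0_norm//; last 2 first.
  - by rewrite subr_ge0.
  - by rewrite addr_ge0.
  by field.
rewrite ltr0_norm// in h; rewrite !ler0_norm//; [by field|lra|lra|lra].
Qed.

Lemma tent_in s : `|s| <= 2^-1 -> 2^-1 <= tent s.
Proof.
rewrite /tent ler_norml => /andP[h1 h2].
rewrite (@ger0_norm _ (s + 1)); last by lra.
rewrite (@ler0_norm _ (s - 1)); last by lra.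
have : `|s| <= 2^-1 by rewrite ler_norml h1 h2.
lra.
Qed.

Definition wave_data n (x : 'rV[R]_n) : R[i] :=
  \prod_(i < n) (expi (3 * x ord0 i) * toC (fejer (x ord0 i))).

Definition wave_hat n (xi : 'rV[R]_n) : R :=
  \prod_(i < n) (fejer_mass * tent (3 - xi ord0 i)).

Lemma normc_wave_data_le1 n (x : 'rV[R]_n) : normc (wave_data x) <= 1.
Proof.
rewrite normc_prod prodr_ile1// => i _.
rewrite normc_ge0 Normc.normcM normc_expi mul1r normc_real ger0_norm
  ?fejer_ge0//.
by apply: le_trans (fejer_le _) _; rewrite invf_le1// ler1n.
Qed.

Lemma wave_hat_ge0 n (xi : 'rV[R]_n) : 0 <= wave_hat xi.
Proof. by apply: prodr_ge0 => i _; rewrite mulr_ge0 ?tent_ge0// ltW//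
  fejer_mass_gt0. Qed.

Lemma dotvC n (x y : 'rV[R]_n) : dotv x y = dotv y x.
Proof. by apply: eq_bigr => i _; rewrite mulrC. Qed.

Lemma expi_sum (I : finType) (F : I -> R) : expi (\sum_i F i) = \prod_i expi (F
  i) :> R[i].
Proof.
by apply: (big_morph expi) => [x y|]; [exact: expiD|exact: expi0].
Qed.

Lemma cintegrable_wave_data n : cintegrable (leb n) (@wave_data n).
Proof. by have [] := cintegral_rV_prod (fun _ : 'I_n =>
  (fourier_fejer 3).1). Qed.

Lemma fourier_wave_data n (xi : 'rV[R]_n) : fourier (@wave_data n) xi = toC
  (wave_hat xi).
Proof.
have [_ E] := cintegral_rV_prod (fun i : 'I_n =>
  (fourier_fejer (3 - xi ord0 i)).1).
transitivity (cintegral (leb n) (fun x => \prod_i (expi ((3 - xi ord0 i) * x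
  ord0 i) * toC (fejer (x ord0 i))))).
  apply: eq_cintegral => x; rewrite /wave_data -sumrN expi_sum -big_split/=.
  apply: eq_bigr => i _; rewrite mulrA -expiD; congr (expi _ * _); ring.
rewrite E /wave_hat rmorph_prod/=; apply: eq_bigr => i _.
exact: (fourier_fejer _).2.
Qed.

Lemma continuous_tent : continuous tent.
Proof.
move=> x; rewrite /tent.
apply: cvgM; last exact: cvg_cst.
apply: cvgB; last first.
  by apply: cvgM; [exact: cvg_cst|exact: norm_continuous].
apply: cvgD; apply: cvg_norm.
  by apply: cvgD; [exact: cvg_id|exact: cvg_cst].
by apply: cvgB; [exact: cvg_id|exact: cvg_cst].
Qed.

Lemma integrable_tent : mu.-integrable setT (fun x =>
  (fejer_mass * tent (3 - x))%:E).
Proof.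
have mt : measurable_fun setT (fun x : R => fejer_mass * tent (3 - x)).
  apply: measurable_funM => //; apply: measurableT_comp.
    by apply: continuous_measurable_fun; exact: continuous_tent.
  exact: measurable_funB.
have i1 := integrable_indic_itv (2 : R) 4 true false.
have i2 := integrableZl measurableT fejer_mass i1.
apply: (le_integrable measurableT _ _ i2); first exact/measurable_EFinP.
have Q0 := ltW fejer_mass_gt0.
move=> x _; rewrite -EFinM lee_fin (ger0_norm (mulr_ge0 Q0 (tent_ge0 _))).
rewrite indicE; case: (boolP (x \in _)) => [_|].
  rewrite mulr1 (ger0_norm Q0) ler_piMr// /tent.
  rewrite ler_pdivrMr// mul1r.
  by have := ler_normD (3 - x) 1; have := ler_normB (3 - x) 1; rewrite normr1;
    lra.
rewrite notin_setE /= in_itv/= => /negP h; rewrite tent_out ?mulr0// leNgt.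
by apply: contra h; rewrite ltr_norml => /andP[h1 h2]; apply/andP; split; lra.
Qed.

Lemma cintegrable_real d (T : measurableType d) (m : {measure set T ->
  \bar R}) (r : T -> R) :
  m.-integrable setT (fun x => (r x)%:E) ->
  cintegrable m (fun x => toC (r x)) /\
  cintegral m (fun x => toC (r x)) = toC (\int[m]_x r x).
Proof.
move=> ri; split; first by split => //; exact: integrable0.
by apply: complex_eqP => //=; rewrite /Rintegral integral0.
Qed.

Lemma cintegral_wave_hat n : cintegrable (leb n) (fun xi =>
  toC (@wave_hat n xi)) /\
  cintegral (leb n) (fun xi => toC (wave_hat xi)) =
  toC ((\int[mu]_x (fejer_mass * tent (3 - x))) ^+ n).
Proof.
have [ci cE] := cintegrable_real integrable_tent.
have [] := cintegral_rV_prod (fun _ : 'I_n => ci).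
have E : (fun xi => toC (@wave_hat n xi)) =
    (fun xi => \prod_i toC (fejer_mass * tent (3 - xi ord0 i))).
  by apply/funext => xi; exact: rmorph_prod.
by rewrite E => h1 ->; split => //; rewrite cE prodr_const card_ord -toCX.
Qed.

Lemma cintegrable_wave_hat n : cintegrable (leb n) (fun xi =>
  toC (@wave_hat n xi)).
Proof. exact: (cintegral_wave_hat n).1. Qed.

Lemma integral_wave_hat_gt0 n : 0 < \int[leb n]_xi wave_hat xi.
Proof.
have [_ /(congr1 (@complex.Re R))/= ->] := cintegral_wave_hat n.
have Q0 := fejer_mass_gt0.
apply: exprn_gt0.
have mD : measurable (`[(3 - 2^-1), 3]%classic : set R) by exact:
  measurable_itv.
have muD : (0 < mu (`[(3 - 2^-1)%R, 3%R]%classic : set R))%E.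
  by rewrite lebesgue_measure_itv/= lte_fin ltrBlDr ltrDl invr_gt0 ltr0n -EFinB
    lte_fin; lra.
have c0 : 0 < fejer_mass * 2^-1 by rewrite mulr_gt0.
apply: (Rintegral_gt0 integrable_tent _ mD c0 muD).
  by move=> x; rewrite mulr_ge0 ?tent_ge0// ltW.
move=> x /=; rewrite in_itv/= => /andP[x1 x2].
by rewrite ler_wpM2l ?(ltW Q0)// tent_in// ger0_norm; lra.
Qed.

(** This is the multiplication formula: exp(-i x.xi) f(x) phi(xi) is dominated by an integrable
    product, and Fubini exchanges the two integrations. *)
Lemma is_fourier_wave n : is_fourier (@wave_data n) (fun xi =>
  toC (wave_hat xi)).
Proof.
split; first exact: cintegrable_wave_hat.
move=> phi iphi _.
pose H (p : 'rV[R]_n * 'rV[R]_n) := expi (- dotv p.1 p.2) * (wave_data p.1 * phi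
  p.2).
have iP := cintegrable_prod (cintegrable_wave_data n) iphi.
have mP := cintegrable_measurable iP.
have iH : cintegrable (leb n \x leb n)%E H.
  apply: (le_cintegrable _ (cintegrable_normc iP)).
    apply: cmeasurableM => //; apply: cmeasurable_expi;
      apply: measurableT_comp => //.
    apply: measurable_sum => i; apply: measurable_funM.
      by apply: (measurableT_comp (measurable_coord i)).
    by apply: (measurableT_comp (measurable_coord i)).
  by move=> p; rewrite Normc.normcM normc_expi mul1r.
transitivity (cintegral (leb n) (fun xi => cintegral (leb n) (fun x => H (x,
  xi)))).
  apply: eq_cintegral => xi; rewrite -fourier_wave_data mulrC.
  have ie : cintegrable (leb n) (fun x => expi (- dotv x xi) * wave_data x).
    apply: (le_cintegrable _ (cintegrable_normc (cintegrable_wave_data n))).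
      apply: cmeasurableM; last exact: cintegrable_measurable
        (cintegrable_wave_data n).
      apply: cmeasurable_expi; apply: measurableT_comp => //;
        exact: measurable_dotv.
    by move=> x; rewrite Normc.normcM normc_expi mul1r.
  rewrite /fourier -(cintegralZl _ ie); apply: eq_cintegral => x.
  by rewrite /H/=; ring.
rewrite -(cintegral_exchange iH); apply: eq_cintegral => x.
have ie : cintegrable (leb n) (fun xi => expi (- dotv xi x) * phi xi).
  apply: (le_cintegrable _ (cintegrable_normc iphi)).
    apply: cmeasurableM; last exact: cintegrable_measurable iphi.
    apply: cmeasurable_expi; apply: measurableT_comp => //;
      exact: measurable_dotv.
  by move=> xi; rewrite Normc.normcM normc_expi mul1r.
rewrite /fourier -(cintegralZl _ ie); apply: eq_cintegral => xi.
by rewrite /H/= dotvC; ring.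
Qed.

Lemma wave_hat_support n : (0 < n)%N -> exists K : set 'rV[R]_n,
  [/\ compact K, ~ K 0, forall xi, ~ K xi -> wave_hat xi = 0
    & forall xi, K xi -> enorm xi <= 4 * n%:R].
Proof.
move=> n0; pose I := `[2, 4]%classic : set R.
exists [set v | forall i, I (v ord0 i)]; split.
- exact: (@rV_compact R n (fun=> I) (fun=> @segment_compact R 2 4)).
- move=> /(_ (Ordinal n0)); rewrite mxE /I/= in_itv/= => /andP[];
  rewrite ler0n. lra.
- move=> xi /existsNP[ i]; rewrite /I/= in_itv/= => h.
  rewrite /wave_hat (bigD1 i)//= tent_out ?mulr0 ?mul0r//.
  rewrite leNgt; apply/negP => h1; apply: h.
  move: h1; rewrite ltr_norml => /andP[h1 h2]; apply/andP; split; lra.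
move=> xi h.
(* Coordinates at most 4 give norm at most 4 sqrt n; the larger 4 n avoids the root. *)
rewrite -[leRHS]ger0_norm ?mulr_ge0// -sqrtr_sqr ler_wsqrtr//.
apply: (@le_trans _ _ (\sum_(i < n) (4 ^+ 2))).
  apply: ler_sum => i _; rewrite -expr2 lerXn2r ?nnegrE//; have := h i;
    rewrite /I/= in_itv/= => /andP[]; lra.
rewrite sumr_const card_ord -[leLHS]mulr_natr [leRHS]exprMn; apply: ler_wpM2l;
  first exact: sqr_ge0.
rewrite expr2 ler_peMr//.
by rewrite ler1n.
Qed.

End fejer.

(** * Duhamel integral of the data *)

Section pairing.
Context {R : realType}.
Local Notation mu := (@lebesgue_measure R).
Local Notation leb n := (@lebesgue_rV R n).
Local Notation toC x := ((x : R)%:C%C).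
Variables (n : nat) (n0 : (0 < n)%N).

Let delta : R := (4 * n%:R)^-1.
Let delta_gt0 : 0 < delta. Proof. by rewrite invr_gt0 mulr_gt0// ltr0n. Qed.

(** Its length is the reciprocal of the bound 4 n for |xi| on the frequency support, so the phase s
    |xi| never exceeds 1 and averaging over the pulse causes no cancellation. *)
Definition pulse : set R := `[0, (4 * n%:R)^-1]%classic.

Lemma measurable_pulse : measurable pulse.
Proof. exact: measurable_itv. Qed.

Lemma lebesgue_pulse : mu pulse = (4 * n%:R)^-1%:E.
Proof. by rewrite /pulse lebesgue_measure_itv/= lte_fin delta_gt0 sube0. Qed.

Definition source (s : R) (x : 'rV[R]_n) : R[i] :=
  toC (\1_pulse s) * wave_data x.
Definition source_hat (s : R) (xi : 'rV[R]_n) : R[i] :=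
  toC (\1_pulse s) * toC (wave_hat xi).

Let cintegrable_pulse : cintegrable mu (fun s => toC (\1_pulse s)).
Proof.
apply: cintegrable_indic; first exact: measurable_pulse.
exact: (eq_ind_r (fun x => (x < +oo)%E) (ltry _) lebesgue_pulse).
Qed.

Let cintegrable_source_hat : cintegrable (mu \x leb n)%E (fun p =>
  source_hat p.1 p.2).
Proof. exact: (cintegrable_prod cintegrable_pulse (cintegrable_wave_hat n)).
  Qed.

Let cintegrable_hat_source : cintegrable (leb n \x mu)%E (fun p =>
  source_hat p.2 p.1).
Proof.
have := cintegrable_prod (cintegrable_wave_hat n) cintegrable_pulse.
by under eq_fun do rewrite mulrC.
Qed.

Lemma measurable_enorm : measurable_fun setT (@enorm R n).
Proof.
apply: measurableT_comp; last exact: measurable_dotv2.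
by apply: continuous_measurable_fun; exact: sqrt_continuous.
Qed.

Lemma enorm_eq0 (xi : 'rV[R]_n) : enorm xi <= 0 -> xi = 0.
Proof.
move=> h; have e0 : enorm xi = 0 by apply/eqP; rewrite eq_le h enorm_ge0.
apply/rowP => i; rewrite mxE.
have /eqP : dotv xi xi = 0 by rewrite -enorm_sqr e0 expr0n.
rewrite psumr_eq0 => [/allP/(_ i)|j _]; last by rewrite -expr2 sqr_ge0.
by rewrite mem_index_enum/= => /(_ isT); rewrite mulf_eq0 orbb => /eqP.
Qed.

Definition wave_kernel (t : R) (x : 'rV[R]_n) (p : R * 'rV[R]_n) : R[i] :=
  expi (dotv x p.2) * (expi ((t - p.1) * enorm p.2) * source_hat p.1 p.2).

Lemma normc_wave_kernel t x p :
  normc (wave_kernel t x p) = normc (source_hat p.1 p.2).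
Proof. by rewrite /wave_kernel 2!Normc.normcM !normc_expi !mul1r. Qed.

Lemma cintegrable_wave_kernel t x : cintegrable (mu \x leb n)%E (wave_kernel t
  x).
Proof.
apply: (le_cintegrable _ (cintegrable_normc cintegrable_source_hat)).
  apply: cmeasurableM.
    apply: cmeasurable_expi; under eq_fun do rewrite dotvC.
    by apply: (measurableT_comp (measurable_dotv x)).
  apply: cmeasurableM; last exact: (cintegrable_measurable
    cintegrable_source_hat).
  apply: cmeasurable_expi; apply: measurable_funM; first exact: measurable_funB.
  by apply: (measurableT_comp measurable_enorm).
by move=> p; rewrite normc_wave_kernel.
Qed.

Lemma half_wave_source t s x : half_wave (t - s) (source_hat s) x =
  toC ((2 * pi) ^- n) * cintegral (leb n) (fun xi => wave_kernel t x (s, xi)).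
Proof. by []. Qed.

Lemma duhamel_converges_source : duhamel_converges source_hat.
Proof.
move=> t x; under eq_fun do rewrite half_wave_source.
apply: cintegrableZl; exact: (cintegrable_cintegral12 (cintegrable_wave_kernel t
  x)).
Qed.

(** The time integral runs over the whole line rather than over s < t, so exp(i t |xi|) factors out
    and the Duhamel integral is the free evolution of one datum, independent of t. This is the
    transform of that datum. *)
Definition averaged_hat (xi : 'rV[R]_n) : R[i] :=
  cintegral mu (fun s => expi (- (s * enorm xi)) * source_hat s xi).

Let averaged_kernel (p : 'rV[R]_n * R) : R[i] :=
  expi (- (p.2 * enorm p.1)) * source_hat p.2 p.1.

Let cintegrable_averaged_kernel : cintegrable (leb n \x mu)%E averaged_kernel.
Proof.
apply: (le_cintegrable _ (cintegrable_normc cintegrable_hat_source)).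
  apply: cmeasurableM; last exact: (cintegrable_measurable
    cintegrable_hat_source).
  apply: cmeasurable_expi; apply: measurableT_comp => //;
    apply: measurable_funM => //.
  by apply: (measurableT_comp measurable_enorm).
by move=> p; rewrite Normc.normcM normc_expi mul1r.
Qed.

Lemma cintegrable_averaged_hat : cintegrable (leb n) averaged_hat.
Proof. exact: (cintegrable_cintegral12 cintegrable_averaged_kernel). Qed.

Lemma cintegrable_source_section xi : cintegrable mu (fun s =>
  expi (- (s * enorm xi)) * source_hat s xi).
Proof.
have ip := cintegrableZl (toC (wave_hat xi)) cintegrable_pulse.
apply: (le_cintegrable _ (cintegrable_normc ip)).
  apply: cmeasurableM.
    by apply: cmeasurable_expi; apply: measurableT_comp => //;
      exact: measurable_funM.
  by apply: cmeasurableM; [exact: (cintegrable_measurable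
    cintegrable_pulse)|exact: cmeasurable_cst].
by move=> s; rewrite Normc.normcM normc_expi mul1r /source_hat mulrC.
Qed.

Lemma duhamel_source t x : duhamel source_hat t x =
  toC ((2 * pi) ^- n) *
  cintegral (leb n) (fun xi => expi (dotv x xi) * (expi (t * enorm xi) *
    averaged_hat xi)).
Proof.
have ik := cintegrable_wave_kernel t x.
transitivity (toC ((2 * pi) ^- n) * cintegral mu (fun s =>
  cintegral (leb n) (fun xi => wave_kernel t x (s, xi)))).
  rewrite -(cintegralZl _ (cintegrable_cintegral12 ik)).
  by apply: eq_cintegral => s; exact: half_wave_source.
rewrite (cintegral_exchange ik); congr (_ * _); apply: eq_cintegral => xi.
have is_ := cintegrable_source_section xi.
rewrite /averaged_hat mulrA -(cintegralZl _ is_); apply: eq_cintegral => s.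
rewrite /wave_kernel [(s, xi).1]/= [(s, xi).2]/= mulrBl expiD; ring.
Qed.

Lemma cmeasurable_duhamel_source t : cmeasurable (duhamel source_hat t).
Proof.
have -> : duhamel source_hat t = fun x => toC ((2 * pi) ^- n) *
    cintegral (leb n) (fun xi => expi (dotv x xi) * (expi (t * enorm xi) *
      averaged_hat xi)).
  by apply/funext => x; exact: duhamel_source.
apply: cmeasurableM; first exact: cmeasurable_cst.
apply: (cmeasurable_cintegral (leb n) (f := fun q : 'rV[R]_n * 'rV[R]_n =>
  expi (dotv q.1 q.2) * (expi (t * enorm q.2) * averaged_hat q.2))).
apply: cmeasurableM.
  apply: cmeasurable_expi; apply: measurable_sum => i; apply: measurable_funM;
    by apply: (measurableT_comp (measurable_coord i)).
apply: cmeasurableM.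
  apply: cmeasurable_expi; apply: measurable_funM => //.
  by apply: (measurableT_comp measurable_enorm).
by apply: (cmeasurable_comp (phi := snd) _ (cintegrable_measurable
  cintegrable_averaged_hat)).
Qed.

(** The constant K: of exp(-z |xi|) only exp(-|xi|), due to the real part 1 of z, survives the
    cancellation of the phases. *)
Definition pairing : R[i] :=
  cintegral (leb n) (fun xi => toC (expR (- enorm xi)) * averaged_hat xi).

Lemma cintegrable_pairing :
  cintegrable (leb n) (fun xi => toC (expR (- enorm xi)) * averaged_hat xi).
Proof.
apply: (le_cintegrable _ (cintegrable_normc cintegrable_averaged_hat)).
  apply: cmeasurableM; last exact: (cintegrable_measurable
    cintegrable_averaged_hat).
  apply: cmeasurable_real; apply: measurableT_comp => //;
    apply: measurableT_comp => //.
  exact: measurable_enorm.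
move=> p; rewrite Normc.normcM normc_real ger0_norm ?expR_ge0// ler_piMl
  ?normc_ge0//.
by rewrite -expR0 ler_expR oppr_le0 enorm_ge0.
Qed.

Lemma wave_hat_eq0 (xi : 'rV[R]_n) : enorm xi <= 0 \/ 4 * n%:R < enorm xi ->
  wave_hat xi = 0.
Proof.
have [K [_ K0 Kout Kin]] := @wave_hat_support R n n0.
move=> h; apply: Kout => Kxi; case: h => [/enorm_eq0 xi0|].
  by apply: K0; rewrite -xi0.
by apply/negP; rewrite -leNgt; exact: Kin.
Qed.

Lemma averaged_hat_eq0 (xi : 'rV[R]_n) : wave_hat xi = 0 -> averaged_hat xi = 0.
Proof.
move=> h0; rewrite /averaged_hat.
transitivity (cintegral mu (fun s => 0 * toC (\1_pulse s))).
  by apply: eq_cintegral => s; rewrite /source_hat h0 !mulr0 mul0r.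
by rewrite (cintegralZl _ cintegrable_pulse) mul0r.
Qed.

Lemma cintegral_conical_duhamel t :
  cintegral (leb n) (fun x => conical (Complex 1 t) x * duhamel source_hat t x)
    =
  toC ((2 * pi) ^- n) * (gauss_int (Complex 1 t)^-1 ^+ n * gauss_int (Complex 1
    t)) *
  pairing.
Proof.
set z := Complex 1 t; have z0 : 0 < complex.Re z by exact: ltr01.
have ih := cintegrable_conical n0 z0; have ia := cintegrable_averaged_hat.
pose A x xi := expi (dotv x xi) * (expi (t * enorm xi) * averaged_hat xi).
pose Phi (q : 'rV[R]_n * 'rV[R]_n) := conical z q.1 * A q.1 q.2.
have mA : cmeasurable (fun q : 'rV[R]_n * 'rV[R]_n => A q.1 q.2).
  apply: cmeasurableM.
    apply: cmeasurable_expi; apply: measurable_sum => i; apply: measurable_funM;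
      by apply: (measurableT_comp (measurable_coord i)).
  apply: cmeasurableM.
    apply: cmeasurable_expi; apply: measurable_funM => //.
    by apply: (measurableT_comp measurable_enorm).
  by apply: (cmeasurable_comp (phi := snd) _ (cintegrable_measurable ia)).
have nA x xi : normc (A x xi) = normc (averaged_hat xi).
  by rewrite /A 2!Normc.normcM !normc_expi !mul1r.
have iA x : cintegrable (leb n) (A x).
  apply: (le_cintegrable _ (cintegrable_normc ia)); last by move=> xi;
    rewrite nA.
  by apply: (cmeasurable_comp (phi := fun xi => (x, xi)) _ mA);
    exact: measurable_pair1.
have iPhi : cintegrable (leb n \x leb n)%E Phi.
  apply: (le_cintegrable _ (cintegrable_normc (cintegrable_prod ih ia))).
    apply: cmeasurableM => //.
    by apply: (cmeasurable_comp (phi := fst) _ (cintegrable_measurable ih)).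
  by move=> q; rewrite Normc.normcM nA -Normc.normcM.
transitivity (cintegral (leb n) (fun x => toC ((2 * pi) ^- n) *
    cintegral (leb n) (fun xi => Phi (x, xi)))).
  apply: eq_cintegral => x; rewrite duhamel_source mulrCA; congr (_ * _).
  by rewrite -(cintegralZl _ (iA x)).
rewrite (cintegralZl _ (cintegrable_cintegral12 iPhi)) -[RHS]mulrA;
  congr (_ * _).
rewrite (cintegral_exchange iPhi) /pairing.
rewrite -(cintegralZl _ cintegrable_pairing); apply: eq_cintegral => xi.
set kap := gauss_int _ ^+ n * _.
transitivity (cintegral (leb n) (fun x => expi (t * enorm xi) * averaged_hat xi
  *
    (expi (dotv x xi) * conical z x))).
  by apply: eq_cintegral => x; rewrite /Phi /A/=; ring.
rewrite (cintegralZl _ (cintegrable_conical_expi xi n0 z0)).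
(* [fourier_conical] excludes the zero frequency, where the data vanish. *)
have [xi0|xi0] := ltP 0 (enorm xi); last first.
  by rewrite averaged_hat_eq0 ?mulr0 ?mul0r//; apply: wave_hat_eq0; left.
rewrite (fourier_conical n0 z0 xi0) -/kap.
have -> : cexp (- z * toC (enorm xi)) = toC (expR (- enorm xi)) * expi (- (t *
  enorm xi)).
  rewrite cexpE; congr (toC (expR _) * expi _); rewrite /z/=; ring.
have e1 : expi (t * enorm xi) * expi (- (t * enorm xi)) = 1 :> R[i].
  by rewrite -expiD subrr expi0.
transitivity (expi (t * enorm xi) * expi (- (t * enorm xi)) *
  (kap * (toC (expR (- enorm xi)) * averaged_hat xi))); first by ring.
by rewrite e1 mul1r.
Qed.

(** On the support the phase is at most 1, so its cosine is at least 1/2 and the average over the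
    pulse is at least delta / 2 times [wave_hat], while exp(-|xi|) is at least exp(-4 n). *)
Lemma re_pairing_gt0 : 0 < complex.Re pairing.
Proof.
have [iR _] := cintegrable_pairing.
have iw := @cintegrable_wave_hat R n.
pose c : R := expR (- (4 * n%:R)) * (delta / 2).
have c0 : 0 < c by rewrite mulr_gt0 ?expR_gt0// divr_gt0.
have bound xi : c * wave_hat xi <= complex.Re (toC (expR (- enorm xi)) *
  averaged_hat xi).
  have [h|h] := leP (enorm xi) (4 * n%:R); last first.
    have h0 : wave_hat xi = 0 by apply: wave_hat_eq0; right.
    by rewrite (averaged_hat_eq0 h0) h0 !mulr0.
  rewrite reZ /c -mulrA; apply: ler_pM => //.
  - by rewrite mulr_ge0 ?wave_hat_ge0// divr_ge0// ltW.
  - by rewrite ler_expR lerN2.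
  have [ipR _] := cintegrable_pulse.
  have iu := integrableZl measurableT (wave_hat xi / 2) ipR.
  have [is_ _] := cintegrable_source_section xi.
  have -> : delta / 2 * wave_hat xi = \int[mu]_s (wave_hat xi / 2 * complex.Re
    (toC (\1_pulse s))).
    rewrite RintegralZl//= /Rintegral integral_indic//;
      last exact: measurable_pulse.
    have E : fine (mu (pulse `&` setT)) = delta.
      by rewrite setIT; exact: (congr1 fine lebesgue_pulse).
    by rewrite E; ring.
  apply: le_Rintegral => //.
  move=> s _; rewrite reM /source_hat -[toC _ * toC _]rmorphM/= mulr0 subr0.
  rewrite indicE; case: (boolP (s \in pulse)); last by rewrite mul0r !mulr0.
  rewrite inE /pulse/= in_itv/= -/delta => /andP[s0 s1].
  rewrite mul1r mulr1 [leLHS]mulrC ler_wpM2r ?wave_hat_ge0// cosN.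
  apply: le_trans (cos_ge _); rewrite lerBrDl -lerBrDr.
  have : (s * enorm xi) ^+ 2 <= 1.
    rewrite exprn_ile1 ?mulr_ge0 ?enorm_ge0//.
    have -> : 1 = delta * (4 * n%:R) by rewrite mulVf// gt_eqF// mulr_gt0//
      ltr0n.
    by rewrite ler_pM ?enorm_ge0.
  lra.
have [iwR _] := iw.
apply: (@lt_le_trans _ _ (\int[leb n]_xi (c * wave_hat xi))).
  by rewrite RintegralZl// mulr_gt0// integral_wave_hat_gt0.
apply: le_Rintegral => //.
exact: eq_integrable (integrableZl measurableT c iwR).
Qed.

End pairing.

(** * Lower bound by duality *)

Section duality.
Context {R : realType} d {T : measurableType d} (m : {measure set T -> \bar R}).
Local Notation toC x := ((x : R)%:C%C).

(** In extended reals the bound is trivial when the right-hand side is infinite, so it applies to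
    the pairing before anything is known about the integrability of the product. *)
Lemma le_normc_cintegral (f : T -> R[i]) : cmeasurable f ->
  ((normc (cintegral m f))%:E <= 2%:E * \int[m]_x (normc (f x))%:E)%E.
Proof.
move=> mf; have [foo|] := ltP (\int[m]_x (normc (f x))%:E)%E +oo%E; last first.
  by rewrite leye_eq => /eqP ->; rewrite gt0_muley ?leey// lte_fin.
have cf := cintegrableP mf foo.
have h := normc_cintegral cf.
have : (0 <= \int[m]_x (normc (f x))%:E)%E.
  by apply: integral_ge0 => x _; rewrite lee_fin normc_ge0.
move=> h0; rewrite -(fineK (x := (\int[m]_x (normc (f x))%:E)%E))
  ?ge0_fin_numE//.
Qed.

(** Hoelder, with the dual norm of [h] interpolated between its sup and L^1 bounds: since 0 <= beta
    <= 1 and the dual exponent is at least 1, a power of beta is at most beta. For r = +oo the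
    inverse is 0 and the power of M becomes 1. *)
Lemma le_cLnorm_pairing (r : \bar R) (h D : T -> R[i]) (beta : T ->
  R) (C M : R) :
  (0 < m setT)%E -> (2%:E <= r)%E -> cmeasurable h -> cmeasurable D ->
  measurable_fun setT beta -> (forall x, 0 <= beta x <= 1) ->
  0 < C -> 0 < M -> (forall x, normc (h x) <= C * beta x) ->
  (\int[m]_x (beta x)%:E <= M%:E)%E ->
  (\int[m]_x (normc (h x * D x))%:E <= (C * M `^ (1 - fine r^-1))%:E * cLnorm m
    r D)%E.
Proof.
move=> mT r2 mh mD mb b01 C0 M0 hb bM.
have mnh := measurable_normc mh; have mnD := measurable_normc mD.
case: r r2 => [r|_|//].
- rewrite lee_fin => r2; have r0 : 0 < r by lra.
  pose q := (1 - r^-1)^-1.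
  have ri : r^-1 <= 2^-1 by rewrite lef_pV2 ?posrE.
  have ri0 : 0 < r^-1 by rewrite invr_gt0.
  have qi0 : 0 < 1 - r^-1 by lra.
  have q0 : 0 < q by rewrite invr_gt0.
  have q1 : 1 <= q by rewrite /q -[X in X <= _]invr1 lef_pV2 ?posrE//; lra.
  have qr : q^-1 + r^-1 = 1 by rewrite /q invrK subrK.
  have := hoelder m mnh mnD q0 r0 qr.
  rewrite Lnorm1.
  under eq_integral => x _.
    rewrite gee0_abs; last by rewrite lee_fin mulr_ge0 ?normc_ge0.
    rewrite /= -Normc.normcM.
    over.
  move=> /le_trans; apply.
  rewrite -[X in (_ <= _ * X)%E]/(Lnorm m r%:E (EFin \o (normc \o D))).
  apply: lee_wpmul2r; first exact: Lnorm_ge0.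
  rewrite inver gt_eqF// -[fine _]/(r^-1).
  rewrite unlock /=.
  have bq x : normc (h x) `^ q <= C `^ q * beta x.
    have /andP[b0 b1] := b01 x.
    apply: (@le_trans _ _ ((C * beta x) `^ q)).
      by apply: ge0_ler_powR; rewrite ?nnegrE ?normc_ge0 ?mulr_ge0 ?(ltW C0)
        ?(ltW q0)//.
    rewrite powRM ?(ltW C0)// ler_wpM2l ?powR_ge0//.
    have [->|bn0] := eqVneq (beta x) 0; first by rewrite powR0// gt_eqF.
    rewrite -[leRHS]powRr1//; apply: ger_powR => //.
    by rewrite b1 lt_neqAle eq_sym bn0 b0.
  have iq : (\int[m]_x `|(normc (h x))%:E| `^ q <= (C `^ q * M)%:E)%E.
    apply: (@le_trans _ _ (\int[m]_x ((C `^ q)%:E * (beta x)%:E)%E)%E).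
      apply: ge0_le_integral => //.
      - by move=> x _; exact: poweR_ge0.
      - apply: (measurableT_comp (measurable_poweR q)).
        by apply: measurableT_comp => //; exact/measurable_EFinP.
      - by apply/measurable_EFinP; apply: measurable_funM.
      by move=> x _; rewrite gee0_abs ?lee_fin ?normc_ge0// -EFinM poweR_EFin
        lee_fin.
    rewrite ge0_integralZl_EFin//; last 3 first.
    - by move=> x _; have /andP[] := b01 x.
    - exact/measurable_EFinP.
    - exact: powR_ge0.
    by rewrite EFinM; apply: lee_wpmul2l => //; rewrite lee_fin powR_ge0.
  have I0 : (0 <= \int[m]_x `|(normc (h x))%:E| `^ q)%E.
    by apply: integral_ge0 => x _; exact: poweR_ge0.
  have CM0 : 0 <= C `^ q * M by rewrite mulr_ge0 ?powR_ge0// ltW.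
  have := gt0_ler_poweR (ltW (eq_ind_r (fun y => 0 < y) qi0 (invrK _))) _ _ iq.
  rewrite !in_itv/= I0 !leey lee_fin CM0 => /(_ isT isT) /le_trans; apply.
  rewrite lee_fin powRM ?powR_ge0 ?(ltW M0)// -powRrM mulfV ?gt_eqF// powRr1
    ?(ltW C0)//.
  by rewrite /q invrK.
(* The norm of exponent +oo is the essential supremum only for a nonzero measure, which is the
   purpose of [mT]. *)
- rewrite invey /= subr0 powRr1 ?(ltW M0)// /cLnorm unlock mT.
  set S := ess_sup _ _.
  have S0 : (0 <= S)%E.
    by apply: ess_sup_gee => //; apply: nearW => x; exact: abse_ge0.
  have supS : \forall x \ae m, ((abse \o (fun x => (normc (D x))%:E)) x <= S)%E.
    exact: ess_sup_ge.
  clearbody S; case: S S0 supS => [s|_ _|//]; last first.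
    by rewrite gt0_muley ?leey// lte_fin mulr_gt0.
  rewrite lee_fin => s0 sup.
  apply: (@le_trans _ _ (\int[m]_x (s%:E * (normc (h x))%:E))%E).
    apply: ae_ge0_le_integral => //.
    - by move=> x _; rewrite lee_fin normc_ge0.
    - by apply/measurable_EFinP; exact: (measurable_normc (cmeasurableM mh mD)).
    - by move=> x _; rewrite -EFinM lee_fin mulr_ge0// normc_ge0.
    - by apply/measurable_EFinP; exact: measurable_funM.
    apply: filterS sup => x hD _.
    have {}hD : normc (D x) <= s by rewrite -lee_fin; move: hD;
      rewrite /= ger0_norm ?normc_ge0.
    by rewrite -EFinM lee_fin Normc.normcM mulrC ler_wpM2r// normc_ge0.
  rewrite ge0_integralZl_EFin//; last 2 first.
  - by move=> x _; rewrite lee_fin normc_ge0.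
  - exact/measurable_EFinP.
  rewrite muleC; apply: lee_wpmul2r; first by rewrite lee_fin.
  apply: (@le_trans _ _ (\int[m]_x (C%:E * (beta x)%:E))%E).
    apply: ge0_le_integral => //.
    - by move=> x _; rewrite lee_fin normc_ge0.
    - exact/measurable_EFinP.
    - by apply/measurable_EFinP; exact: measurable_funM.
    by move=> x _; rewrite -EFinM lee_fin.
  rewrite ge0_integralZl_EFin//; last 3 first.
  - by move=> x _; have /andP[] := b01 x.
  - exact/measurable_EFinP.
  - exact: ltW.
  by rewrite EFinM; apply: lee_wpmul2l => //; rewrite lee_fin ltW.
Qed.

End duality.

Section dispersive_lower_bound.
Context {R : realType}.
Local Notation mu := (@lebesgue_measure R).
Local Notation leb n := (@lebesgue_rV R n).
Local Notation toC x := ((x : R)%:C%C).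

(** With total mass 0 the integral of [wave_hat] would vanish, but it is positive. *)
Lemma lebesgue_rV_setT_gt0 n : (0 < leb n [set: 'rV[R]_n])%E.
Proof.
rewrite lt0e measure_ge0 andbT; apply/eqP => h0.
have := @integral_wave_hat_gt0 R n; rewrite /Rintegral.
rewrite (ge0_negligible_integral (N := setT)) ?setDT ?integral_set0 ?ltxx//.
- by have [iR _] := @cintegrable_wave_hat R n; exact: measurable_int iR.
- by move=> x _; rewrite lee_fin wave_hat_ge0.
Qed.

Lemma inve_ge2 (r : \bar R) : (2%:E <= r)%E ->
  [/\ (r^-1 = (fine r^-1)%:E)%E, 0 <= fine r^-1 & fine r^-1 <= 2^-1].
Proof.
case: r => [r|_|//]; last by rewrite invey; split; rewrite //= invr_ge0.
rewrite lee_fin => r2; have r0 : 0 < r by lra.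
by rewrite inver gt_eqF//= invr_ge0 ltW// lef_pV2 ?posrE.
Qed.

(** Each of the n space variables gains |z|^(1/2), and the remaining Gaussian in y loses one such
    factor: this is where n - 1 comes from. *)
Lemma normc_gauss_int_dual n (z : R[i]) : 0 < complex.Re z -> (0 < n)%N ->
  normc (gauss_int z^-1 ^+ n * gauss_int z) =
  normc (gauss_int 1) ^+ n.+1 * Num.sqrt (normc z) ^+ n.-1.
Proof.
move=> z0 n0; set c := normc (gauss_int 1); have c0 : 0 < c := gauss_int1_gt0.
have w0 : 0 < normc z by rewrite normc_gt0// Re_gt0_neq0.
set s := Num.sqrt (normc z); have s0 : 0 < s by rewrite (sqrtr_gt0 (normc z)).
have sE : s ^+ 2 = normc z by rewrite (sqr_sqrtr (normc_ge0 z)).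
have J1 : normc (gauss_int z) = c / s.
  apply/eqP; rewrite -(eqrXn2 (n := 2))// ?normc_ge0 ?divr_ge0 ?(ltW c0) ?(ltW
    s0)//.
  rewrite expr_div_n sE -(normc_gauss_int z0) mulfK// gt_eqF//.
have J2 : normc (gauss_int z^-1) = c * s.
  apply/eqP; rewrite -(eqrXn2 (n := 2))// ?normc_ge0 ?mulr_ge0 ?(ltW c0) ?(ltW
    s0)//.
  have zi0 := re_inv_gt0 z0.
  have zz : normc z^-1 * normc z = 1.
    by rewrite -Normc.normcM mulVf ?Normc.normc1// Re_gt0_neq0.
  by rewrite exprMn sE -(normc_gauss_int zi0) -mulrA zz mulr1.
rewrite Normc.normcM normcX J1 J2; case: n n0 => // k _ /=.
by rewrite exprMn mulrACA -exprSr [s ^+ k.+1]exprSr mulfK// gt_eqF.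
Qed.

Lemma duhamel_source_lower_bound (n : nat) (r : \bar R) : (2 <= n)%N ->
  (2%:E <= r)%E ->
  exists2 c : R, 0 < c & forall t, 1 <= t ->
    ((c * t `^ (- (n.-1%:R * (2^-1 - fine r^-1))))%:E <=
      cLnorm (leb n) r (duhamel (@source_hat R n) t))%E.
Proof.
move=> n2 r2; have n0 : (0 < n)%N := ltnW n2.
have [C C0 hC] := @normc_gauss_moment R n.
have [C1 C10 hC1] := @integral_cone_decay R n n2.
have K0 := re_pairing_gt0 (R := R) n0.
set K := normc (pairing (R := R) n).
have {K0} K0 : 0 < K.
  by apply: lt_le_trans K0 _; apply: le_trans (normc_Re _); exact: ler_norm.
pose c1 := normc (gauss_int (1 : R[i])); have c10 : 0 < c1 by exact:
  gauss_int1_gt0.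
pose a := ((2 * pi) ^- n) * c1 ^+ n.+1 * K.
have a0 : 0 < a.
  by rewrite !mulr_gt0 ?exprn_gt0// invr_gt0 exprn_gt0// mulr_gt0// pi_gt0.
have [_ rho0 rho1] := inve_ge2 r2; set rho := fine r^-1 in rho0 rho1 *.
(* The 2 comes from [le_normc_cintegral]; adding 1 makes the two nonnegative constants positive. *)
pose b := 2 * ((C + 1) * (C1 + 1) `^ (1 - rho)).
have b0 : 0 < b.
  by rewrite mulr_gt0// mulr_gt0 ?ltr_wpDl// powR_gt0// ltr_wpDl.
exists (a / b); first by rewrite divr_gt0.
move=> t t1; have t0 : 0 < t := lt_le_trans ltr01 t1.
set z := Complex 1 t; have z0 : 0 < complex.Re z by exact: ltr01.
set D := duhamel _ t; have mD : cmeasurable D by exact: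
  cmeasurable_duhamel_source.
have ih := cintegrable_conical n0 z0.
have mh := cintegrable_measurable ih.
pose M := (C1 + 1) * t ^+ n.-1.
have tn0 : 0 < t ^+ n.-1 by rewrite exprn_gt0.
have M0 : 0 < M by rewrite mulr_gt0// ltr_wpDl.
have hb (x : 'rV[R]_n) : normc (conical z x) <= (C + 1) * cone_decay t x.
  have w0 := re_cone_weight_gt0 x z0.
  have := hC _ w0; rewrite -/(conical z x) => h.
  have sw0 : 0 < Num.sqrt (normc (cone_weight z x)).
    by rewrite (sqrtr_gt0 (normc _)) normc_gt0// Re_gt0_neq0.
  rewrite /cone_decay exprVn ler_pdivlMr ?exprn_gt0//.
  by apply: le_trans h _; rewrite lerDl.
have bM : (\int[leb n]_x (cone_decay t x)%:E <= M%:E)%E.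
  by apply: le_trans (hC1 _ t1) _; rewrite lee_fin ler_wpM2r ?(ltW tn0)// lerDl.
have b01 (x : 'rV[R]_n) : 0 <= cone_decay t x <= 1.
  by rewrite cone_decay_ge0 cone_decay_le1.
have C10' : 0 < C + 1 by rewrite ltr_wpDl.
have key := le_cLnorm_pairing (lebesgue_rV_setT_gt0 n) r2 mh mD
  (measurable_cone_decay t) b01 C10' M0 hb bM.
have low := le_normc_cintegral (leb n) (cmeasurableM mh mD).
rewrite (cintegral_conical_duhamel n0) -/z in low.
have tz : t <= normc z by apply: le_trans (normc_Im z); exact: ler_norm.
have lhs : a * Num.sqrt t ^+ n.-1 <=
    normc (toC ((2 * pi) ^- n) * (gauss_int z^-1 ^+ n * gauss_int z) * pairing
      n).
  rewrite Normc.normcM Normc.normcM normc_real (normc_gauss_int_dual z0 n0) -/c1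
    -/K.
  rewrite ger0_norm; last by rewrite invr_ge0 exprn_ge0// mulr_ge0// pi_ge0.
  rewrite /a mulrAC -!mulrA ler_wpM2l ?invr_ge0 ?exprn_ge0 ?mulr_ge0 ?pi_ge0//.
  rewrite ler_wpM2l ?exprn_ge0 ?(ltW c10)// ler_wpM2r ?(ltW K0)//.
  rewrite lerXn2r ?nnegrE ?sqrtr_ge0//; exact: ler_wsqrtr.
have all : ((a * Num.sqrt t ^+ n.-1)%:E <=
    2%:E * ((C + 1)%R * M `^ (1 - rho))%:E * cLnorm (leb n) r D)%E.
  rewrite -muleA; apply: le_trans (lee_wpmul2l _ key); last by rewrite lee_fin.
  by apply: le_trans low; rewrite lee_fin.
have powt (k : nat) : t ^+ k = t `^ k%:R by rewrite powR_mulrn// ltW.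
have sqt : Num.sqrt t ^+ n.-1 = t `^ (n.-1%:R / 2).
  by rewrite -powR_mulrn ?sqrtr_ge0// -powR12_sqrt ?(ltW t0)// -powRrM mulrC.
have Mt : M `^ (1 - rho) = (C1 + 1) `^ (1 - rho) * t `^ (n.-1%:R * (1 - rho)).
  by rewrite /M powRM ?exprn_ge0 ?addr_ge0 ?(ltW t0)// powt -powRrM.
have N0 : (0 <= cLnorm (leb n) r D)%E by exact: Lnorm_ge0.
case: (cLnorm (leb n) r D) N0 all => [v|_ _|//]; last by rewrite leey.
move=> _; rewrite -!EFinM !lee_fin sqt Mt => h.
(* The pairing grows like t^((n-1)/2) and the dual norm of [conical] is at most of order
   t^((n-1)(1-rho)); their quotient has the stated exponent. *)
have -> : - (n.-1%:R * (2^-1 - rho)) = n.-1%:R / 2 - n.-1%:R * (1 - rho) by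
  field.
rewrite powRD; last by rewrite (gt_eqF t0) implybT.
rewrite powRN mulrA ler_pdivrMr ?powR_gt0//.
rewrite mulrAC ler_pdivrMr//; apply: le_trans h _.
by rewrite /b le_eqVlt; apply/orP; left; apply/eqP; ring.
Qed.

End dispersive_lower_bound.

(** * Divergence of the Lorentz norm *)

Section lorentz.
Context {R : realType}.
Local Notation mu := (@lebesgue_measure R).

(** The integral of a nonnegative function is a supremum over simple functions below it, hence
    monotone without measurability; the Lorentz norm is applied to an arbitrary [G]. *)
Lemma le_integral_ge0 d (T : measurableType d) (m : {measure set T -> \bar R})
    (f g : T -> \bar R) : (forall x, 0 <= f x)%E -> (forall x, f x <= g x)%E ->
  (\int[m]_x f x <= \int[m]_x g x)%E.
Proof.
move=> f0 fg; have g0 x : (0 <= g x)%E by apply: le_trans (fg x).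
rewrite ge0_integralTE// [leRHS]ge0_integralTE//; apply: le_ereal_sup.
move=> _ [h hf <-]; exists h => // x; exact: le_trans (hf x) (fg x).
Qed.

(* On arbitrary sets the library's Lebesgue measure is the outer measure that it
   restricts. *)
Lemma le_lebesgue_measure (A B : set R) : A `<=` B -> (mu A <= mu B)%E.
Proof.
move=> AB; exact: le_outer_measure.
Qed.

Lemma integral_invr_itv (b : R) : 0 < b ->
  (\int[mu]_x (\1_(`]0, b[%classic) x * x^-1)%:E = +oo)%E.
Proof.
move=> b0; set f := fun x : R => (\1_(`]0, b[%classic) x * x^-1).
have f0 x : 0 <= f x.
  rewrite /f indicE; case: (boolP (x \in _)); rewrite ?mul0r// inE/= in_itv/=
    mul1r invr_ge0.
  by case/andP => /ltW.
have mf : measurable_fun setT (EFin \o f).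
  apply/measurable_EFinP; apply: measurable_funM; last exact: measurable_inv.
  by apply: measurable_indic; exact: measurable_itv.
have two0 : (2 : R) != 0 by [].
have E := ge0_integral_scale two0 mf (fun x => ltac:(rewrite lee_fin;
  exact: f0)).
rewrite ger0_norm// in E.
have ms : measurable_fun setT (fun x : R => f (2 * x)).
  by apply/measurable_EFinP; apply: (measurableT_comp mf);
    exact: measurable_funM.
pose D := `[(b / 2), b[%classic : set R.
have mD : measurable D by exact: measurable_itv.
have muD : mu D = (b / 2)%:E.
  rewrite /D lebesgue_measure_itv/= lte_fin ltr_pdivrMr// ltr_pMr// ltr1n
    -EFinB.
  by congr EFin; field.
have mI : measurable_fun setT (\1_D : R -> R) by exact: measurable_indic.
have bi0 : 0 <= b^-1 by rewrite invr_ge0 ltW.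
have E1 : (\int[mu]_x (2%:E * (f (2 * x)%R)%:E) = \int[mu]_x (f x)%:E)%E.
  rewrite ge0_integralZl_EFin//; last 2 first.
  - by move=> x _; rewrite lee_fin.
  - exact/measurable_EFinP.
  by rewrite E muleA -EFinM mulfV// mul1e.
have E2 : (\int[mu]_x (b^-1%:E * (\1_D x)%:E) = (2^-1)%:E)%E.
  rewrite ge0_integralZl_EFin//; last exact/measurable_EFinP.
  transitivity (b^-1%:E * mu D)%E; first by rewrite integral_indic// setIT.
  by rewrite muD -EFinM; congr EFin; field; rewrite gt_eqF.
have le : (\int[mu]_x (2%:E * (f (2 * x)%R)%:E + b^-1%:E * (\1_D x)%:E) <=
  \int[mu]_x (f x)%:E)%E.
  apply: le_integral_ge0 => x.
    by rewrite -!EFinM -EFinD lee_fin addr_ge0// mulr_ge0// indicE.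
  rewrite -!EFinM -EFinD lee_fin /f !indicE.
  have [xD|xD] := boolP (x \in D).
    move: xD; rewrite inE /D/= in_itv/= => /andP[x1 x2].
    have x0 : 0 < x by apply: lt_le_trans x1; rewrite divr_gt0.
    rewrite memNset/=; last by rewrite in_itv/= => /andP[_]; apply/negP;
      rewrite -leNgt; lra.
    rewrite mem_set/=; last by rewrite in_itv/= x0.
    by rewrite mul0r mulr0 add0r mulr1 mul1r lef_pV2 ?posrE// ltW.
  rewrite mulr0 addr0; have [x2|_] := boolP (2 * x \in _); last first.
    by rewrite mul0r mulr0; have := f0 x; rewrite /f indicE.
  move: x2; rewrite inE/= in_itv/= => /andP[x1 x2].
  have x0 : 0 < x by lra.
  rewrite mem_set/=; last by rewrite in_itv/= x0; lra.
  by rewrite !mul1r invfM mulrA mulfV// mul1r.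
move: le; rewrite ge0_integralD//; last 4 first.
- by move=> x _; rewrite -EFinM lee_fin mulr_ge0.
- by apply/measurable_EFinP; exact: measurable_funM.
- by move=> x _; rewrite -EFinM lee_fin mulr_ge0// indicE.
- by apply/measurable_EFinP; exact: measurable_funM.
rewrite E1 E2.
have I0 : (0 <= \int[mu]_x (f x)%:E)%E by apply: integral_ge0 => x _;
  rewrite lee_fin.
case: (\int[mu]_x (f x)%:E)%E I0 => [v|//|//] _.
by rewrite -EFinD lee_fin gerDl => h; exfalso; move: h; apply/negP;
  rewrite -ltNge invr_gt0.
Qed.

Lemma lorentz_norm_power_decay (q p c a : R) (G : R -> \bar R) :
  1 <= q -> 1 <= p -> 0 < c -> a * q <= 1 ->
  (forall t, 1 <= t -> ((c * t `^ (- a))%:E <= G t)%E) ->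
  lorentz_norm q p G = +oo%E.
Proof.
move=> q1 p1 c0 aq GE; have q0 : 0 < q := lt_le_trans ltr01 q1.
have p0 : 0 < p := lt_le_trans ltr01 p1.
(* For l < c / 2 one has (c/l)^q >= 2, so the interval [1, (c/l)^q[ has length at least (c/l)^q / 2;
   raised to p/q and multiplied by l^p, this gives exactly [A]. *)
pose A := c `^ p * 2 `^ (- (p / q)).
have A0 : 0 < A by rewrite mulr_gt0 ?powR_gt0.
rewrite /lorentz_norm.
set I := (X in (X `^ p^-1)%E); suff -> : I = +oo%E by rewrite poweRyr//
  invr_neq0// gt_eqF.
apply/eqP; rewrite -leye_eq.
have b0 : 0 < c / 2 by rewrite divr_gt0.
have mf : measurable_fun setT (fun x : R => \1_(`]0,
  (c / 2)[%classic) x * x^-1).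
  apply: measurable_funM; last exact: measurable_inv.
  by apply: measurable_indic; exact: measurable_itv.
have f0 x : 0 <= \1_(`]0, (c / 2)[%classic) x * x^-1 :> R.
  rewrite indicE; case: (boolP (x \in _)); rewrite ?mul0r// inE/= in_itv/= mul1r
    invr_ge0.
  by case/andP => /ltW.
have <- : (\int[mu]_x (A%:E * (\1_(`]0, (c / 2)[%classic) x * x^-1)%:E) =
  +oo)%E.
  rewrite ge0_integralZl_EFin//; last 3 first.
  - by move=> x _; rewrite lee_fin.
  - exact/measurable_EFinP.
  - exact: ltW.
  by rewrite integral_invr_itv// gt0_muley// lte_fin.
rewrite /I [leRHS]integral_mkcond; apply: le_integral_ge0 => l.
  by rewrite -EFinM lee_fin mulr_ge0// ltW.
rewrite patchE indicE; case: (boolP (l \in `]0, (c / 2)[%classic)) => [|_];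
  last first.
  rewrite mul0r mule0; case: ifPn => // lp.
  move: lp; rewrite inE/= in_itv/= andbT => l0.
  by rewrite !mule_ge0 ?lee_fin ?powR_ge0 ?poweR_ge0 ?invr_ge0 ?ltW.
rewrite inE/= in_itv/= => /andP[l0 lc].
rewrite mem_set/= ?in_itv/= ?l0// mul1r.
have cl2 : 2 <= c / l by rewrite ler_pdivlMr// -ler_pdivlMl// mulrC ltW.
have cl1 : 1 <= c / l by lra.
have cl0 : 0 < c / l by rewrite divr_gt0.
have clq : 2 <= (c / l) `^ q.
  by apply: le_trans cl2 _; rewrite -[leLHS]powRr1 ?(ltW cl0)// ler_powR.
(* As t >= 1 and a <= 1/q, t^a is at most t^(1/q), hence below c / l on this interval. Equality a q
   = 1 is allowed, which is what excludes the endpoint in the theorem. *)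
have sub : `[1%R, ((c / l) `^ q)[%classic `<=` [set t | (l%:E < G t)%E].
  move=> t /=; rewrite in_itv/= => /andP[t1 tc]; apply: lt_le_trans (GE t t1).
  have t0 : 0 < t := lt_le_trans ltr01 t1.
  rewrite lte_fin powRN ltr_pdivlMr ?powR_gt0// -ltr_pdivlMl// mulrC.
  apply: (@le_lt_trans _ _ (t `^ q^-1)).
    by apply: ler_powR => //; rewrite -[q^-1]mul1r ler_pdivlMr.
  have -> : c / l = ((c / l) `^ q) `^ q^-1.
    by rewrite -powRrM mulfV ?gt_eqF// powRr1// ltW.
  by apply: gt0_ltr_powR; rewrite ?invr_gt0 ?nnegrE ?powR_ge0 ?(ltW t0).
have mulow : (((c / l) `^ q / 2)%:E <= mu [set t | (l%:E < G t)%E])%E.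
  apply: le_trans (le_lebesgue_measure sub).
  rewrite lebesgue_measure_itv/= lte_fin ifT; last by apply: lt_le_trans clq;
    rewrite ltr1n.
  by rewrite -EFinB lee_fin; lra.
apply: (@le_trans _ _ ((l `^ p)%:E * ((c / l) `^ q / 2)%:E `^ (p / q) *
  (l^-1)%:E)%E).
  rewrite poweR_EFin -!EFinM lee_fin le_eqVlt; apply/orP; left; apply/eqP.
  rewrite /A; congr (_ * _).
  have -> : ((c / l) `^ q / 2) `^ (p / q) = (c / l) `^ p * 2 `^ (- (p / q)).
    rewrite powRM ?powR_ge0 ?invr_ge0//; congr (_ * _).
      by rewrite -powRrM; congr (_ `^ _); field; rewrite gt_eqF.
    by rewrite -powR_inv1// -powRrM mulN1r.
  rewrite mulrA -powRM ?(ltW l0) ?(ltW cl0)//; congr (_ `^ _ * _).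
  by field; rewrite gt_eqF.
apply: lee_wpmul2r; first by rewrite lee_fin invr_ge0 ltW.
apply: lee_wpmul2l; first by rewrite lee_fin powR_ge0.
apply: gt0_ler_poweR; last exact: mulow.
- by rewrite divr_ge0 ?ltW.
- by rewrite in_itv/= leey andbT lee_fin divr_ge0 ?powR_ge0.
- by rewrite in_itv/= leey andbT measure_ge0.
Qed.

End lorentz.

(** * Admissibility of the source and the final contradiction *)

Section counterexample.
Context {R : realType} (n : nat).
Local Notation mu := (@lebesgue_measure R).
Local Notation leb n := (@lebesgue_rV R n).
Local Notation toC x := ((x : R)%:C%C).

Lemma sourceE (s : R) : source (n := n) s =
  if s \in pulse n then @wave_data R n else cst 0.
Proof.
apply/funext => x; rewrite /source indicE; case: (s \in _);
  first by rewrite [toC _]rmorph1 mul1r.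
by rewrite [toC _]rmorph0 mul0r.
Qed.

Lemma source_hatE (s : R) : source_hat (n := n) s =
  if s \in pulse n then (fun xi : 'rV[R]_n => toC (wave_hat xi)) else cst 0.
Proof.
apply/funext => x; rewrite /source_hat indicE; case: (s \in _);
  first by rewrite [toC 1%:R]rmorph1 mul1r.
by rewrite [toC 0%:R]rmorph0 mul0r.
Qed.

Lemma measurable_indic_pulse : measurable_fun setT (\1_(pulse n) : R -> R).
Proof. by apply: measurable_indic; exact: measurable_pulse. Qed.

Lemma cmeasurable_source : cmeasurable (fun z : R * 'rV[R]_n => source z.1 z.2).
Proof.
apply: cmeasurableM.
  by apply: cmeasurable_real; exact: (measurableT_comp measurable_indic_pulse).
by apply: (cmeasurable_comp (phi := snd) _ (cintegrable_measurable
  (cintegrable_wave_data n))).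
Qed.

Lemma cmeasurable_source_hat : cmeasurable (fun z : R * 'rV[R]_n =>
  source_hat z.1 z.2).
Proof.
apply: cmeasurableM.
  by apply: cmeasurable_real; exact: (measurableT_comp measurable_indic_pulse).
by apply: (cmeasurable_comp (phi := snd) _ (cintegrable_measurable
  (cintegrable_wave_hat n))).
Qed.

Lemma cintegrable_cst0 : cintegrable (leb n) (cst (0 : R[i])).
Proof. by split; exact: integrable0. Qed.

Lemma is_spatial_fourier_source : is_spatial_fourier (@source R n) (@source_hat
  R n).
Proof.
split; first exact: cmeasurable_source_hat.
apply: nearW => t; rewrite sourceE source_hatE; case: ifPn => _.
  exact: is_fourier_wave.
split; first exact: cintegrable_cst0.
move=> phi _ _; transitivity (cintegral (leb n) (cst (0 : R[i]))).
  by apply: eq_cintegral => x; rewrite mul0r.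
by apply: eq_cintegral => x; rewrite mul0r.
Qed.

Lemma spatial_support_source : (0 < n)%N ->
  spatial_support_compact_away0 (@source_hat R n).
Proof.
move=> n0; have [K [cK K0 Kout _]] := @wave_hat_support R n n0.
exists K; split => //; apply: nearW => t; apply: nearW => xi /Kout h.
by rewrite /source_hat h mulr0.
Qed.

(** As |f| <= 1 and b >= 1, |f|^b is at most the integrable |f|. In time the norm is a multiple of
    the indicator of a bounded interval, finite for every a; a = +oo occurs when the time exponent
    is dual to 1. *)
Lemma mixed_norm_source (a b : \bar R) : (0 < n)%N -> (1 <= a)%E ->
  (1 <= b)%E -> b != +oo%E ->
  (mixed_norm a b (@source R n) < +oo)%E.
Proof.
move=> n0; case: b => [b|//|//] a1; rewrite lee_fin => b1 _; have b0 : 0 < b :=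
  lt_le_trans ltr01 b1.
have mf := cintegrable_measurable (@cintegrable_wave_data R n).
pose nu := cLnorm (leb n) b%:E (@wave_data R n).
have nu0 : (0 <= nu)%E by exact: Lnorm_ge0.
have nuoo : (nu < +oo)%E.
  rewrite /nu /cLnorm unlock; apply: poweR_lty.
  apply: le_lt_trans (cintegrable_lty (@cintegrable_wave_data R n)).
  apply: ge0_le_integral => //.
  - by move=> x _; exact: poweR_ge0.
  - apply: (measurableT_comp (measurable_poweR b)); apply: measurableT_comp =>
    //.
    exact/measurable_EFinP/measurable_normc.
  - exact/measurable_EFinP/measurable_normc.
  move=> x _; rewrite /= ger0_norm ?normc_ge0// lee_fin.
  have [->|f0] := eqVneq (normc (wave_data x)) 0;
    first by rewrite powR0// gt_eqF.
  rewrite -[leRHS]powRr1 ?normc_ge0//; apply: ger_powR => //.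
  by rewrite normc_wave_data_le1 lt_neqAle eq_sym f0 normc_ge0.
have cE s : cLnorm (leb n) b%:E (source (n := n) s) = (\1_(pulse n) s * fine
  nu)%:E.
  rewrite sourceE indicE; case: (s \in _).
    by rewrite mul1r fineK// ge0_fin_numE.
  rewrite mul0r /cLnorm.
  under eq_fun do rewrite Normc.normc0.
  by rewrite Lnorm0// eqe gt_eqF.
rewrite /mixed_norm; under eq_fun do rewrite cE.
have fn0 : 0 <= fine nu by rewrite fine_ge0.
case: a a1 => [a|_|//]; last first.
  rewrite unlock; case: ifPn => _ //; apply: le_lt_trans (ltry (fine nu)).
  apply/ess_supP; apply: nearW => s; rewrite /= lee_fin ger0_norm ?mulr_ge0
    ?indicE//.
  by rewrite ler_piMl// lern1; case: (_ \in _).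
rewrite lee_fin => a1; have a0 : 0 < a := lt_le_trans ltr01 a1.
rewrite unlock; apply: poweR_lty.
have mI := measurable_indic_pulse.
under eq_integral => s _.
  rewrite (_ : _ `^ a = (fine nu `^ a)%:E * (\1_(pulse n) s)%:E)%E; last first.
    rewrite gee0_abs; last by rewrite lee_fin mulr_ge0// indicE.
    rewrite poweR_EFin -EFinM indicE; case: (s \in _);
      first by rewrite mul1r mulr1.
    by rewrite mul0r mulr0 powR0// gt_eqF.
  over.
rewrite ge0_integralZl_EFin//; last 2 first.
- exact/measurable_EFinP.
- exact: powR_ge0.
have -> : (\int[mu]_x (\1_(pulse n) x)%:E = mu (pulse n))%E.
  by rewrite integral_indic ?setIT//; exact: measurable_pulse.
by rewrite (lebesgue_pulse n0) -EFinM ltry.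
Qed.

End counterexample.

Theorem proposition3p1 (R : realType) (d : nat) (q qt p : R) (r rt : \bar R)
    (hd : (2 <= d)%N) (hq : 1 <= q) (hqt : 1 <= qt)
    (hr : (2%:E <= r)%E) (hrt : (2%:E <= rt)%E) (hp : 1 <= p)
    (hest : exists2 C : R, 0 < C &
      forall F Fhat : R -> 'rV[R]_d -> R[i],
        cmeasurable (fun z : R * 'rV[R]_d => F z.1 z.2) ->
        (mixed_norm (hoelder_conjugate qt%:E) (hoelder_conjugate rt) F
          < +oo)%E ->
        is_spatial_fourier F Fhat ->
        spatial_support_compact_away0 Fhat ->
        duhamel_converges Fhat ->
        (lorentz_mixed_norm q p r (duhamel Fhat)
          <= C%:E * mixed_norm (hoelder_conjugate qt%:E)
                      (hoelder_conjugate rt) F)%E) :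
  ((q^-1)%:E < (d%:R - 1)%:E * ((2^-1)%:E - r^-1))%E.
Proof.
have d0 : (0 < d)%N := ltnW hd.
have [rE rho0 rho1] := inve_ge2 hr.
have [C C0 est] := hest.
rewrite rE -EFinB -EFinM lte_fin ltNge; apply/negP => aq.
have fin : (mixed_norm (hoelder_conjugate qt%:E) (hoelder_conjugate rt)
    (@source R d) < +oo)%E.
  apply: mixed_norm_source => //.
  - by apply: hoelder_conj_ge1; rewrite lee_fin.
  - apply: hoelder_conj_ge1; by apply: le_trans hrt; rewrite lee_fin ler1n.
  (* An infinite dual exponent would force [rt] to be 1, against [rt >= 2]. *)
  - apply/eqP => /hoelder_conjugate_eqy rt1; move: hrt.
    by rewrite rt1 lee_fin; lra.
have := est _ _ (@cmeasurable_source R d) fin (@is_spatial_fourier_source R d)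
  (spatial_support_source d0) (duhamel_converges_source d0).
have [c c0 low] := duhamel_source_lower_bound hd hr.
rewrite /lorentz_mixed_norm (lorentz_norm_power_decay hq hp c0 _ low); last first.
  rewrite -ler_pdivlMr ?(lt_le_trans ltr01)// mul1r.
  by apply: le_trans aq; rewrite -subn1 natrB// ltnW.
by apply/negP; rewrite -ltNge lte_mul_pinfty// lee_fin ltW.
Qed.
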